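(* Let $1\leq p,q\leq\infty$, let $\phi\in\mathcal{C}$, and suppose $\lim_{n\to\infty}\|z^n\|_{p,q,\phi}^{1/n}=\infty$. Let $\mu$ be a positive Borel measure on $(0,\infty)$. Then the Hausdorff operator $\mathcal{H}_\mu$ is compact on $F_\phi^{p,q}$ if and only if $$\mu((0,1])=0\quad\text{and}\quad\int_{(0,\infty)}\frac{1}{t}\,d\mu(t)<\infty.$$
   Context: $H(\mathbb{C})$ denotes the space of entire functions. Let $\phi:[0,\infty)\to\mathbb{R}^+$ be continuously differentiable, extended radially to $\mathbb{C}$ by $\phi(z)=\phi(|z|)$. It is called a weight if $\int_0^\infty e^{-q\phi(r)}r\,dr<\infty$ for the exponent $q$ under consideration, $0<q<\infty$ (when the space considered has $q=\infty$, the integral condition is understood for some finite exponent). A weight $\phi$ belongs to the class $\mathcal{C}$ if $\lim_{r\to\infty}r\phi'(r)=\infty$. For $f\in H(\mathbb{C})$ and $0\le r<\infty$ let $M_p(f,r)=\left(\frac{1}{2\pi}\int_0^{2\pi}|f(re^{i\theta})|^p\,d\theta\right)^{1/p}$ for $0<p<\infty$ and $M_\infty(f,r)=\sup_{|z|=r}|f(z)|$. For $0<p\le\infty$, the weighted mixed norm Fock space $F_\phi^{p,q}$ consists of all $f\in H(\mathbb{C})$ with $\|f\|_{p,q,\phi}<\infty$, where $\|f\|_{p,q,\phi}^q=\int_0^\infty M_p^q(f,r)e^{-q\phi(r)}r\,dr$ if $0<q<\infty$, and $\|f\|_{p,\infty,\phi}=\sup_{r\in[0,\infty)}M_p(f,r)e^{-\phi(r)}$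 if $q=\infty$. For $1\le p,q\le\infty$ it is a Banach space. Here $\|z^n\|_{p,q,\phi}$ is the norm of the monomial $z\mapsto z^n$. For a positive Borel measure $\mu$ on $(0,\infty)$, the Hausdorff operator is defined formally by $\mathcal{H}_\mu f(z)=\int_{(0,\infty)}\frac{1}{t}f\left(\frac{z}{t}\right)d\mu(t)$, $z\in\mathbb{C}$, for $f\in H(\mathbb{C})$. Saying that $\mathcal{H}_\mu$ is compact on $F_\phi^{p,q}$ means that this formula defines a compact linear operator from $F_\phi^{p,q}$ to itself. *)

(* Defs.v *)
From HB Require Import structures.
From mathcomp Require Import all_boot all_order all_algebra.
From mathcomp Require Import complex.
From mathcomp Require Import all_classical all_reals all_analysis.

Set Implicit Arguments.
Unset Strict Implicit.
Unset Printing Implicit Defensive.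

Import Order.TTheory GRing.Theory Num.Theory.
Import numFieldNormedType.Exports.

Local Open Scope classical_set_scope.
Local Open Scope ring_scope.
Local Open Scope complex_scope.

Section HausdorffFock.
Context {R : realType}.
Implicit Types (p q : \bar R) (phi : R -> R) (f : R[i] -> R[i]) (r : R).
Implicit Types (mu : {measure set (measurableTypeR R) -> \bar R}).

Definition cabs (z : R[i]) : R := ComplexField.Normc.normc z.

(* [derivable] is taken over the field R[i], so this is complex
   differentiability. *)
Definition entire f : Prop :=
  forall z : R[i], derivable (f : R[i]^o -> R[i]^o) z 1.

(* Functions on [0, +oo[ are represented by total functions R -> R, of which
   only the values on [0, +oo[ matter; at 0 the derivative is one-sided. *)
Definition C1_halfline phi : Prop :=
  exists dphi : R -> R,
    {within `[0, +oo[, continuous dphi} /\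
    forall r, 0 <= r ->
      (phi s - phi r) / (s - r) @[s --> within `[0, +oo[ r^'] --> dphi r.

Definition weight_integrable (s : R) phi : Prop :=
  (\int[lebesgue_measure]_(r in `[0%R, +oo[) (expR (- (s * phi r)) * r)%:E
     < +oo)%E.

(* Weights may vanish, so that |z|^2 / 2 is one. For q = +oo, integrability is
   required for some finite exponent. *)
Definition is_weight q phi : Prop :=
  [/\ C1_halfline phi,
      forall r, 0 <= r -> 0 <= phi r &
      match q with
      | s%:E => weight_integrable s phi
      | _ => exists2 s : R, 0 < s & weight_integrable s phi
      end].

Definition classC q phi : Prop :=
  is_weight q phi /\ r * derive1 phi r @[r --> +oo] --> +oo.

Definition polar r (theta : R) : R[i] := (r * cos theta) +i* (r * sin theta).

(* The exponents p, q range over ]0, +oo]; the value at -oo is irrelevant. *)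
Definition integral_mean p f r : \bar R :=
  match p with
  | s%:E => (((2 * pi)^-1)%:E *
      \int[lebesgue_measure]_(theta in `[0%R, (2 * pi)%R])
        (cabs (f (polar r theta)) `^ s)%:E) `^ s^-1
  | +oo => ereal_sup [set (cabs (f z))%:E | z in [set z | cabs z = r]]
  | -oo => 0
  end%E.

Definition mixed_norm p q phi f : \bar R :=
  match q with
  | s%:E => (\int[lebesgue_measure]_(r in `[0%R, +oo[)
      (integral_mean p f r `^ s * (expR (- (s * phi r)) * r)%:E)) `^ s^-1
  | +oo => ereal_sup
      [set integral_mean p f r * (expR (- phi r))%:E | r in `[0%R, +oo[]
  | -oo => 0
  end%E.

Definition Fock p q phi : set (R[i] -> R[i]) :=
  [set f | entire f /\ (mixed_norm p q phi f < +oo)%E].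

(* Complex-valued Lebesgue integration, by real and imaginary parts. *)
Definition cintegrable mu (D : set R) (g : R -> R[i]) : Prop :=
  mu.-integrable D (fun t => (complex.Re (g t))%:E) /\
  mu.-integrable D (fun t => (complex.Im (g t))%:E).

Definition cintegral mu (D : set R) (g : R -> R[i]) : R[i] :=
  (\int[mu]_(t in D) complex.Re (g t)) +i* (\int[mu]_(t in D) complex.Im (g t)).

Definition hausdorff_integrand f (z : R[i]) (t : R) : R[i] :=
  (t^-1)%:C * f (z / t%:C).

(* A Borel measure on ]0, +oo[ is represented by a Borel measure on R, which is
   only ever evaluated on subsets of ]0, +oo[. *)
Definition hausdorff_defined mu f : Prop :=
  forall z : R[i], cintegrable mu `]0, +oo[ (hausdorff_integrand f z).

Definition hausdorff mu f : R[i] -> R[i] :=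
  fun z => cintegral mu `]0, +oo[ (hausdorff_integrand f z).

(* T restricts to a compact linear operator on the space V normed by N: bounded
   sequences are mapped to sequences with a convergent subsequence. *)
Definition compact_operator (V : set (R[i] -> R[i]))
    (N : (R[i] -> R[i]) -> \bar R) (T : (R[i] -> R[i]) -> R[i] -> R[i]) : Prop :=
  [/\ forall f, V f -> V (T f),
      forall (a : R[i]) f g, V f -> V g ->
        T (fun z => a * f z + g z) = (fun z => a * T f z + T g z) &
      forall u : nat -> R[i] -> R[i],
        (forall n, V (u n)) ->
        (exists B : R, forall n, (N (u n) <= B%:E)%E) ->
        exists sigma : nat -> nat, exists2 g, V g &
          {homo sigma : m n / (m < n)%N} /\
          N (fun z => T (u (sigma n)) z - g z) @[n --> \oo] --> 0%E].

Definition hausdorff_compact p q phi mu : Prop :=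
  (forall f, Fock p q phi f -> hausdorff_defined mu f) /\
  compact_operator (Fock p q phi) (mixed_norm p q phi) (hausdorff mu).

End HausdorffFock.

(* Main.v *)
Require Import Defs.
From HB Require Import structures.
From mathcomp Require Import all_boot all_order all_algebra.
From mathcomp Require Import complex ring lra.
From mathcomp Require Import all_classical all_reals all_analysis.
From mathcomp Require Import measurable_realfun.

Set Implicit Arguments.
Unset Strict Implicit.
Unset Printing Implicit Defensive.

Import Order.TTheory GRing.Theory Num.Theory.
Import numFieldNormedType.Exports.

Local Open Scope classical_set_scope.
Local Open Scope ring_scope.
Local Open Scope complex_scope.

(** The Hausdorff operator is diagonal on monomials: it multiplies z^n by the moment
    of order n, the integral of t^-(n+1) ([hausdorff_monomial]). This moment is at
    least the mass of ]0, 1], and for n = 0 it is the integral of 1/t.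

    Necessity. If the operator is defined on the constant function 1, then 1/t is
    integrable. If it is compact, the images of the normalized monomials converge
    along a subsequence. The norm dominates each Taylor coefficient
    ([cabs_coef_norm]), so all coefficients of the limit are zero, and the moments,
    which are the normalized coefficients of the images, tend to 0 along the
    subsequence. Hence the mass of ]0, 1] is zero ([null_of_compact]).

    Sufficiency. Suppose that the measure lives on ]1, +oo[ and that 1/t has the
    finite integral W. Integral means of an entire function increase with the radius
    ([le_mean_radius]), so the dilations z / t with t > 1 are contractions, and by
    Minkowski's inequality the operator has norm at most W ([mean_hausdorff_on]).
    Moreover, factors t close to 1 carry little mass, and for t >= l > 1 the value
    f (z / t) is given by the Taylor polynomial of f of large degree, up to a small
    multiple of the integral mean of f on the circle of z. Up to a small error in
    norm, the operator thus depends on finitely many Taylor coefficients only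
    ([hausdorff_approx]). A bounded sequence has a subsequence that converges locally
    uniformly to an element of the space ([normal_family]); the coefficients of the
    differences tend to 0, and so do the norms of their images ([compact_of_mass]).

    The function theory behind this starts from complex differentiability at every
    point. Goursat's theorem on a rectangle, transported by the exponential, shows
    that circle means of a function holomorphic on an annulus do not depend on the
    radius ([cmean_annulus]). The mean value property, Cauchy's formula, Taylor's
    formula with remainder ([taylor_remainder]) and Poisson's formula follow. That
    limits of entire functions and integrals depending on a parameter are entire is
    obtained from [chord_lipschitz], an inequality between values that is equivalent
    to holomorphy and passes to limits and integrals, in place of the theorems of
    Weierstrass and Morera. *)

(** * Modulus and derivative of complex functions *)

Arguments cabs {R} z : simpl never.

Section Modulus.
Context {R : realType}.
Implicit Types (z w : R[i]) (x y : R).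

Lemma cabsE z : `|z| = (cabs z)%:C.
Proof. by case: z => a b; rewrite normc_def. Qed.

Lemma cabs_ge0 z : 0 <= cabs z.
Proof. by case: z => a b; exact: sqrtr_ge0. Qed.

Lemma cabs0 : cabs (0 : R[i]) = 0.
Proof. exact: ComplexField.Normc.normc0. Qed.

Lemma cabs1 : cabs (1 : R[i]) = 1.
Proof. exact: ComplexField.Normc.normc1. Qed.

Lemma cabsM z w : cabs (z * w) = cabs z * cabs w.
Proof. exact: ComplexField.Normc.normcM. Qed.

Lemma cabsV z : cabs z^-1 = (cabs z)^-1.
Proof. exact: ComplexField.Normc.normcV. Qed.

Lemma cabsX z n : cabs (z ^+ n) = cabs z ^+ n.
Proof. by elim: n => [|n ih]; rewrite ?expr0 ?cabs1// !exprS cabsM ih. Qed.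

Lemma cabsN z : cabs (- z) = cabs z.
Proof. by apply: complexI; rewrite -!cabsE normrN. Qed.

Lemma cabs_distC z w : cabs (z - w) = cabs (w - z).
Proof. by rewrite -cabsN opprB. Qed.

Lemma cabsD z w : cabs (z + w) <= cabs z + cabs w.
Proof. by rewrite -lecR rmorphD/= -!cabsE ler_normD. Qed.

Lemma cabsB z w : cabs (z - w) <= cabs z + cabs w.
Proof. by rewrite -[cabs w]cabsN cabsD. Qed.

Lemma cabs_dist z w : cabs z - cabs w <= cabs (z - w).
Proof. by rewrite lerBlDr -{1}(subrK w z) cabsD. Qed.

Lemma cabs_eq0 z : (cabs z == 0) = (z == 0).
Proof. by rewrite -(inj_eq (@complexI R)) -cabsE normr_eq0. Qed.

Lemma cabs_gt0 z : (0 < cabs z) = (z != 0).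
Proof. by rewrite lt_def cabs_ge0 andbT cabs_eq0. Qed.

Lemma cabs_real x : cabs x%:C = `|x|.
Proof. by rewrite /cabs/= expr0n/= addr0 sqrtr_sqr. Qed.

Lemma cabs_imag x : cabs (0 +i* x) = `|x|.
Proof. by rewrite /cabs/= expr0n/= add0r sqrtr_sqr. Qed.

Lemma cabs_i : cabs ('i : R[i]) = 1.
Proof. by rewrite /cabs/= expr0n/= add0r expr1n sqrtr1. Qed.

Lemma Re_le_cabs z : `|complex.Re z| <= cabs z.
Proof. by rewrite -lecR -cabsE normc_ge_Re. Qed.

Lemma Im_le_cabs z : `|complex.Im z| <= cabs z.
Proof.
case: z => a b; rewrite -sqrtr_sqr /cabs/= ler_wsqrtr//.
by rewrite lerDr sqr_ge0.
Qed.

Lemma cabs_le_ReIm z : cabs z <= `|complex.Re z| + `|complex.Im z|.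
Proof.
rewrite {1}(complexE z) (le_trans (cabsD _ _))// cabsM cabs_i mul1r.
by rewrite !cabs_real.
Qed.

Lemma cabs_sum n (F : nat -> R[i]) :
  cabs (\sum_(k < n) F k) <= \sum_(k < n) cabs (F k).
Proof.
elim: n => [|n ih]; first by rewrite !big_ord0 cabs0.
by rewrite !big_ord_recr/= (le_trans (cabsD _ _))// lerD2r.
Qed.

Lemma cReD z w : complex.Re (z + w) = complex.Re z + complex.Re w.
Proof. by case: z w => [a b] [c d]. Qed.
Lemma cImD z w : complex.Im (z + w) = complex.Im z + complex.Im w.
Proof. by case: z w => [a b] [c d]. Qed.
Lemma cReN z : complex.Re (- z) = - complex.Re z.
Proof. by case: z. Qed.
Lemma cImN z : complex.Im (- z) = - complex.Im z.
Proof. by case: z. Qed.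
Lemma cReM z w : complex.Re (z * w) =
  complex.Re z * complex.Re w - complex.Im z * complex.Im w.
Proof. by case: z w => [a b] [c d]. Qed.
Lemma cImM z w : complex.Im (z * w) =
  complex.Re z * complex.Im w + complex.Im z * complex.Re w.
Proof. by case: z w => [a b] [c d]; rewrite /= [b * c]mulrC. Qed.

Lemma complex_ext z w : complex.Re z = complex.Re w ->
  complex.Im z = complex.Im w -> z = w.
Proof. by case: z w => [a b] [c d] /= -> ->. Qed.

End Modulus.

Section ComplexDerivative.
Context {R : realType}.
Implicit Types (F G : R[i] -> R[i]) (z w c L : R[i]).

(** Over R[i], [derivable] has complex-valued tolerances; the estimates below compare
    real numbers. *)
Definition cderiv F z L : Prop := forall e : R, 0 < e -> exists2 d : R, 0 < d &
  forall w, cabs w < d -> cabs (F (z + w) - F z - L * w) <= e * cabs w.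

Definition cderivable F z : Prop := exists L, cderiv F z L.

Definition ccont F z : Prop := forall e : R, 0 < e -> exists2 d : R, 0 < d &
  forall w, cabs w < d -> cabs (F (z + w) - F z) <= e.

Lemma derivableP_cderiv F z :
  derivable (F : R[i]^o -> R[i]^o) z 1 <-> cderivable F z.
Proof.
split=> [/cvg_ex[/= L FL]|[L FL]].
- exists L => e e0.
  have e0' : 0 < e%:C :> R[i] by rewrite ltcR.
  move/cvgrPdist_le : FL => /(_ _ e0').
  move=> -[/= d d0 dP].
  have dr : d = (complex.Re d)%:C by rewrite RRe_real// gtr0_real.
  exists (complex.Re d); first by rewrite -ltcR -dr.
  move=> w; rewrite -ltcR -dr -cabsE => wd.
  have [->|w0] := eqVneq w 0.
    by rewrite addr0 mulr0 subr0 subrr cabs0 mulr0.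
  have /= := dP w; rewrite sub0r normrN => /(_ wd w0).
  rewrite -[w *: 1]/(w * 1) mulr1 -[_ *: _]/(_ * _) cabsE lecR => H.
  have -> : F (z + w) - F z - L * w = - (w * (L - w^-1 * (F (w + z) - F z))).
    by rewrite mulrBr mulrA divff// mul1r [w + z]addrC; ring.
  by rewrite cabsN cabsM mulrC ler_wpM2r// cabs_ge0.
- apply/cvg_ex; exists L; apply/cvgrPdist_le => /= e e0.
  have er : e = (complex.Re e)%:C by rewrite RRe_real// gtr0_real.
  have e0' : 0 < complex.Re e by rewrite -ltcR -er.
  have [d d0 dP] := FL _ e0'.
  exists d%:C; first by rewrite /= ltcR.
  move=> w /=; rewrite sub0r normrN cabsE ltcR => wd w0.
  rewrite -[w *: 1]/(w * 1) mulr1 -[_ *: _]/(_ * _) cabsE er lecR.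
  have := dP w wd.
  have -> : F (z + w) - F z - L * w = - (w * (L - w^-1 * (F (w + z) - F z))).
    by rewrite mulrBr mulrA divff// mul1r [w + z]addrC; ring.
  by rewrite cabsN cabsM mulrC ler_pM2r// cabs_gt0.
Qed.

Lemma entireP F : entire F <-> forall z, cderivable F z.
Proof. by split=> h z; apply/derivableP_cderiv; exact: h. Qed.

Lemma cderivableD F G z : cderivable F z -> cderivable G z ->
  cderivable (fun w => F w + G w) z.
Proof.
move=> /derivableP_cderiv dF /derivableP_cderiv dG; apply/derivableP_cderiv.
exact: (derivableD dF dG).
Qed.

Lemma cderivableB F G z : cderivable F z -> cderivable G z ->
  cderivable (fun w => F w - G w) z.
Proof.
move=> /derivableP_cderiv dF /derivableP_cderiv dG; apply/derivableP_cderiv.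
exact: (derivableB dF dG).
Qed.

Lemma cderivableM F G z : cderivable F z -> cderivable G z ->
  cderivable (fun w => F w * G w) z.
Proof.
move=> /derivableP_cderiv dF /derivableP_cderiv dG; apply/derivableP_cderiv.
exact: (derivableM dF dG).
Qed.

Lemma cderivableV F z : F z != 0 -> cderivable F z ->
  cderivable (fun w => (F w)^-1) z.
Proof.
move=> Fz /derivableP_cderiv dF; apply/derivableP_cderiv.
exact: (derivableV Fz dF).
Qed.

Lemma cderivable_cst (c : R[i]) z : cderivable (fun=> c) z.
Proof. by apply/derivableP_cderiv; exact: derivable_cst. Qed.

Lemma cderivable_id z : cderivable id z.
Proof. by apply/derivableP_cderiv; exact: derivable_id. Qed.

Lemma cderivableX n z : cderivable (fun w => w ^+ n) z.
Proof.
elim: n => [|n ih].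
  under [X in cderivable X _]eq_fun do rewrite expr0; exact: cderivable_cst.
under [X in cderivable X _]eq_fun do rewrite exprS.
by apply: cderivableM => //; exact: cderivable_id.
Qed.

Lemma cderivable_near F G z (d : R) : 0 < d ->
  (forall w, cabs w < d -> F (z + w) = G (z + w)) ->
  cderivable F z -> cderivable G z.
Proof.
move=> d0 FG [L FL]; exists L => e e0; have [d' d'0 dP] := FL e e0.
exists (Num.min d d'); first by rewrite lt_min d0.
move=> w; rewrite lt_min => /andP[wd wd'].
have := FG 0; rewrite addr0 cabs0 => /(_ d0) <-.
by rewrite -FG//; exact: dP.
Qed.

Lemma cderiv_ccont F z : cderivable F z -> ccont F z.
Proof.
move=> [L FL] e e0; have [d d0 dP] := FL 1 ltr01.
have c0 : 0 < cabs L + 1 by rewrite ltr_wpDl// cabs_ge0.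
exists (Num.min d (e / (cabs L + 1))); first by rewrite lt_min d0 divr_gt0.
move=> w; rewrite lt_min => /andP[/dP]; rewrite mul1r => h1.
rewrite ltr_pdivlMr// => h2.
have -> : F (z + w) - F z = (F (z + w) - F z - L * w) + L * w by rewrite subrK.
rewrite (le_trans (cabsD _ _))// cabsM (le_trans _ (ltW h2))//.
by rewrite mulrDr mulr1 addrC [_ * cabs L]mulrC lerD2l.
Qed.

Lemma cderiv_comp F G z L M : cderiv F z L -> cderiv G (F z) M ->
  cderiv (G \o F) z (M * L).
Proof.
move=> FL GM e e0.
have [d0 d00 d0P] := FL 1 ltr01.
pose c := cabs L + 1.
have c0 : 0 < c by rewrite ltr_wpDl// cabs_ge0.
pose m := cabs M + 1.
have m0 : 0 < m by rewrite ltr_wpDl// cabs_ge0.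
have e20 : 0 < e / 2 by rewrite divr_gt0.
have [d1 d10 d1P] := GM (e / 2 / c) (divr_gt0 e20 c0).
have [d2 d20 d2P] := FL (e / 2 / m) (divr_gt0 e20 m0).
exists (Num.min (Num.min d0 d2) (d1 / c)); first by rewrite !lt_min d00 d20 divr_gt0.
move=> w; rewrite !lt_min => /andP[/andP[wd0 wd2] wd1].
pose v := F (z + w) - F z.
have vc : cabs v <= c * cabs w.
  rewrite /v -(subrK (L * w) (_ - _)) (le_trans (cabsD _ _))// cabsM.
  by rewrite /c mulrDl addrC lerD2l; exact: d0P.
have vd1 : cabs v < d1.
  by rewrite (le_lt_trans vc)// mulrC -ltr_pdivlMr.
have Fv : F (z + w) = F z + v by rewrite /v [RHS]addrC subrK.
rewrite /= Fv.
have -> : G (F z + v) - G (F z) - M * L * w =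
    (G (F z + v) - G (F z) - M * v) + M * (v - L * w) by ring.
rewrite (le_trans (cabsD _ _))// [leRHS](_ : _ = e / 2 * cabs w + e / 2 * cabs w); last first.
  by rewrite -mulrDl -splitr.
apply: lerD.
  apply: (le_trans (d1P _ vd1)).
  rewrite -mulrA ler_wpM2l ?divr_ge0 ?(ltW e0)//.
  by rewrite ler_pdivrMl.
rewrite cabsM (@le_trans _ _ (m * (e / 2 / m * cabs w)))//.
  by apply: ler_pM; rewrite ?cabs_ge0 ?d2P// /m lerDl.
by rewrite mulrA mulrCA mulfV ?gt_eqF// mulr1.
Qed.

Lemma entire_dilation F c : entire F -> entire (fun w => F (w * c)).
Proof.
move=> /entireP dF; apply/entireP => w; have [L FL] := dF (w * c).
exists (L * c); apply: (@cderiv_comp (fun w => w * c) F) => // e e0; exists 1 => // v _.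
have -> : (w + v) * c - w * c - c * v = 0 by ring.
by rewrite cabs0 mulr_ge0 ?cabs_ge0 ?(ltW e0).
Qed.

End ComplexDerivative.

(** * Goursat's theorem on rectangles *)

Section SegmentIntegral.
Context {R : realType}.
Implicit Types (f g : R -> R) (a b m : R).
Local Notation leb := (@lebesgue_measure R).

Definition segcont a b f : Prop := forall x, a <= x <= b -> {for x, continuous f}.

Lemma segcont_integrable a b f : segcont a b f ->
  leb.-integrable `[a, b] (EFin \o f).
Proof.
move=> cf; apply: continuous_compact_integrable; first exact: segment_compact.
by apply: continuous_in_subspaceT => x /set_mem; rewrite /= in_itv/=; exact: cf.
Qed.

Lemma seg_cst a b (c : R) : a <= b -> \int[leb]_(x in `[a, b]) c = c * (b - a).
Proof.
move=> ab; rewrite Rintegral_cst//= lebesgue_measure_itv/= lte_fin.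
have [ab'|] := ltP a b; first by rewrite -EFinB.
by move=> ba; rewrite (_ : b = a) ?subrr//; apply/eqP; rewrite eq_le ab ba.
Qed.

Lemma segcontS a b a' b' f : a <= a' -> b' <= b -> segcont a b f ->
  segcont a' b' f.
Proof.
by move=> aa bb cf x /andP[h1 h2]; apply: cf; rewrite (le_trans aa)//= (le_trans h2).
Qed.

Lemma seg_split a m b f : a <= m -> m <= b -> segcont a b f ->
  \int[leb]_(x in `[a, b]) f x =
  \int[leb]_(x in `[a, m]) f x + \int[leb]_(x in `[m, b]) f x.
Proof.
move=> am mb cf; have := segcont_integrable cf => fi.
have := @Rintegral_itvB R f (BLeft a) (BRight b) m fi.
rewrite !bnd_simp => /(_ am mb) H.
rewrite -(subrK (\int[leb]_(x in `[a, m]) f x) (\int[leb]_(x in `[a, b]) f x)).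
rewrite addrC; congr (_ + _); rewrite {}H.
apply: Rintegral_itv_obnd_cbnd.
have := segcont_integrable (segcontS am (lexx b) cf).
apply: integrableS => //.
by apply: subset_itv; rewrite bnd_simp.
Qed.

Lemma seg_bound a b f (c e : R) : a <= b -> segcont a b f ->
  (forall x, a <= x <= b -> `|f x - c| <= e) ->
  `|\int[leb]_(x in `[a, b]) f x - c * (b - a)| <= e * (b - a).
Proof.
move=> ab cf fe; rewrite -(seg_cst _ ab).
have ci : segcont a b (fun=> c) by move=> x _; exact: cvg_cst.
have ei : segcont a b (fun=> e) by move=> x _; exact: cvg_cst.
have fi := segcont_integrable cf.
rewrite -RintegralB//; last exact: (segcont_integrable ci).
have di : segcont a b (fun x => f x - c).
  by move=> x xab; apply: (@continuousB _ R^o) => //; [exact: cf|exact: ci].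
have dI := segcont_integrable di.
rewrite (le_trans (le_normr_Rintegral _ dI))// -(seg_cst _ ab).
apply: (le_Rintegral _ _ (segcont_integrable ei)) => //.
exact: (integrable_norm dI).
Qed.

End SegmentIntegral.

Section Bisection.
Context {R : realType}.

Lemma nested_segments (u : nat -> R) (h : R) : 0 <= h ->
  (forall n, u n <= u n.+1 <= u n + h / 2 ^+ n.+1) ->
  exists a, forall n, u n <= a <= u n + h / 2 ^+ n.
Proof.
move=> h0 hu.
have low n k : u n <= u (n + k)%N.
  elim: k => [|k ih]; first by rewrite addn0.
  by rewrite addnS (le_trans ih)//; have /andP[] := hu (n + k)%N.
have half n : h / 2 ^+ n = h / 2 ^+ n.+1 + h / 2 ^+ n.+1.
  by rewrite exprS; field; rewrite expf_neq0.
have upp n k : u (n + k)%N + h / 2 ^+ (n + k) <= u n + h / 2 ^+ n.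
  elim: k => [|k ih]; first by rewrite addn0.
  apply: le_trans ih; rewrite addnS [in leRHS]half addrA lerD2r.
  by have /andP[] := hu (n + k)%N.
have ub n : ubound (range u) (u n + h / 2 ^+ n).
  move=> _ [m _ <-]; have [mn|/ltnW nm] := leqP m n.
    rewrite -(subnKC mn) (le_trans (low m (n - m)%N))// lerDl divr_ge0//.
  rewrite -(subnKC nm); apply: le_trans (upp n (m - n)%N).
  by rewrite lerDl divr_ge0// exprn_ge0.
exists (sup (range u)) => n; apply/andP; split.
  by apply: ub_le_sup; [exists (u 0%N + h / 2 ^+ 0); exact: ub|exists n].
by apply: ge_sup => //; exists (u 0%N), 0%N.
Qed.

(** If the rectangle fails, one of its quarters fails; the nested failing quarters
    shrink to a point, where the local hypothesis is contradicted. *)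
Lemma rectangle_bisection (P : R -> R -> R -> R -> Prop) (x0 y0 h0 k0 : R) :
  0 <= h0 -> 0 <= k0 ->
  (forall x y h k, 0 <= h -> 0 <= k ->
     P x y h k -> P (x + h) y h k -> P x (y + k) h k -> P (x + h) (y + k) h k ->
     P x y (h + h) (k + k)) ->
  (forall a b, x0 <= a <= x0 + h0 -> y0 <= b <= y0 + k0 ->
     exists2 d : R, 0 < d & forall x y h k, 0 <= h -> 0 <= k ->
       x <= a <= x + h -> y <= b <= y + k -> h + k < d -> P x y h k) ->
  P x0 y0 h0 k0.
Proof.
move=> h00 k00 quarters local; apply: contrapT => nP.
pose H n := h0 / 2 ^+ n.
pose K n := k0 / 2 ^+ n.
have H0 n : 0 <= H n by rewrite divr_ge0// exprn_ge0.
have K0 n : 0 <= K n by rewrite divr_ge0// exprn_ge0.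
have HS n : H n = H n.+1 + H n.+1.
  by rewrite /H exprS; field; rewrite expf_neq0.
have KS n : K n = K n.+1 + K n.+1.
  by rewrite /K exprS; field; rewrite expf_neq0.
have step (np : nat * (R * R)) : exists p : R * R,
    ~ P np.2.1 np.2.2 (H np.1) (K np.1) ->
    [/\ ~ P p.1 p.2 (H np.1.+1) (K np.1.+1),
        np.2.1 <= p.1 <= np.2.1 + H np.1.+1 &
        np.2.2 <= p.2 <= np.2.2 + K np.1.+1].
  move: np => [n [x y]]/=; set h := H n.+1; set k := K n.+1.
  have [Pxy|] := pselect (P x y (H n) (K n)); first by exists (0, 0).
  have h_0 : 0 <= h := H0 _.
  have k_0 : 0 <= k := K0 _.
  rewrite HS KS -/h -/k => nPxy.
  have [P1|?] := pselect (P x y h k); last first.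
    by exists (x, y) => _; split; rewrite //= lexx lerDl.
  have [P2|?] := pselect (P (x + h) y h k); last first.
    by exists (x + h, y) => _; split; rewrite //= ?lexx ?lerDl ?h_0 ?k_0.
  have [P3|?] := pselect (P x (y + k) h k); last first.
    by exists (x, y + k) => _; split; rewrite //= ?lexx ?lerDl ?h_0 ?k_0.
  have [P4|?] := pselect (P (x + h) (y + k) h k); last first.
    by exists (x + h, y + k) => _; split; rewrite //= ?lexx ?lerDl ?h_0 ?k_0.
  by case: nPxy; exact: quarters.
have [nxt nxtP] := choice step.
pose s := fix s n := if n is n'.+1 then nxt (n', s n') else (x0, y0).
have sP n : ~ P (s n).1 (s n).2 (H n) (K n).
  elim: n => [|n ih]; first by rewrite /H /K/= expr0 !divr1.
  by have [] := nxtP (n, s n) ih.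
have [a aP] : exists a, forall n, (s n).1 <= a <= (s n).1 + H n.
  by apply: nested_segments => // n; have [] := nxtP (n, s n) (sP n).
have [b bP] : exists b, forall n, (s n).2 <= b <= (s n).2 + K n.
  by apply: nested_segments => // n; have [] := nxtP (n, s n) (sP n).
have [|| d d0 dP] := local a b.
- by have := aP 0%N; rewrite /H expr0 divr1.
- by have := bP 0%N; rewrite /K expr0 divr1.
pose N := Num.bound ((h0 + k0) / d).
apply: (sP N); apply: dP => //; rewrite /H /K -mulrDl ltr_pdivrMr ?exprn_gt0//.
rewrite mulrC -ltr_pdivrMr//.
apply: (@lt_trans _ _ N%:R).
  by apply: archi_boundP; rewrite divr_ge0 ?addr_ge0// ltW.
by rewrite -natrX ltr_nat ltn_expl.
Qed.

End Bisection.

Section Goursat.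
Context {R : realType}.
Implicit Types (F : R[i] -> R[i]) (x y h k t : R).
Local Notation leb := (@lebesgue_measure R).

(** The imaginary part of the integral of F along the boundary of the rectangle
   with corner x + iy and sides h, k. *)
Definition rect_flux F x y h k : R :=
  \int[leb]_(t in `[y, y + k])
     (complex.Re (F ((x + h) +i* t)) - complex.Re (F (x +i* t))) -
  \int[leb]_(t in `[x, x + h])
     (complex.Im (F (t +i* (y + k))) - complex.Im (F (t +i* y))).

Lemma ccont_Re_vert F x t : ccont F (x +i* t) ->
  {for t, continuous (fun s => complex.Re (F (x +i* s)))}.
Proof.
move=> cF; apply/cvgrPdist_le => /= e e0; have [d d0 dP] := cF e e0.
exists d => //= s ts.
have := dP (0 +i* (s - t)); rewrite cabs_imag distrC.
move=> /(_ ts); rewrite (_ : x +i* t + _ = x +i* s); last first.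
  by apply: complex_ext; rewrite ?cReD ?cImD/=; ring.
rewrite distrC => H.
by rewrite (le_trans _ H)// -cReN -cReD Re_le_cabs.
Qed.

Lemma ccont_Im_horiz F y t : ccont F (t +i* y) ->
  {for t, continuous (fun s => complex.Im (F (s +i* y)))}.
Proof.
move=> cF; apply/cvgrPdist_le => /= e e0; have [d d0 dP] := cF e e0.
exists d => //= s ts.
have := dP (s - t)%:C; rewrite cabs_real distrC.
move=> /(_ ts); rewrite (_ : t +i* y + _ = s +i* y); last first.
  by apply: complex_ext; rewrite ?cReD ?cImD/=; ring.
rewrite distrC => H.
by rewrite (le_trans _ H)// -cImN -cImD Im_le_cabs.
Qed.

(** The constant and linear parts of F have no flux, so only the remainder in the
    definition of the derivative contributes. *)
Lemma rect_flux_small F (a b : R) L (e : R) : 0 < e -> cderiv F (a +i* b) L ->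
  exists2 d : R, 0 < d & forall x y h k, 0 <= h -> 0 <= k ->
    (forall p q, x <= p <= x + h -> y <= q <= y + k -> ccont F (p +i* q)) ->
    x <= a <= x + h -> y <= b <= y + k -> h + k < d ->
    `|rect_flux F x y h k| <= e * (h + k) ^+ 2.
Proof.
move=> e0 FL; have [d d0 dP] := FL (e / 2) (divr_gt0 e0 (ltr0n _ 2)).
exists d => // x y h k h0 k0 cF /andP[xa ax] /andP[yb by_] hkd.
have E p q : x <= p <= x + h -> y <= q <= y + k ->
    cabs (F (p +i* q) - F (a +i* b) - L * ((p - a) +i* (q - b))) <= e / 2 * (h + k).
  move=> /andP[xp px] /andP[yq qy].
  have w : cabs ((p - a) +i* (q - b)) <= h + k.
    rewrite (le_trans (cabs_le_ReIm _))//=.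
    by apply: lerD; rewrite ler_norml; apply/andP; split; lra.
  have := dP _ (le_lt_trans w hkd).
  rewrite (_ : a +i* b + _ = p +i* q); last first.
    by apply: complex_ext; rewrite ?cReD ?cImD/=; ring.
  move=> /le_trans; apply.
  by rewrite ler_wpM2l// divr_ge0// ltW.
have diff p q p' q' : x <= p <= x + h -> y <= q <= y + k ->
    x <= p' <= x + h -> y <= q' <= y + k ->
    cabs (F (p +i* q) - F (p' +i* q') - L * ((p - p') +i* (q - q'))) <= e * (h + k).
  move=> px qy px' qy'.
  have -> : F (p +i* q) - F (p' +i* q') - L * ((p - p') +i* (q - q')) =
     (F (p +i* q) - F (a +i* b) - L * ((p - a) +i* (q - b))) -
     (F (p' +i* q') - F (a +i* b) - L * ((p' - a) +i* (q' - b))).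
    have -> : (p - p') +i* (q - q') =
              ((p - a) +i* (q - b)) - ((p' - a) +i* (q' - b)) :> R[i].
      by apply: complex_ext; rewrite ?(cReD, cReN) ?(cImD, cImN)/=; ring.
    by ring.
  rewrite (le_trans (cabsB _ _))//.
  have -> : e * (h + k) = e / 2 * (h + k) + e / 2 * (h + k).
    by rewrite -mulrDl -splitr.
  by rewrite lerD// E.
have V : `|\int[leb]_(t in `[y, y + k])
     (complex.Re (F ((x + h) +i* t)) - complex.Re (F (x +i* t))) -
     complex.Re L * h * (y + k - y)| <= e * (h + k) * (y + k - y).
  apply: seg_bound; first by rewrite lerDl.
    move=> t ty; apply: (@continuousB _ R^o); apply: ccont_Re_vert; apply: cF => //.
      by rewrite lexx lerDl h0.
    by rewrite lexx lerDl h0.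
  move=> t ty.
  have := diff (x + h) t x t; rewrite !lexx !lerDl h0 => /(_ isT ty isT ty).
  apply: le_trans.
  rewrite [leLHS](_ : _ = `|complex.Re (F ((x + h) +i* t) - F (x +i* t) -
      L * ((x + h - x) +i* (t - t)))|) ?Re_le_cabs//.
  rewrite !cReD !cReN !cReM/=; congr (`|_|); ring.
have W : `|\int[leb]_(t in `[x, x + h])
     (complex.Im (F (t +i* (y + k))) - complex.Im (F (t +i* y))) -
     complex.Re L * k * (x + h - x)| <= e * (h + k) * (x + h - x).
  apply: seg_bound; first by rewrite lerDl.
    move=> t tx; apply: (@continuousB _ R^o); apply: ccont_Im_horiz; apply: cF => //.
      by rewrite lexx lerDl k0.
    by rewrite lexx lerDl k0.
  move=> t tx.
  have := diff t (y + k) t y; rewrite !lexx !lerDl k0 => /(_ tx isT tx isT).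
  apply: le_trans.
  rewrite [leLHS](_ : _ = `|complex.Im (F (t +i* (y + k)) - F (t +i* y) -
      L * ((t - t) +i* (y + k - y)))|) ?Im_le_cabs//.
  rewrite !cImD !cImN !cImM/=; congr (`|_|); ring.
rewrite /rect_flux.
have -> : e * (h + k) ^+ 2 = e * (h + k) * (y + k - y) + e * (h + k) * (x + h - x) by ring.
set A := \int[leb]_(t in _) _ in V *; set B := \int[leb]_(t in _) _ in W *.
have -> : A - B = (A - complex.Re L * h * (y + k - y)) -
  (B - complex.Re L * k * (x + h - x)) by ring.
by rewrite (le_trans (ler_normB _ _))// lerD.
Qed.

Lemma rect_flux_quarters F x y h k : 0 <= h -> 0 <= k ->
  (forall p q, x <= p <= x + (h + h) -> y <= q <= y + (k + k) ->
     ccont F (p +i* q)) ->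
  rect_flux F x y (h + h) (k + k) =
  rect_flux F x y h k + rect_flux F (x + h) y h k +
  (rect_flux F x (y + k) h k + rect_flux F (x + h) (y + k) h k).
Proof.
move=> h0 k0 cF.
have cR p : x <= p <= x + (h + h) ->
    segcont y (y + (k + k)) (fun t => complex.Re (F (p +i* t))).
  by move=> px t ty; apply: ccont_Re_vert; exact: cF.
have cI q : y <= q <= y + (k + k) ->
    segcont x (x + (h + h)) (fun t => complex.Im (F (t +i* q))).
  by move=> qy t tx; apply: ccont_Im_horiz; exact: cF.
pose V p a l := \int[leb]_(t in `[a, a + l]) complex.Re (F (p +i* t)).
pose H q a l := \int[leb]_(t in `[a, a + l]) complex.Im (F (t +i* q)).
have fluxE a b h' k' : x <= a -> y <= b -> 0 <= h' -> 0 <= k' ->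
    a + h' <= x + (h + h) -> b + k' <= y + (k + k) ->
    rect_flux F a b h' k' =
    V (a + h') b k' - V a b k' - (H (b + k') a h' - H b a h').
  move=> xa yb h'0 k'0 ah bk.
  have ix p : a <= p <= a + h' -> x <= p <= x + (h + h).
    by move=> /andP[? ?]; apply/andP; split; lra.
  have iy q : b <= q <= b + k' -> y <= q <= y + (k + k).
    by move=> /andP[? ?]; apply/andP; split; lra.
  rewrite /rect_flux; congr (_ - _); rewrite RintegralB//;
    apply: segcont_integrable.
  - by apply: (segcontS yb bk (cR _ _)); apply: ix; rewrite lexx lerDl h'0.
  - by apply: (segcontS yb bk (cR _ _)); apply: ix; rewrite lexx lerDl h'0.
  - by apply: (segcontS xa ah (cI _ _)); apply: iy; rewrite lexx lerDl k'0.
  - by apply: (segcontS xa ah (cI _ _)); apply: iy; rewrite lexx lerDl k'0.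
have Vsplit p : x <= p <= x + (h + h) -> V p y (k + k) = V p y k + V p (y + k) k.
  move=> px; rewrite /V (@seg_split _ y (y + k)) ?addrA ?lerDl//.
  by have := cR p px; rewrite addrA.
have Hsplit q : y <= q <= y + (k + k) -> H q x (h + h) = H q x h + H q (x + h) h.
  move=> qy; rewrite /H (@seg_split _ x (x + h)) ?addrA ?lerDl//.
  by have := cI q qy; rewrite addrA.
have xh : x <= x + h by rewrite lerDl.
have yk : y <= y + k by rewrite lerDl.
have xhh : x + h <= x + (h + h) by rewrite addrA lerDl.
have ykk : y + k <= y + (k + k) by rewrite addrA lerDl.
have hh : 0 <= h + h by rewrite addr_ge0.
have kk : 0 <= k + k by rewrite addr_ge0.
have xhh' : x + h + h <= x + (h + h) by rewrite addrA.
have ykk' : y + k + k <= y + (k + k) by rewrite addrA.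
rewrite !fluxE// !Vsplit ?lexx ?lerDl ?hh// !Hsplit ?lexx ?lerDl ?kk//.
by rewrite !addrA; ring.
Qed.

(** The flux is additive under subdivision, and near a point of differentiability it
    is small compared with the squared size of the rectangle. *)
Lemma goursat F x y h k : 0 <= h -> 0 <= k ->
  (forall p q, x <= p <= x + h -> y <= q <= y + k -> cderivable F (p +i* q)) ->
  rect_flux F x y h k = 0.
Proof.
move=> h0 k0 dF; apply/eqP; rewrite -normr_le0; apply/ler_addgt0Pl => e e0.
rewrite addr0.
pose c := e / ((h + k) ^+ 2 + 1).
have c0 : 0 < c by rewrite divr_gt0// ltr_wpDl// sqr_ge0.
pose inside x' y' h' k' := [/\ x <= x', x' + h' <= x + h, y <= y' & y' + k' <= y + k].
pose P x' y' h' k' := inside x' y' h' k' ->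
  `|rect_flux F x' y' h' k'| <= c * (h' + k') ^+ 2.
have : P x y h k.
  apply: rectangle_bisection => //.
  - move=> x' y' h' k' h'0 k'0 P1 P2 P3 P4 [i1 i2 i3 i4].
    rewrite rect_flux_quarters//; last first.
      move=> p q /andP[? ?] /andP[? ?]; apply: cderiv_ccont; apply: dF;
      by apply/andP; split; lra.
    have -> : c * (h' + h' + (k' + k')) ^+ 2 =
      c * (h' + k') ^+ 2 + c * (h' + k') ^+ 2 +
      (c * (h' + k') ^+ 2 + c * (h' + k') ^+ 2) by ring.
    by do ?(rewrite (le_trans (ler_normD _ _))//; apply: lerD);
      [apply: P1|apply: P2|apply: P3|apply: P4]; split; lra.
  - move=> a b ax yb; have [L FL] := dF a b ax yb.
    have [d d0 dP] := rect_flux_small c0 FL.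
    exists d => // x' y' h' k' h'0 k'0 ax' yb' hkd [i1 i2 i3 i4].
    apply: dP => // p q /andP[? ?] /andP[? ?].
    by apply: cderiv_ccont; apply: dF; apply/andP; split; lra.
move=> /(_ _) /le_trans; apply; first by [].
rewrite /c mulrAC ler_pdivrMr ?ltr_wpDl ?sqr_ge0//.
by rewrite ler_wpM2l ?lerDl ?ltW.
Qed.

End Goursat.

(** * Polar coordinates and the exponential *)

Section Polar.
Context {R : realType}.
Implicit Types (F K : R[i] -> R[i]) (z w : R[i]) (r s t x y : R).

Lemma polarE r t : polar r t = r%:C * polar 1 t.
Proof. by apply: complex_ext; rewrite ?cReM ?cImM/= ?mul1r; ring. Qed.

Lemma cabs_polar r t : cabs (polar r t) = `|r|.
Proof.
rewrite /cabs/= !exprMn -mulrDr [in cos _ ^+ 2 + _]addrC addrC cos2Dsin2.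
by rewrite mulr1 sqrtr_sqr.
Qed.

Lemma polarM r s x y : polar r x * polar s y = polar (r * s) (x + y).
Proof.
by apply: complex_ext; rewrite ?cReM ?cImM/= ?cosD ?sinD; ring.
Qed.

Lemma polar_2pi r : polar r (2 * pi) = polar r 0.
Proof.
by rewrite /polar -mulr_natl !(mulr2n, mulrDl, mul1r) -mulr2n cos2pi sin2pi cos0 sin0.
Qed.

Definition cexp w : R[i] := polar (expR (complex.Re w)) (complex.Im w).

Lemma cexpD z w : cexp (z + w) = cexp z * cexp w.
Proof. by rewrite /cexp polarM cReD cImD expRD. Qed.

Lemma derive_small (f : R -> R) (a b e : R) : is_derive (0 : R) 1 f a -> f 0 = b ->
  0 < e -> exists2 d : R, 0 < d & forall h, `|h| < d -> `|f h - b - a * h| <= e * `|h|.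
Proof.
move=> [/cvg_ex[/= l fl] fa] f0 e0.
have al : a = l by rewrite -fa; exact: cvg_lim fl.
move/cvgrPdist_le : fl => /(_ e e0)[/= d d0 dP].
exists d => // h hd; have [->|h0] := eqVneq h 0.
  by rewrite f0 subrr mulr0 subrr normr0 mulr0.
have /= := dP h; rewrite sub0r normrN => /(_ hd h0).
rewrite -[h *: 1]/(h * 1) mulr1 addr0 -[_ *: _]/(_ * _) f0 -al => H.
have -> : f h - b - a * h = - (h * (a - h^-1 * (f h - b))).
  by rewrite mulrBr mulrA divff// mul1r; ring.
by rewrite normrN normrM mulrC ler_wpM2r.
Qed.

Lemma cexp_cderiv0 : cderiv cexp 0 1.
Proof.
move=> e e0.
have e4 : 0 < Num.min (e / 8) 1 by rewrite lt_min ltr01 divr_gt0.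
set c := Num.min (e / 8) 1 in e4.
have ce : c <= e / 8 by rewrite ge_min lexx.
have c1 : c <= 1 by rewrite ge_min lexx orbT.
have [d1 d10 d1P] := derive_small (is_derive_expR (0 : R)) erefl e4.
have [d2 d20 d2P] := derive_small (is_derive_cos (0 : R)) erefl e4.
have [d3 d30 d3P] := derive_small (is_derive_sin (0 : R)) erefl e4.
exists (Num.min (Num.min d1 d2) (Num.min d3 (c / 2))).
  by rewrite !lt_min d10 d20 d30 divr_gt0.
move=> w; rewrite !lt_min => /andP[/andP[w1 w2] /andP[w3 wc]].
have := d1P _ (le_lt_trans (Re_le_cabs w) w1).
have := d2P _ (le_lt_trans (Im_le_cabs w) w2).
have := d3P _ (le_lt_trans (Im_le_cabs w) w3).
have := Re_le_cabs w; have := Im_le_cabs w.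
rewrite expR0 sin0 cos0 !(oppr0, mul0r, addr0, mul1r).
set W := cabs w in wc *; set h := complex.Re w; set k := complex.Im w.
set E := expR h; set C := cos k; set S := sin k => kW hW HS HC HE.
have W0 : 0 <= W by exact: cabs_ge0.
have -> : cexp (0 + w) - cexp 0 - w = (E * C - 1 - h) +i* (E * S - k).
  rewrite add0r /cexp/= expR0 /polar/= cos0 sin0 -/h -/k -/E -/C -/S.
  by apply: complex_ext; rewrite ?(cReD, cReN) ?(cImD, cImN)/= -?/h -?/k; ring.
rewrite (le_trans (cabs_le_ReIm _))//=.
have cW : c * W <= c * W by [].
have HS' : `|S - k| <= c * W by rewrite (le_trans HS)// ler_wpM2l// ltW.
have HC' : `|C - 1| <= c * W by rewrite (le_trans HC)// ler_wpM2l// ltW.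
have HE' : `|E - 1 - h| <= c * W by rewrite (le_trans HE)// ler_wpM2l// ltW.
have E1 : `|E - 1| <= 2 * W.
  rewrite -(subrK h (E - 1)) (le_trans (ler_normD _ _))//.
  by rewrite mulr2n mulrDl mul1r lerD// (le_trans HE')// ler_piMl.
have S1 : `|S| <= 2 * W.
  rewrite -(subrK k S) (le_trans (ler_normD _ _))//.
  by rewrite mulr2n mulrDl mul1r lerD// (le_trans HS')// ler_piMl.
have W2c : 2 * W <= c by rewrite -ler_pdivlMl// mulrC ltW.
have C1 : `|C| <= 1 by rewrite ler_norml cos_geN1 cos_le1.
have P1 : `|E * C - 1 - h| <= c * W + c * W + c * W.
  have -> : E * C - 1 - h = (E - 1 - h) + (E - 1) * (C - 1) + (C - 1) by ring.
  rewrite (le_trans (ler_normD _ _))// lerD// (le_trans (ler_normD _ _))// lerD//.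
  rewrite normrM (@le_trans _ _ (1 * (c * W)))//; last by rewrite mul1r.
  by rewrite ler_pM// (le_trans E1)// (le_trans W2c).
have P2 : `|E * S - k| <= c * W + c * (2 * W).
  have -> : E * S - k = (S - k) + (E - 1) * S by ring.
  rewrite (le_trans (ler_normD _ _))// lerD// normrM ler_pM//.
  exact: le_trans E1 W2c.
rewrite (le_trans (lerD P1 P2))//.
have : c * W <= e / 8 * W by rewrite ler_wpM2r.
rewrite -/W; nra.
Qed.

Lemma cexp_cderiv w : cderiv cexp w (cexp w).
Proof.
move=> e e0; have m0 : 0 < cabs (cexp w) + 1 by rewrite ltr_wpDl// cabs_ge0.
have [d d0 dP] := cexp_cderiv0 (divr_gt0 e0 m0).
exists d => // v vd; have := dP v vd.
rewrite add0r cexpD.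
have -> : cexp w * cexp v - cexp w - cexp w * v = cexp w * (cexp v - 1 - 1 * v) by ring.
have -> : cexp 0 = 1.
  by rewrite /cexp/= /polar expR0 cos0 sin0 mulr1 mulr0.
rewrite cabsM => H.
apply: (@le_trans _ _ ((cabs (cexp w) + 1) * (e / (cabs (cexp w) + 1) * cabs v))).
  by apply: ler_pM; rewrite ?cabs_ge0// lerDl.
by rewrite mulrA mulrCA mulfV ?gt_eqF// mulr1.
Qed.

(** Joint continuity in the radius and the angle, in the form to which the
    compactness of the interval of angles applies. *)
Lemma near_polar K r0 t0 (e : R) : ccont K (polar r0 t0) -> 0 < e ->
  \forall t \near t0 & r \near r0, cabs (K (polar r t) - K (polar r0 t0)) <= e.
Proof.
move=> cK e0; have [d d0 dP] := cK e e0.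
have m0 : 0 < `|r0| + 1 by rewrite ltr_wpDl.
pose c := d / 4 / (`|r0| + 1).
have c0 : 0 < c by rewrite !divr_gt0.
have cr : (c + c) * (`|r0| + 1) = d / 2.
  by rewrite mulrDl /c divfK ?gt_eqF//; field.
have Hr : \forall r \near r0, `|r0 - r| < d / 2.
  by exists (d / 2) => //=; rewrite divr_gt0.
have Hc : \forall t \near t0, `|cos t0 - cos t| <= c.
  by have /cvgrPdist_le/(_ c c0) := @continuous_cos R t0.
have Hs : \forall t \near t0, `|sin t0 - sin t| <= c.
  by have /cvgrPdist_le/(_ c c0) := @continuous_sin R t0.
near=> t r.
have -> : K (polar r t) = K (polar r0 t0 + (polar r t - polar r0 t0)).
  by congr K; rewrite addrC subrK.
apply: dP.
have -> : polar r t - polar r0 t0 =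
    (r - r0)%:C * polar 1 t + r0%:C * (polar 1 t - polar 1 t0).
  by rewrite (polarE r) (polarE r0) rmorphB; ring.
rewrite (le_lt_trans (cabsD _ _))// !cabsM !cabs_real cabs_polar normr1 mulr1.
have H1 : `|r - r0| < d / 2 by rewrite distrC; near: r.
have H2 : cabs (polar 1 t - polar 1 t0) <= c + c.
  rewrite (le_trans (cabs_le_ReIm _))//= !mul1r.
  by apply: lerD; rewrite distrC; near: t.
rewrite [ltRHS](_ : d = d / 2 + d / 2); last by field.
rewrite ltr_leD// -cr mulrC ler_pM ?cabs_ge0// lerDl//.
Unshelve. all: by end_near. Qed.

End Polar.

(** * Means over circles *)

Section CircleMean.
Context {R : realType}.
Implicit Types (F G K : R[i] -> R[i]) (z w c : R[i]) (r s t : R).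
Local Notation leb := (@lebesgue_measure R).

Lemma pi2_gt0 : 0 < 2 * pi :> R.
Proof. by rewrite mulr_gt0// pi_gt0. Qed.

Lemma pi2_ge0 : 0 <= 2 * pi :> R.
Proof. exact: ltW pi2_gt0. Qed.

Definition avg (g : R -> R) : R :=
  (2 * pi)^-1 * \int[leb]_(t in `[0, 2 * pi]) g t.

Definition cmean r K : R[i] :=
  avg (fun t => complex.Re (K (polar r t))) +i*
  avg (fun t => complex.Im (K (polar r t))).

Definition circ r K := forall t, ccont K (polar r t).

Lemma avgB (g h : R -> R) : segcont 0 (2 * pi) g -> segcont 0 (2 * pi) h ->
  avg (fun t => g t - h t) = avg g - avg h.
Proof.
move=> cg ch; rewrite /avg -mulrBr; congr (_ * _).
by apply: RintegralB; [|exact: segcont_integrable|exact: segcont_integrable].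
Qed.

Lemma avgD (g h : R -> R) : segcont 0 (2 * pi) g -> segcont 0 (2 * pi) h ->
  avg (fun t => g t + h t) = avg g + avg h.
Proof.
move=> cg ch; rewrite /avg -mulrDr; congr (_ * _).
by apply: RintegralD; [|exact: segcont_integrable|exact: segcont_integrable].
Qed.

Lemma avgZ (a : R) (g : R -> R) : segcont 0 (2 * pi) g ->
  avg (fun t => a * g t) = a * avg g.
Proof.
move=> cg; rewrite /avg (RintegralZl _ _ (segcont_integrable cg))//.
by rewrite mulrCA.
Qed.

Lemma avg_cst (a : R) : avg (fun=> a) = a.
Proof.
by rewrite /avg seg_cst ?pi2_ge0// subr0 mulrC mulfK// gt_eqF// pi2_gt0.
Qed.

Lemma le_avg (g h : R -> R) : segcont 0 (2 * pi) g -> segcont 0 (2 * pi) h ->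
  (forall t, g t <= h t) -> avg g <= avg h.
Proof.
move=> cg ch gh; rewrite /avg ler_wpM2l ?invr_ge0 ?pi2_ge0//.
by apply: le_Rintegral => //; exact: segcont_integrable.
Qed.

Lemma avg_ge0 (g : R -> R) : (forall t, 0 <= g t) -> 0 <= avg g.
Proof.
move=> g0; rewrite /avg mulr_ge0 ?invr_ge0 ?pi2_ge0//.
by apply: Rintegral_ge0.
Qed.

Lemma eq_cmean r F G : (forall z, cabs z = `|r| -> F z = G z) ->
  cmean r F = cmean r G.
Proof.
by move=> FG; congr (avg _ +i* avg _); apply: funext => t; rewrite FG ?cabs_polar.
Qed.

Lemma ccontD F G z : ccont F z -> ccont G z -> ccont (fun w => F w + G w) z.
Proof.
move=> cF cG e e0; have e2 : 0 < e / 2 by rewrite divr_gt0.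
have [d d0 dP] := cF _ e2; have [d' d'0 dP'] := cG _ e2.
exists (Num.min d d'); first by rewrite lt_min d0.
move=> w; rewrite lt_min => /andP[/dP h1 /dP' h2].
have -> : F (z + w) + G (z + w) - (F z + G z) =
  (F (z + w) - F z) + (G (z + w) - G z) by ring.
by rewrite (le_trans (cabsD _ _))// [leRHS]splitr lerD.
Qed.

Lemma ccontZ c F z : ccont F z -> ccont (fun w => c * F w) z.
Proof.
move=> cF e e0; have c0 : 0 < cabs c + 1 by rewrite ltr_wpDl// cabs_ge0.
have [d d0 dP] := cF _ (divr_gt0 e0 c0).
exists d => // w /dP h; rewrite -mulrBr cabsM.
apply: (@le_trans _ _ ((cabs c + 1) * (e / (cabs c + 1)))).
  by rewrite ler_pM ?cabs_ge0// lerDl.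
by rewrite mulrC divfK// gt_eqF.
Qed.

Lemma circ_cabs r K : circ r K -> forall t,
  {for t, continuous (fun s => cabs (K (polar r s)))} /\
  {for t, continuous (fun s => complex.Re (K (polar r s)))} /\
  {for t, continuous (fun s => complex.Im (K (polar r s)))}.
Proof.
move=> cK t; have H (e : R) : 0 < e ->
    \forall s \near t, cabs (K (polar r s) - K (polar r t)) <= e.
  move=> e0; have := near_polar (cK t) e0.
  move=> [[A B] /= [HA HB] AB].
  near=> s; apply: (AB (s, r)); split => /=.
    by near: s.
  exact: nbhs_singleton.
have half (u : R[i] -> R) : (forall z w, `|u z - u w| <= cabs (z - w)) ->
    {for t, continuous (fun s => u (K (polar r s)))}.
  move=> hu; apply/cvgrPdist_le => /= e e0.
  near=> s; rewrite distrC (le_trans (hu _ _))//; near: s.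
  exact: H.
split; [|split]; apply: half => z w.
- by rewrite ler_norml lerNl opprB {1}cabs_distC !cabs_dist.
- by rewrite -cReN -cReD Re_le_cabs.
- by rewrite -cImN -cImD Im_le_cabs.
Unshelve. all: by end_near. Qed.

Lemma circ_Re r K : circ r K -> segcont 0 (2 * pi) (fun s => complex.Re (K (polar r s))).
Proof. by move=> cK t _; have [_ []] := circ_cabs cK t. Qed.

Lemma circ_Im r K : circ r K -> segcont 0 (2 * pi) (fun s => complex.Im (K (polar r s))).
Proof. by move=> cK t _; have [_ []] := circ_cabs cK t. Qed.

Lemma circ_abs r K : circ r K -> segcont 0 (2 * pi) (fun s => cabs (K (polar r s))).
Proof. by move=> cK t _; have [] := circ_cabs cK t. Qed.

Lemma cmeanD r F G : circ r F -> circ r G ->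
  cmean r (fun z => F z + G z) = cmean r F + cmean r G.
Proof.
move=> cF cG; apply: complex_ext; rewrite ?cReD ?cImD/= -avgD; do ?[exact: circ_Re|exact: circ_Im].
  by congr avg; apply: funext => t; rewrite cReD.
by congr avg; apply: funext => t; rewrite cImD.
Qed.

Lemma segcontZ a b (x : R) (g : R -> R) : segcont a b g -> segcont a b (fun t => x * g t).
Proof. by move=> cg t tab; apply: (@continuousM R R^o) => //; [exact: cvg_cst|exact: cg]. Qed.

Lemma cmeanZ r c F : circ r F -> cmean r (fun z => c * F z) = c * cmean r F.
Proof.
move=> cF; have cR := circ_Re cF; have cI := circ_Im cF.
apply: complex_ext; rewrite ?cReM ?cImM/= -!avgZ// -?avgB -?avgD; do ?exact: segcontZ.
  by congr avg; apply: funext => t; rewrite cReM.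
by congr avg; apply: funext => t; rewrite cImM.
Qed.

Lemma cmeanB r F G : circ r F -> circ r G ->
  cmean r (fun z => F z - G z) = cmean r F - cmean r G.
Proof.
move=> cF cG; rewrite -[- cmean r G]mulN1r -cmeanZ// -cmeanD//.
  by apply: eq_cmean => z _; rewrite mulN1r.
by move=> t; exact: ccontZ.
Qed.

Lemma cmean_cst r c : cmean r (fun=> c) = c.
Proof. by rewrite /cmean !avg_cst; case: c. Qed.

(** Rotating the mean onto the positive half-line makes it the mean of a real part. *)
Lemma cabs_cmean r K : circ r K -> cabs (cmean r K) <= avg (fun t => cabs (K (polar r t))).
Proof.
move=> cK; set m := cmean r K.
have [->|m0] := eqVneq m 0.
  by rewrite cabs0 avg_ge0// => t; exact: cabs_ge0.
have am0 : 0 < cabs m by rewrite cabs_gt0.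
pose c := (cabs m)%:C / m.
have c1 : cabs c = 1 by rewrite cabsM cabsV cabs_real ger0_norm ?cabs_ge0// divff// gt_eqF.
have -> : cabs m = complex.Re (c * m) by rewrite divfK.
rewrite -cmeanZ// /cmean/=; apply: le_avg.
- by apply: (@circ_Re r (fun z => c * K z)) => t; exact: ccontZ.
- exact: circ_abs.
- move=> t; rewrite (le_trans (ler_norm _))// (le_trans (Re_le_cabs _))//.
  by rewrite cabsM c1 mul1r.
Qed.

Lemma cmean_conj r K : circ r K -> cmean r (fun z => conjc (K z)) = conjc (cmean r K).
Proof.
move=> cK; apply: complex_ext => /=.
  by congr avg; apply: funext => t; case: (K _).
rewrite -mulN1r -avgZ; last exact: circ_Im.
by congr avg; apply: funext => t; case: (K _) => a b /=; rewrite mulN1r.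
Qed.

(** By compactness of the interval of angles, continuity is uniform in the angle. *)
Lemma near_circle r0 K (e : R) : circ r0 K -> 0 < e ->
  exists2 d : R, 0 < d & forall r t, `|r - r0| < d -> 0 <= t <= 2 * pi ->
    cabs (K (polar r t) - K (polar r0 t)) <= e.
Proof.
move=> cK e0; have /compact_near_coveringP := @segment_compact R 0 (2 * pi).
move=> /(_ R (nbhs r0) (fun r t => cabs (K (polar r t) - K (polar r0 t)) <= e)).
case.
- move=> t0 _; have e2 : 0 < e / 2 by rewrite divr_gt0.
  have := near_polar (cK t0) e2 => -[[A B] /= [HA HB] AB].
  exists (A, B) => // -[t r] /= [At Br].
  have -> : K (polar r t) - K (polar r0 t) =
    (K (polar r t) - K (polar r0 t0)) - (K (polar r0 t) - K (polar r0 t0)) by ring.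
  rewrite (le_trans (cabsB _ _))// [leRHS]splitr lerD//.
    exact: (AB (t, r)).
  by apply: (AB (t, r0)); split => //=; exact: nbhs_singleton.
- move=> d /= d0 dP; exists d => // r t rd t2; apply: dP => //.
  by rewrite /= distrC.
Qed.

Lemma cmean_near r0 K (e : R) : circ r0 K -> 0 < e ->
  exists2 d : R, 0 < d & forall r, circ r K -> `|r - r0| < d ->
    cabs (cmean r K - cmean r0 K) <= e.
Proof.
move=> cK e0; have e2 : 0 < e / 2 by rewrite divr_gt0.
have [d d0 dP] := near_circle cK e2; exists d => // r cr rd.
rewrite (le_trans (cabs_le_ReIm _))// [leRHS]splitr cReD cReN cImD cImN/=.
have bd (g h : R -> R) : segcont 0 (2 * pi) g -> segcont 0 (2 * pi) h ->
    (forall t, 0 <= t <= 2 * pi -> `|g t - h t| <= e / 2) ->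
    `|avg g - avg h| <= e / 2.
  move=> cg ch gh; rewrite -avgB// /avg normrM ger0_norm ?invr_ge0 ?pi2_ge0//.
  rewrite ler_pdivrMl ?pi2_gt0//.
  have cgh : segcont 0 (2 * pi) (fun t => g t - h t).
    by move=> t t2; apply: (@continuousB _ R^o); [exact: cg|exact: ch].
  have := @seg_bound R 0 (2 * pi) (fun t => g t - h t) 0 (e / 2) pi2_ge0 cgh.
  rewrite !(subr0, mul0r) [_ * (2 * pi)]mulrC; apply => t t2.
  by rewrite subr0 gh.
by apply: lerD; apply: bd; do ?[exact: circ_Re|exact: circ_Im];
  move=> t t2; rewrite -?cReN -?cReD -?cImN -?cImD;
  rewrite ?(le_trans (Re_le_cabs _))// ?(le_trans (Im_le_cabs _))// dP.
Qed.

End CircleMean.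

(** * Cauchy's formula *)

Section CauchyTheory.
Context {R : realType}.
Implicit Types (f F G K : R[i] -> R[i]) (z w c : R[i]) (r s t : R).
Local Notation leb := (@lebesgue_measure R).

Lemma circ_cderivable r K : (forall z, cabs z = `|r| -> cderivable K z) -> circ r K.
Proof. by move=> dK t; apply: cderiv_ccont; apply: dK; rewrite cabs_polar. Qed.

(** The exponential maps a rectangle of height 2 * pi onto the annulus; the fluxes
    through its horizontal sides cancel by periodicity, and those through its
    vertical sides are the two circle means. *)
Lemma avg_Re_annulus r s K : 0 < r -> r <= s ->
  (forall z, r <= cabs z <= s -> cderivable K z) ->
  avg (fun t => complex.Re (K (polar r t))) = avg (fun t => complex.Re (K (polar s t))).
Proof.
move=> r0 rs dK; have s0 := lt_le_trans r0 rs.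
have : rect_flux (K \o cexp) (ln r) 0 (ln s - ln r) (2 * pi) = 0.
  apply: goursat; rewrite ?pi2_ge0// ?subr_ge0 ?ler_ln// ?posrE//.
  move=> p q; rewrite addrC subrK => /andP[rp ps] _.
  have [L KL] : cderivable K (cexp (p +i* q)).
    apply: dK; rewrite cabs_polar/= ger0_norm ?expR_ge0//.
    by rewrite -{1}(lnK (x := r)) ?posrE// -(lnK (x := s)) ?posrE// !ler_expR rp.
  by exists (L * cexp (p +i* q)); apply: cderiv_comp => //; exact: cexp_cderiv.
rewrite /rect_flux add0r [ln r + _]addrC subrK.
rewrite [X in _ - X](_ : _ = 0) ?subr0; last first.
  rewrite (_ : (fun t => _) = fun=> 0); last first.
    by apply: funext => t /=; rewrite /cexp/= polar_2pi subrr.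
  by rewrite Rintegral_cst// mul0r.
rewrite /= /cexp/= !lnK ?posrE// => H.
have c x : r <= x <= s -> circ x K.
  move=> /andP[rx xs]; apply: circ_cderivable => z.
  by rewrite ger0_norm ?(le_trans (ltW r0))// => zx; apply: dK; rewrite zx rx.
apply/esym/eqP; rewrite -subr_eq0 -avgB; last 2 first.
- by apply: circ_Re; apply: c; rewrite rs lexx.
- by apply: circ_Re; apply: c; rewrite rs lexx.
by rewrite /avg H mulr0.
Qed.

Lemma cmean_annulus r s K : 0 < r -> r <= s ->
  (forall z, r <= cabs z <= s -> cderivable K z) -> cmean r K = cmean s K.
Proof.
move=> r0 rs dK; apply: complex_ext => /=; first exact: avg_Re_annulus.
have := @avg_Re_annulus r s (fun z => (- 'i) * K z) r0 rs.
have E x : (fun t => complex.Re (- 'i * K (polar x t))) =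
    (fun t => complex.Im (K (polar x t))).
  by apply: funext => t; case: (K _) => a b /=; ring.
rewrite !E; apply => z zrs; apply: cderivableM; first exact: cderivable_cst.
exact: dK.
Qed.

(** Circle means are constant in the radius on either side of the circle through
    z0, and they depend continuously on the radius; hence the exceptional point,
    which in the application is the base point of a difference quotient, does no
    harm. *)
Lemma cmean_disc r K z0 : 0 <= r -> (forall z, cabs z <= r -> ccont K z) ->
  (forall z, cabs z <= r -> z != z0 -> cderivable K z) -> cmean r K = K 0.
Proof.
move=> r0 cK dK.
have cc s : 0 <= s <= r -> circ s K.
  by move=> /andP[s0 sr] t; apply: cK; rewrite cabs_polar ger0_norm.
have ann s s' : 0 < s -> s <= s' -> s' <= r -> ~~ (s <= cabs z0 <= s') ->
    cmean s K = cmean s' K.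
  move=> s0 ss' s'r nz; apply: cmean_annulus => // z /andP[sz zs'].
  apply: dK; first exact: le_trans s'r.
  by apply: contraNneq nz => <-; rewrite sz.
have cm s (e : R) : 0 <= s <= r -> 0 < e -> exists2 d, 0 < d &
    forall s', 0 <= s' <= r -> `|s' - s| < d -> cabs (cmean s' K - cmean s K) <= e.
  move=> hs e0; have [d d0 dP] := cmean_near (cc s hs) e0.
  by exists d => // s' hs' s's; apply: dP => //; exact: cc.
have eq_lim x y : (forall e, 0 < e -> cabs (x - y) <= e) -> x = y :> R[i].
  move=> h; apply/eqP; rewrite -subr_eq0 -cabs_eq0 eq_le cabs_ge0 andbT.
  by apply/ler_addgt0Pl => e e0; rewrite addr0 h.
have -> : K 0 = cmean 0 K.
  rewrite -(cmean_cst 0 (K 0)); apply: eq_cmean => z.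
  by rewrite normr0 => /eqP; rewrite cabs_eq0 => /eqP ->.
have inner s : 0 <= s <= r -> s < cabs z0 \/ cabs z0 = 0 -> cmean s K = cmean 0 K.
  move=> /andP[s0 sr] sz; apply: eq_lim => e e0.
  have h0 : 0 <= (0 : R) <= r by rewrite lexx.
  have [d d0 dP] := cm 0 e h0 e0.
  move: s0; rewrite le_eqVlt => /predU1P[<-|s0].
    by rewrite subrr cabs0 ltW.
  have m0 : 0 < Num.min s (d / 2) by rewrite lt_min s0 divr_gt0.
  have ms : Num.min s (d / 2) <= s by rewrite ge_min lexx.
  rewrite -(ann (Num.min s (d / 2)))//; last first.
    case: sz => [sz|->]; first by rewrite (leNgt (cabs z0)) sz andbF.
    by rewrite leNgt m0.
  apply: dP; first by rewrite (ltW m0) (le_trans ms).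
  rewrite subr0 ger0_norm ?(ltW m0)// gt_min; apply/orP; right.
  by rewrite ltr_pdivrMr// ltr_pMr// ltr1n.
have [z00|z0n] := eqVneq (cabs z0) 0; first by apply: inner; [rewrite r0 lexx|right].
have zp : 0 < cabs z0 by rewrite lt_neqAle eq_sym z0n cabs_ge0.
have [rz|zr] := ltP r (cabs z0); first by apply: inner; [rewrite r0 lexx|left].
have hz : 0 <= cabs z0 <= r by rewrite (ltW zp).
have at_z0 : cmean (cabs z0) K = cmean 0 K.
  apply: eq_lim => e e0.
  have [d d0 dP] := cm (cabs z0) e hz e0.
  pose m := Num.max 0 (cabs z0 - d / 2).
  have mz : m < cabs z0 by rewrite gt_max zp ltrBlDr ltrDl divr_gt0.
  have m0 : 0 <= m by rewrite le_max lexx.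
  have mr : m <= r by rewrite ltW// (lt_le_trans mz).
  rewrite -(inner m); [|by rewrite m0|by left].
  rewrite cabs_distC; apply: dP; first by rewrite m0.
  rewrite distrC ger0_norm ?subr_ge0 ?(ltW mz)//.
  apply: (@le_lt_trans _ _ (d / 2)).
    by rewrite lerBlDr -lerBlDl le_max lexx orbT.
  by rewrite ltr_pdivrMr// ltr_pMr// ltr1n.
move: zr; rewrite le_eqVlt => /predU1P[<-//|zr].
rewrite -at_z0; apply: eq_lim => e e0.
have [d d0 dP] := cm (cabs z0) e hz e0.
pose m := Num.min r (cabs z0 + d / 2).
have mz : cabs z0 < m by rewrite lt_min zr ltrDl divr_gt0.
have mr : m <= r by rewrite ge_min lexx.
rewrite -(ann m)//; last by rewrite [m <= _]leNgt mz.
  apply: dP; first by rewrite mr ltW// (lt_trans zp).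
  rewrite ger0_norm ?subr_ge0 ?(ltW mz)//.
  apply: (@le_lt_trans _ _ (d / 2)).
    by rewrite lerBlDl ge_min lexx orbT.
  by rewrite ltr_pdivrMr// ltr_pMr// ltr1n.
exact: lt_trans mz.
Qed.

Definition slope f z0 L z : R[i] :=
  if z == z0 then L else (f z - f z0) / (z - z0).

Lemma slope_cderivable f z0 L z : (forall z, cderivable f z) -> z != z0 ->
  cderivable (slope f z0 L) z.
Proof.
move=> df zz0; apply: (@cderivable_near _ (fun w => (f w - f z0) / (w - z0)) _ _ (cabs (z - z0))).
- by rewrite cabs_gt0 subr_eq0.
- move=> w wz; rewrite /slope ifF//; apply/eqP => E.
  by move: wz; rewrite -E opprD addrA subrr sub0r cabsN ltxx.
- apply: cderivableM; first by apply: cderivableB => //; exact: cderivable_cst.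
  apply: cderivableV; first by rewrite subr_eq0.
  by apply: cderivableB; [exact: cderivable_id|exact: cderivable_cst].
Qed.

Lemma slope_ccont f z0 L : cderiv f z0 L -> ccont (slope f z0 L) z0.
Proof.
move=> fL e e0; have [d d0 dP] := fL e e0; exists d => // w wd.
rewrite /slope eqxx; have [->|w0] := eqVneq w 0.
  by rewrite addr0 eqxx subrr cabs0 ltW.
rewrite ifF; last by rewrite -subr_eq0 addrC addKr (negbTE w0).
have -> : z0 + w - z0 = w by rewrite addrC addKr.
have -> : (f (z0 + w) - f z0) / w - L = (f (z0 + w) - f z0 - L * w) / w.
  by rewrite [RHS]mulrBl mulfK.
by rewrite cabsM cabsV ler_pdivrMr ?cabs_gt0// dP.
Qed.

Lemma ccontM_id F z : ccont F z -> ccont (fun w => F w * w) z.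
Proof.
move=> cF e e0.
have m0 : 0 < cabs z + 1 by rewrite ltr_wpDl// cabs_ge0.
have n0 : 0 < cabs (F z) + 1 by rewrite ltr_wpDl// cabs_ge0.
have e2 : 0 < e / 2 by rewrite divr_gt0.
have [d d0 dP] := cF _ (divr_gt0 e2 m0).
exists (Num.min d (Num.min 1 (e / 2 / (cabs (F z) + 1)))).
  by rewrite !lt_min d0 ltr01 divr_gt0.
move=> w; rewrite !lt_min => /andP[/dP h1 /andP[w1 w2]].
have -> : F (z + w) * (z + w) - F z * z = (F (z + w) - F z) * (z + w) + F z * w by ring.
rewrite (le_trans (cabsD _ _))// !cabsM [leRHS]splitr lerD//.
  rewrite (@le_trans _ _ (e / 2 / (cabs z + 1) * (cabs z + 1)))//.
    rewrite ler_pM ?cabs_ge0// (le_trans (cabsD _ _))// lerD2l ltW//.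
  by rewrite divfK// gt_eqF.
rewrite (@le_trans _ _ ((cabs (F z) + 1) * (e / 2 / (cabs (F z) + 1))))//.
  by rewrite ler_pM ?cabs_ge0 ?(ltW w2)// lerDl.
by rewrite mulrC divfK// gt_eqF.
Qed.

Lemma circle_neq r z z0 : cabs z0 < r -> cabs z = `|r| -> z - z0 != 0.
Proof.
move=> zr zE; rewrite subr_eq0; apply: contraTneq zr => <-.
by rewrite zE -leNgt ler_norm.
Qed.

Lemma cauchy_kernel_cderivable z0 z : z - z0 != 0 ->
  cderivable (fun z => z / (z - z0)) z.
Proof.
move=> zz0; apply: cderivableM; first exact: cderivable_id.
apply: cderivableV => //.
by apply: cderivableB; [exact: cderivable_id|exact: cderivable_cst].
Qed.

Lemma mulc_conj z : z * conjc z = (cabs z ^+ 2)%:C.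
Proof. by rewrite -sqr_normc cabsE rmorphXn. Qed.

(** On the circle, the conjugate of the kernel is r^2 / (r^2 - conjc z0 * z), which
    is holomorphic on the disc and equal to 1 at the origin. *)
Lemma cmean_cauchy_kernel r z0 : cabs z0 < r -> cmean r (fun z => z / (z - z0)) = 1.
Proof.
move=> zr; have r0 : 0 < r := le_lt_trans (cabs_ge0 _) zr.
have cK : circ r (fun z => z / (z - z0)).
  by apply: circ_cderivable => z zE; apply: cauchy_kernel_cderivable; exact: circle_neq zE.
pose q := (r ^+ 2)%:C : R[i].
have q0 : q != 0 by rewrite -cabs_eq0 cabs_real normr_eq0 sqrf_eq0 gt_eqF.
have den z : cabs z <= r -> q - conjc z0 * z != 0.
  move=> zr'; rewrite subr_eq0; apply: contraTneq zr' => qE.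
  have : cabs q = cabs z0 * cabs z.
    rewrite qE cabsM; congr (_ * _).
    by apply: complexI; rewrite -!cabsE normcJ.
  rewrite cabs_real ger0_norm ?sqr_ge0// => E.
  rewrite -ltNge -(ltr_pM2l r0) -expr2 E.
  have [zz|zz] := eqVneq (cabs z) 0.
    move: E; rewrite zz mulr0 => /eqP; rewrite sqrf_eq0 => /eqP rr.
    by move: r0; rewrite rr ltxx.
  by rewrite ltr_pM2r// lt_neqAle eq_sym zz cabs_ge0.
have : cmean r (fun z => q / (q - conjc z0 * z)) = 1.
  have dK z : cabs z <= r -> cderivable (fun z => q / (q - conjc z0 * z)) z.
    move=> zr'; apply: cderivableM; first exact: cderivable_cst.
    apply: cderivableV; first exact: den.
    apply: cderivableB; first exact: cderivable_cst.
    by apply: cderivableM; [exact: cderivable_cst|exact: cderivable_id].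
  rewrite (@cmean_disc r _ 0 (ltW r0)); last 2 first.
  - by move=> z /dK; exact: cderiv_ccont.
  - by move=> z /dK.
  by rewrite mulr0 subr0 divff.
rewrite (_ : cmean r _ = cmean r (fun z => conjc (z / (z - z0)))); last first.
  apply: eq_cmean => z zE.
  have zz : z * conjc z = q by rewrite mulc_conj zE ger0_norm// ltW.
  have zn0 : z != 0 by apply: contra_eq_neq zz => ->; rewrite mul0r eq_sym.
  rewrite rmorphM/= fmorphV rmorphB/=.
  have -> : q - conjc z0 * z = z * (conjc z - conjc z0) by rewrite -zz; ring.
  by rewrite -zz invfM mulrACA divff// mul1r.
rewrite cmean_conj// => /(congr1 conjc); rewrite conjcK => ->.
exact: conjc1.
Qed.

(** The mean value property for z times the difference quotient of f at z0, a
    function that vanishes at the origin. *)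
Lemma cauchy_formula f r z0 : (forall z, cderivable f z) -> cabs z0 < r ->
  cmean r (fun z => f z * (z / (z - z0))) = f z0.
Proof.
move=> df zr; have r0 : 0 < r := le_lt_trans (cabs_ge0 _) zr.
have [L fL] := df z0.
have H : cmean r (fun z => slope f z0 L z * z) = 0.
  rewrite (@cmean_disc r _ z0 (ltW r0)) ?mulr0//.
    move=> z _; apply: ccontM_id; have [->|zz0] := eqVneq z z0.
      exact: slope_ccont.
    by apply: cderiv_ccont; exact: slope_cderivable.
  move=> z _ zz0; apply: cderivableM; last exact: cderivable_id.
  exact: slope_cderivable.
have c1 : circ r (fun z => f z * (z / (z - z0))).
  apply: circ_cderivable => z zE; apply: cderivableM => //.
  by apply: cauchy_kernel_cderivable; exact: circle_neq zE.
have c2 : circ r (fun z => z / (z - z0)).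
  by apply: circ_cderivable => z zE; apply: cauchy_kernel_cderivable; exact: circle_neq zE.
move: H; rewrite (@eq_cmean _ _ _ (fun z => f z * (z / (z - z0)) - f z0 * (z / (z - z0)))).
  rewrite cmeanB//; last by move=> t; apply: ccontZ; exact: c2.
  rewrite cmeanZ// cmean_cauchy_kernel// mulr1 => /eqP.
  by rewrite subr_eq0 => /eqP.
move=> z zE; rewrite /slope -subr_eq0 (negbTE (circle_neq zr zE)).
by rewrite -mulrBl mulrA mulrAC.
Qed.

End CauchyTheory.

(** * Sequences of complex numbers *)

Section Sequences.
Context {R : realType}.

Lemma cauchy_limit (u : nat -> R) :
  (forall e, 0 < e -> exists N, forall n m, (N <= n)%N -> (N <= m)%N -> `|u n - u m| <= e) ->
  exists l : R, u n @[n --> \oo] --> l.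
Proof.
move=> cu; apply/cvg_ex; apply/cauchy_cvgP; apply/cauchy_exP => e e0.
have [N NP] := cu (e / 2) (divr_gt0 e0 (ltr0n _ 2)).
exists (u N); exists N => // n /= Nn; rewrite /ball/=.
apply: (le_lt_trans (NP _ _ (leqnn N) Nn)).
by rewrite ltr_pdivrMr// ltr_pMr// ltr1n.
Qed.

Definition ccvg (u : nat -> R[i]) (l : R[i]) := forall e : R, 0 < e ->
  exists N, forall n, (N <= n)%N -> cabs (u n - l) <= e.

Lemma ccvg_ReIm (u : nat -> R[i]) l :
  complex.Re (u n) @[n --> \oo] --> complex.Re l ->
  complex.Im (u n) @[n --> \oo] --> complex.Im l -> ccvg u l.
Proof.
move=> /cvgrPdist_le cR /cvgrPdist_le cI e e0.
have e2 : 0 < e / 2 by rewrite divr_gt0.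
have [N _ NP] := cR _ e2; have [M _ MP] := cI _ e2.
exists (maxn N M) => n; rewrite geq_max => /andP[Nn Mn].
rewrite (le_trans (cabs_le_ReIm _))// [leRHS]splitr cReD cReN cImD cImN.
by apply: lerD; rewrite distrC; [exact: NP|exact: MP].
Qed.

Lemma ccvg_cauchy (u : nat -> R[i]) :
  (forall e, 0 < e -> exists N, forall n m, (N <= n)%N -> (N <= m)%N ->
     cabs (u n - u m) <= e) ->
  exists l, ccvg u l.
Proof.
move=> cu.
have [a ua] : exists a : R, complex.Re (u n) @[n --> \oo] --> a.
  apply: cauchy_limit => e /cu[N NP]; exists N => n m Nn Nm.
  by rewrite -cReN -cReD (le_trans (Re_le_cabs _))// NP.
have [b ub] : exists b : R, complex.Im (u n) @[n --> \oo] --> b.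
  apply: cauchy_limit => e /cu[N NP]; exists N => n m Nn Nm.
  by rewrite -cImN -cImD (le_trans (Im_le_cabs _))// NP.
by exists (a +i* b); exact: ccvg_ReIm.
Qed.

Lemma geometric_small (q A e : R) : 0 <= q < 1 -> 0 < e ->
  exists N, forall n, (N <= n)%N -> q ^+ n * A <= e.
Proof.
move=> /andP[q0 q1] e0.
have : geometric A q @ \oo --> 0 by apply: cvg_geometric; rewrite ger0_norm.
move=> /cvgrPdist_le/(_ e e0)[N _ NP]; exists N => n /NP /=.
by rewrite sub0r normrN => h; rewrite mulrC (le_trans (ler_norm _) h).
Qed.

End Sequences.

(** * Taylor expansion of entire functions *)

Section PowerExpansion.
Context {R : realType}.
Implicit Types (f F G K : R[i] -> R[i]) (z w c h k : R[i]) (r s t : R) (n : nat).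

(** The Taylor coefficient of index n at the origin. *)
Definition coef f n : R[i] := cmean 1 (fun z => f z / z ^+ n).

Definition l1mean f r : R := avg (fun t => cabs (f (polar r t))).

Lemma entire_circ f r : entire f -> circ r f.
Proof. by move=> /entireP df; apply: circ_cderivable => z _. Qed.

Lemma l1mean_ge0 f r : 0 <= l1mean f r.
Proof. by apply: avg_ge0 => t; exact: cabs_ge0. Qed.

Lemma cabs_cmean_le r K (M : R) : circ r K ->
  (forall z, cabs z = `|r| -> cabs (K z) <= M) -> cabs (cmean r K) <= M.
Proof.
move=> cK KM; rewrite (le_trans (cabs_cmean cK))// -(avg_cst M).
apply: le_avg; [exact: circ_abs|by move=> x _; exact: cvg_cst|].
by move=> t; apply: KM; rewrite cabs_polar.
Qed.

Lemma cabs_cmeanM r F G (M : R) : circ r F -> circ r (fun z => F z * G z) ->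
  (forall z, cabs z = `|r| -> cabs (G z) <= M) ->
  cabs (cmean r (fun z => F z * G z)) <= M * l1mean F r.
Proof.
move=> cF cFG GM; rewrite (le_trans (cabs_cmean cFG))// /l1mean -avgZ; last exact: circ_abs.
apply: le_avg; [exact: (circ_abs cFG)|exact: segcontZ (circ_abs cF)|].
by move=> t; rewrite cabsM mulrC ler_wpM2r ?cabs_ge0// GM// cabs_polar.
Qed.

Lemma circ_div_pow f n r : entire f -> 0 < r -> circ r (fun z => f z / z ^+ n).
Proof.
move=> /entireP df r0; apply: circ_cderivable => z zr.
have z0 : z != 0 by rewrite -cabs_gt0 zr gtr0_norm.
apply: cderivableM => //; apply: cderivableV; first by rewrite expf_neq0.
exact: cderivableX.
Qed.

Lemma coef_radius f n r : entire f -> 0 < r ->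
  cmean r (fun z => f z / z ^+ n) = coef f n.
Proof.
move=> ef r0; have d s z : 0 < s -> s <= cabs z -> cderivable (fun z => f z / z ^+ n) z.
  move=> s0 sz; have z0 : z != 0 by rewrite -cabs_gt0 (lt_le_trans s0).
  move/entireP : ef => df.
  apply: cderivableM => //; apply: cderivableV; first by rewrite expf_neq0.
  exact: cderivableX.
have [r1|/ltW r1] := leP r 1.
  by apply: cmean_annulus => // z /andP[rz _]; exact: d rz.
by apply/esym; apply: cmean_annulus => // z /andP[rz _]; exact: d rz.
Qed.

Lemma cabs_coef f n r : entire f -> 0 < r -> cabs (coef f n) * r ^+ n <= l1mean f r.
Proof.
move=> ef r0; rewrite -(coef_radius n ef r0).
have rn : 0 < r ^+ n by rewrite exprn_gt0.
rewrite -ler_pdivlMr// mulrC; apply: cabs_cmeanM.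
- exact: entire_circ.
- exact: circ_div_pow.
- by move=> z zr; rewrite cabsV cabsX zr gtr0_norm.
Qed.

Lemma ccoefB f g n : entire f -> entire g ->
  coef (fun z => f z - g z) n = coef f n - coef g n.
Proof.
move=> ef eg; rewrite /coef -cmeanB; do ?exact: circ_div_pow.
by apply: eq_cmean => z _; rewrite mulrBl.
Qed.

(** Cauchy's formula, with the kernel expanded as a finite geometric sum. *)
Lemma taylor_remainder f r z0 n : entire f -> cabs z0 < r ->
  cabs (f z0 - \sum_(j < n) coef f j * z0 ^+ j) <=
  (cabs z0 / r) ^+ n * (r / (r - cabs z0) * l1mean f r).
Proof.
move=> ef zr; have r0 : 0 < r := le_lt_trans (cabs_ge0 _) zr.
have /entireP df := ef.
have zn0 z : cabs z = `|r| -> z != 0 by rewrite -cabs_gt0 => ->; rewrite gtr0_norm.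
have dG m z : cabs z = `|r| -> cderivable (fun z => (z0 / z) ^+ m * (z / (z - z0))) z.
  move=> zE; apply: cderivableM; last first.
    by apply: cauchy_kernel_cderivable; exact: circle_neq zE.
  elim: m => [|m ih].
    by under [X in cderivable X _]eq_fun do rewrite expr0; exact: cderivable_cst.
  under [X in cderivable X _]eq_fun do rewrite exprS.
  apply: cderivableM => //; apply: cderivableM; first exact: cderivable_cst.
  by apply: cderivableV; [exact: zn0|exact: cderivable_id].
have cG m : circ r (fun z => f z * ((z0 / z) ^+ m * (z / (z - z0)))).
  by apply: circ_cderivable => z zE; apply: cderivableM => //; exact: dG.
have -> : f z0 - \sum_(j < n) coef f j * z0 ^+ j =
    cmean r (fun z => f z * ((z0 / z) ^+ n * (z / (z - z0)))).
  elim: n => [|n ih].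
    rewrite big_ord0 subr0 -(cauchy_formula df zr).
    by apply: eq_cmean => z _; rewrite expr0 mul1r.
  rewrite big_ord_recr/= opprD addrA {}ih -(coef_radius n ef r0).
  rewrite mulrC -cmeanZ; last exact: circ_div_pow.
  rewrite -cmeanB//; last by move=> t; apply: ccontZ; exact: circ_div_pow.
  apply: eq_cmean => z zE; have z1 := zn0 _ zE; have z2 := circle_neq zr zE.
  rewrite exprSr expr_div_n; field; rewrite z1 z2 expf_neq0//.
rewrite mulrA; apply: cabs_cmeanM => //; first exact: entire_circ.
move=> z zE; rewrite cabsM cabsX !cabsM !cabsV zE gtr0_norm//.
rewrite ler_wpM2l ?exprn_ge0 ?divr_ge0 ?cabs_ge0 ?(ltW r0)//.
rewrite ler_wpM2l ?(ltW r0)// lef_pV2 ?posrE ?subr_gt0//.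
  by rewrite (le_trans _ (cabs_dist _ _))// zE gtr0_norm.
by rewrite cabs_gt0; exact: circle_neq zE.
Qed.

Lemma taylor_ccvg f z0 : entire f ->
  ccvg (fun n => \sum_(j < n) coef f j * z0 ^+ j) (f z0).
Proof.
move=> ef e e0; pose r := cabs z0 + 1.
have zr : cabs z0 < r by rewrite ltrDl.
have r0 : 0 < r := le_lt_trans (cabs_ge0 _) zr.
have q : 0 <= cabs z0 / r < 1.
  by rewrite divr_ge0 ?cabs_ge0 ?(ltW r0)//= ltr_pdivrMr// mul1r.
have [N NP] := geometric_small (r / (r - cabs z0) * l1mean f r) q e0.
exists N => n /NP; apply: le_trans.
by rewrite cabs_distC; exact: taylor_remainder.
Qed.

(** A pointwise limit of polynomials in measurable functions. *)
Lemma entire_measurable d (T : measurableType d) (D : set T) f (u : T -> R[i]) :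
  entire f -> measurable D ->
  measurable_fun D (fun x => complex.Re (u x)) ->
  measurable_fun D (fun x => complex.Im (u x)) ->
  measurable_fun D (fun x => complex.Re (f (u x))) /\
  measurable_fun D (fun x => complex.Im (f (u x))).
Proof.
move=> ef mD uR uI.
pose cm (v : T -> R[i]) := measurable_fun D (fun x => complex.Re (v x)) /\
  measurable_fun D (fun x => complex.Im (v x)).
have cmD v (w : T -> R[i]) : cm v -> cm w -> cm (fun x => v x + w x).
  move=> [vR vI] [wR wI]; split.
    under eq_fun do rewrite cReD; exact: measurable_funD.
  under eq_fun do rewrite cImD; exact: measurable_funD.
have cmM v (w : T -> R[i]) : cm v -> cm w -> cm (fun x => v x * w x).
  move=> [vR vI] [wR wI]; split.
    under eq_fun do rewrite cReM.
    by apply: measurable_funB; exact: measurable_funM.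
  under eq_fun do rewrite cImM.
  by apply: measurable_funD; exact: measurable_funM.
have cmc c : cm (fun=> c) by split; exact: measurable_cst.
have cmX n : cm (fun x => u x ^+ n).
  elim: n => [|n ih].
    have -> : (fun x => u x ^+ 0) = (fun=> 1) by apply: funext => x; rewrite expr0.
    exact: cmc.
  have -> : (fun x => u x ^+ n.+1) = (fun x => u x * u x ^+ n).
    by apply: funext => x; rewrite exprS.
  by apply: cmM => //; split.
have cmS n : cm (fun x => \sum_(j < n) coef f j * u x ^+ j).
  elim: n => [|n ih].
    have -> : (fun x => \sum_(j < 0) coef f j * u x ^+ j) = (fun=> 0).
      by apply: funext => x; rewrite big_ord0.
    exact: cmc.
  have -> : (fun x => \sum_(j < n.+1) coef f j * u x ^+ j) =
      (fun x => \sum_(j < n) coef f j * u x ^+ j + coef f n * u x ^+ n).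
    by apply: funext => x; rewrite big_ord_recr.
  by apply: cmD => //; apply: cmM.
have lim x (p : R[i] -> R) : (forall z w, `|p z - p w| <= cabs (z - w)) ->
    p (\sum_(j < n) coef f j * u x ^+ j) @[n --> \oo] --> p (f (u x)).
  move=> pl; apply/cvgrPdist_le => e e0.
  have [N NP] := taylor_ccvg (u x) ef e0.
  exists N => // n /= Nn; rewrite (le_trans (pl _ _))// cabs_distC.
  exact: NP.
split.
- apply: (measurable_fun_cvg (fun n => (cmS n).1)) => x _.
  by apply: (lim x (@complex.Re R)) => z w; rewrite -cReN -cReD Re_le_cabs.
- apply: (measurable_fun_cvg (fun n => (cmS n).2)) => x _.
  by apply: (lim x (@complex.Im R)) => z w; rewrite -cImN -cImD Im_le_cabs.
Qed.

Lemma measurable_cabs d (T : measurableType d) (D : set T) (u : T -> R[i]) :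
  measurable_fun D (fun x => complex.Re (u x)) ->
  measurable_fun D (fun x => complex.Im (u x)) ->
  measurable_fun D (fun x => cabs (u x)).
Proof.
move=> uR uI.
have -> : (fun x => cabs (u x)) =
    (fun x => Num.sqrt (complex.Re (u x) ^+ 2 + complex.Im (u x) ^+ 2)).
  by apply: funext => x; case: (u x).
apply: (measurableT_comp (continuous_measurable_fun (@sqrt_continuous R))).
by apply: measurable_funD; exact: measurable_funX.
Qed.

(** Holomorphy as an inequality between values: the divided difference at z is
    Lipschitz in the increment. Being closed under pointwise limits and under
    integration in a parameter, it replaces the theorems of Weierstrass and
    Morera. *)
Definition chord_lipschitz f z (C : R) := forall h k, cabs h <= 1 -> cabs k <= 1 ->
  cabs (k * (f (z + h) - f z) - h * (f (z + k) - f z)) <=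
  C * (cabs h * cabs k * cabs (h - k)).

(** Applied to the Cauchy kernel, the left-hand side produces the factor
    h * k * (h - k) explicitly; the remaining denominators are at least 1 on a
    circle of radius at least cabs z + 2. *)
Lemma entire_chord f r z (M : R) : entire f -> cabs z + 2 <= r ->
  (forall w, cabs w = r -> cabs (f w) <= M) -> chord_lipschitz f z (M * r).
Proof.
move=> ef zr fM h k h1 k1; have /entireP df := ef.
have r0 : 0 < r by apply: lt_le_trans zr; rewrite ltr_wpDl ?cabs_ge0.
have near v : cabs v <= 1 -> cabs (z + v) < r.
  move=> v1; rewrite (le_lt_trans (cabsD _ _))//.
  by rewrite (lt_le_trans _ zr)// ltrD2l (le_lt_trans v1)// ltr1n.
have z1 : cabs z < r by have := near 0; rewrite addr0 cabs0; apply.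
have zh := near _ h1; have zk := near _ k1.
have cK v : cabs v < r -> circ r (fun w => f w * (w / (w - v))).
  move=> vr; apply: circ_cderivable => w wr; apply: cderivableM => //.
  by apply: cauchy_kernel_cderivable; exact: circle_neq wr.
have cZ v c : cabs v < r -> circ r (fun w => c * (f w * (w / (w - v)))).
  by move=> vr t; apply: ccontZ; exact: cK.
have cB a b c c' : circ r a -> circ r b -> circ r (fun w => c * a w - c' * b w).
  move=> ca cb t.
  have -> : (fun w => c * a w - c' * b w) = (fun w => c * a w + (- c') * b w).
    by apply: funext => w; rewrite mulNr.
  by apply: ccontD; apply: ccontZ; [exact: ca|exact: cb].
rewrite -(cauchy_formula df z1) -(cauchy_formula df zh) -(cauchy_formula df zk).
set a := (fun w => f w * (w / (w - (z + h)))).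
set b := (fun w => f w * (w / (w - (z + k)))).
set o := (fun w => f w * (w / (w - z))).
have ca : circ r a by exact: cK.
have cb : circ r b by exact: cK.
have co : circ r o by exact: cK.
have cao : circ r (fun w => 1 * a w - 1 * o w) by exact: cB.
have cbo : circ r (fun w => 1 * b w - 1 * o w) by exact: cB.
have c1 F : circ r F -> circ r (fun w => 1 * F w).
  by move=> cF t; apply: ccontZ; exact: cF.
have E F G : circ r F -> circ r G -> cmean r F - cmean r G =
    cmean r (fun w => 1 * F w - 1 * G w).
  by move=> cF cG; rewrite cmeanB ?cmeanZ ?mul1r//; exact: c1.
rewrite !E// -!cmeanZ// -cmeanB; last 2 first.
- by move=> t; apply: ccontZ; exact: cao.
- by move=> t; apply: ccontZ; exact: cbo.
apply: cabs_cmean_le; first exact: cB.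
move=> w wr; rewrite !mul1r /a /b /o.
have w0 := circle_neq z1 wr; have wh := circle_neq zh wr; have wk := circle_neq zk wr.
have -> : k * (f w * (w / (w - (z + h))) - f w * (w / (w - z))) -
    h * (f w * (w / (w - (z + k))) - f w * (w / (w - z))) =
  (f w * w) * (h * k * (h - k)) / ((w - (z + h)) * (w - (z + k)) * (w - z)).
  by field; rewrite w0 wh wk.
rewrite !cabsM cabsV !cabsM wr gtr0_norm//.
have far v : cabs v <= 1 -> 1 <= cabs (w - (z + v)).
  move=> v1; rewrite (le_trans _ (cabs_dist _ _))// wr gtr0_norm//.
  rewrite lerBrDr (le_trans _ zr)// (_ : 2 = 1 + 1)// [cabs z + _]addrC -addrA lerD2l.
  by rewrite (le_trans (cabsD _ _))// addrC lerD.
have D1 : 1 <= cabs (w - (z + h)) * cabs (w - (z + k)) * cabs (w - z).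
  have := far 0; rewrite addr0 cabs0 => /(_ ler01) w1.
  by rewrite !mulr_ege1// ?far.
rewrite ler_pdivrMr ?(lt_le_trans ltr01)//.
have fw : cabs (f w) <= M by apply: fM; rewrite wr gtr0_norm.
have P : 0 <= cabs h * cabs k * cabs (h - k) by rewrite !mulr_ge0 ?cabs_ge0.
apply: (@le_trans _ _ (M * r * (cabs h * cabs k * cabs (h - k)))).
  by rewrite ler_wpM2r// ler_wpM2r// ltW.
rewrite ler_peMr// mulr_ge0// mulr_ge0 ?(ltW r0)//.
exact: le_trans (cabs_ge0 _) fw.
Qed.

(** The difference quotients along the increments 1 / n form a Cauchy sequence; the
    estimate compares the quotient of any other increment with its limit. *)
Lemma chord_cderivable f z (C : R) : chord_lipschitz f z C -> cderivable f z.
Proof.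
move=> fC; pose q h := (f (z + h) - f z) / h.
have C0 : 0 <= `|C| by [].
have qL h k : cabs h <= 1 -> cabs k <= 1 -> h != 0 -> k != 0 ->
    cabs (q h - q k) <= `|C| * cabs (h - k).
  move=> h1 k1 h0 k0.
  have -> : q h - q k = (k * (f (z + h) - f z) - h * (f (z + k) - f z)) / (h * k).
    by rewrite /q; field; rewrite h0 k0.
  rewrite cabsM cabsV cabsM ler_pdivrMr ?mulr_gt0 ?cabs_gt0//.
  rewrite (le_trans (fC _ _ h1 k1))//.
  rewrite [leRHS](_ : _ = `|C| * (cabs h * cabs k * cabs (h - k))); last by ring.
  by rewrite ler_wpM2r ?ler_norm// !mulr_ge0 ?cabs_ge0.
pose a n : R[i] := (n.+1%:R^-1 : R)%:C.
have cabsa n : cabs (a n) = n.+1%:R^-1 by rewrite cabs_real ger0_norm.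
have a1 n : cabs (a n) <= 1 by rewrite cabsa invf_le1// ler1n.
have a0 n : a n != 0 by rewrite -cabs_gt0 cabsa invr_gt0.
have sm e : 0 < e -> exists N, forall n, (N <= n)%N -> `|C| * cabs (a n) <= e.
  move=> e0; exists (Num.bound (`|C| / e)) => n Nn; rewrite cabsa ler_pdivrMr//.
  rewrite mulrC -ler_pdivrMr//.
  have /ltW := archi_boundP (divr_ge0 C0 (ltW e0)).
  by move=> /le_trans; apply; rewrite ler_nat leqW.
have [|L qa] := @ccvg_cauchy R (q \o a).
  move=> e e0; have [N NP] := sm _ (divr_gt0 e0 (ltr0n _ 2)).
  exists N => n m /NP hn /NP hm; rewrite /= (le_trans (qL _ _ _ _ _ _))//.
  rewrite (@le_trans _ _ (`|C| * (cabs (a n) + cabs (a m))))//.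
    by rewrite ler_wpM2l// cabsB.
  by rewrite mulrDr [leRHS]splitr lerD.
have qlim h : cabs h <= 1 -> h != 0 -> cabs (q h - L) <= `|C| * cabs h.
  move=> h1 h0; apply/ler_addgt0Pl => e e0.
  have e2 : 0 < e / 2 by rewrite divr_gt0.
  have [N NP] := qa _ e2; have [M MP] := sm _ e2.
  pose n := maxn N M.
  have -> : q h - L = (q h - q (a n)) + (q (a n) - L) by ring.
  rewrite (le_trans (cabsD _ _))//.
  rewrite [e + _](_ : _ = (`|C| * cabs h + e / 2) + e / 2); last by field.
  apply: lerD; last by apply: NP; exact: leq_maxl.
  rewrite (le_trans (qL _ _ h1 (a1 n) h0 (a0 n)))//.
  rewrite (@le_trans _ _ (`|C| * (cabs h + cabs (a n))))//.
    by rewrite ler_wpM2l// cabsB.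
  by rewrite mulrDr lerD2l; apply: MP; exact: leq_maxr.
exists L => e e0.
have c1 : 0 < `|C| + 1 by rewrite ltr_wpDl.
exists (Num.min 1 (e / (`|C| + 1))); first by rewrite lt_min ltr01 divr_gt0.
move=> h; rewrite lt_min => /andP[/ltW h1 he].
have [->|h0] := eqVneq h 0; first by rewrite addr0 mulr0 subr0 subrr cabs0 mulr0.
have -> : f (z + h) - f z - L * h = (q h - L) * h by rewrite mulrBl divfK.
rewrite cabsM ler_wpM2r ?cabs_ge0// (le_trans (qlim _ h1 h0))//.
move: he; rewrite ltr_pdivlMr// => /ltW; apply: le_trans.
by rewrite mulrDr mulr1 mulrC lerDl cabs_ge0.
Qed.

Lemma chord_entire f : (forall z, exists C, chord_lipschitz f z C) -> entire f.
Proof. by move=> h; apply/entireP => z; have [C] := h z; exact: chord_cderivable. Qed.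

End PowerExpansion.

(** * Inequalities for integrals of powers *)

Section PowerIntegrals.
Context {R : realType}.
Local Open Scope ereal_scope.

Lemma le_poweR (x y : \bar R) (r : R) : (0 <= r)%R -> 0 <= x -> x <= y ->
  x `^ r <= y `^ r.
Proof.
move=> r0 x0 xy; apply: gt0_ler_poweR => //.
  by rewrite in_itv/= x0 leey.
by rewrite in_itv/= (le_trans x0 xy) leey.
Qed.

Lemma measurable_powR_fun d (T : measurableType d) (D : set T) (g : T -> R) (s : R) :
  measurable_fun D g -> measurable_fun D (fun x => (g x `^ s)%R).
Proof. exact: (measurableT_comp (measurable_powR s)). Qed.

(** Minkowski's inequality for the functions extended by zero. *)
Lemma minkowski_on d (T : measurableType d) (mu : {measure set T -> \bar R})
    (D : set T) (g h : T -> R) (s : R) : measurable D -> (1 <= s)%R ->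
  measurable_fun D g -> measurable_fun D h ->
  (forall x, D x -> (0 <= g x)%R) -> (forall x, D x -> (0 <= h x)%R) ->
  (\int[mu]_(x in D) ((g x + h x) `^ s)%:E) `^ s^-1 <=
  (\int[mu]_(x in D) (g x `^ s)%:E) `^ s^-1 +
  (\int[mu]_(x in D) (h x `^ s)%:E) `^ s^-1.
Proof.
move=> mD s1 mg mh g0 h0; have s0 : (0 < s)%R := lt_le_trans ltr01 s1.
have NE (k : T -> R) : (forall x, D x -> (0 <= k x)%R) ->
    (\int[mu]_(x in D) (k x `^ s)%:E) `^ s^-1 = 'N[mu]_s%:E[EFin \o (k \_ D)].
  move=> k0; rewrite unlock integral_mkcond; congr (_ `^ _).
  apply: eq_integral => x _; rewrite /patch/=; have [/set_mem/k0 kx|_] := boolP (x \in D).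
    by rewrite ger0_norm.
  by rewrite normr0 powR0// gt_eqF.
have gh0 x : D x -> (0 <= g x + h x)%R by move=> Dx; rewrite addr_ge0 ?g0 ?h0.
rewrite [X in X <= _](NE _ gh0) [X in _ <= X + _](NE _ g0) [X in _ <= _ + X](NE _ h0).
rewrite (_ : (fun x => g x + h x)%R \_ D = (g \_ D \+ h \_ D)%R); last first.
  by apply: funext => x; rewrite /patch/=; case: ifP => // _; rewrite addr0.
apply: minkowski_EFin s1.
  exact: ((measurable_restrictT g mD).1 mg).
exact: ((measurable_restrictT h mD).1 mh).
Qed.

(** Young's inequality, read as follows: a convex power lies above its tangent at
    a. *)
Lemma tangent_powR (s a x : R) : (1 <= s -> 0 < a -> 0 <= x ->
  s * a `^ (s - 1) * x <= x `^ s + (s - 1) * a `^ s)%R.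
Proof.
rewrite le_eqVlt => /predU1P[<-|s1] a0 x0.
  by rewrite subrr powRr0 !mul1r mul0r addr0 powRr1.
have s0 : (0 < s)%R := lt_trans ltr01 s1.
have s10 : (0 < s - 1)%R by rewrite subr_gt0.
have := @conjugate_powR R x (a `^ (s - 1))%R s (s / (s - 1))%R x0 (powR_ge0 _ _) s0.
rewrite divr_gt0// => /(_ isT).
have E : (s^-1 + (s / (s - 1))^-1 = 1)%R by field; rewrite !gt_eqF.
move=> /(_ E); rewrite -powRrM [((s - 1) * _)%R]mulrC divfK ?gt_eqF// => H.
have := ler_wpM2l (ltW s0) H.
rewrite mulrDr [X in (_ <= X -> _)%R](_ : _ = x `^ s + (s - 1) * a `^ s)%R; last first.
  by field; rewrite !gt_eqF.
by rewrite mulrAC -mulrA mulrA.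
Qed.

(** Jensen's inequality for a weight of total mass W, obtained by integrating
    the tangent inequality at the mean. *)
Lemma jensen_powR d (T : measurableType d) (mu : {measure set T -> \bar R})
    (D : set T) (w g : T -> R) (s W B : R) : measurable D -> (1 <= s)%R ->
  measurable_fun D w -> measurable_fun D g ->
  (forall x, D x -> (0 <= w x)%R) -> (forall x, D x -> (0 <= g x <= B)%R) ->
  \int[mu]_(x in D) (w x)%:E = W%:E ->
  (\int[mu]_(x in D) (w x * g x)%:E) `^ s <=
  (W `^ (s - 1))%:E * \int[mu]_(x in D) (w x * g x `^ s)%:E.
Proof.
move=> mD s1 mw mg w0 gB wW; have s0 : (0 < s)%R := lt_le_trans ltr01 s1.
set i := \int[mu]_(x in D) (w x * g x)%:E.
set J := \int[mu]_(x in D) (w x * g x `^ s)%:E.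
have mwg : measurable_fun D (fun x => (w x * g x)%:E).
  by apply/measurable_EFinP; exact: measurable_funM.
have mwgs : measurable_fun D (fun x => (w x * g x `^ s)%:E).
  by apply/measurable_EFinP; apply: measurable_funM => //; exact: measurable_powR_fun.
have mwE : measurable_fun D (fun x => (w x)%:E) by exact/measurable_EFinP.
have g0 x : D x -> (0 <= g x)%R by move=> /gB/andP[].
have i0 : 0 <= i by apply: integral_ge0 => x Dx; rewrite lee_fin mulr_ge0 ?w0 ?g0.
have J0 : 0 <= J by apply: integral_ge0 => x Dx; rewrite lee_fin mulr_ge0 ?w0 ?powR_ge0.
have W0 : (0 <= W)%R by rewrite -lee_fin -wW; apply: integral_ge0 => x Dx; rewrite lee_fin w0.
have iB : i <= (`|B| * W)%:E.
  rewrite EFinM -wW -ge0_integralZl_EFin//.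
  apply: ge0_le_integral => //.
  - by move=> x Dx; rewrite lee_fin mulr_ge0 ?w0 ?g0.
  - exact: measurable_funeM.
  - move=> x Dx; rewrite -EFinM lee_fin mulrC ler_wpM2r ?w0//.
    by have /andP[_ /le_trans] := gB x Dx; apply; exact: ler_norm.
have ifin : i \is a fin_num by rewrite ge0_fin_numE// (le_lt_trans iB) ?ltry.
move: i0; rewrite le_eqVlt => /predU1P[<-|ip].
  by rewrite poweR0r ?gt_eqF// mule_ge0// lee_fin powR_ge0.
have ip' : (0 < fine i)%R by rewrite -lte_fin fineK.
have Wp : (0 < W)%R.
  rewrite lt_neqAle W0 andbT eq_sym; apply: contraTneq ip => W00.
  by rewrite -leNgt (le_trans iB)// W00 mulr0.
pose a := (fine i / W)%R.
have a0 : (0 < a)%R by rewrite divr_gt0.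
have iE : i = (a * W)%:E by rewrite divfK ?gt_eqF// fineK.
have key : (a `^ s * W)%:E <= J.
  have H : (s * a `^ (s - 1))%:E * i <= J + ((s - 1) * a `^ s)%:E * W%:E.
    have c0 : (0 <= (s - 1) * a `^ s)%R by rewrite mulr_ge0 ?powR_ge0// subr_ge0.
    rewrite -wW -!ge0_integralZl_EFin//; last 2 first.
    - by move=> x Dx; rewrite lee_fin mulr_ge0 ?w0 ?g0.
    - by rewrite mulr_ge0 ?powR_ge0 ?(ltW s0).
    rewrite -ge0_integralD//; last 3 first.
    - by move=> x Dx; rewrite lee_fin mulr_ge0 ?w0 ?powR_ge0.
    - by move=> x Dx; rewrite mule_ge0// lee_fin w0.
    - exact: measurable_funeM.
    apply: ge0_le_integral => //.
    - move=> x Dx; rewrite mule_ge0// lee_fin; first by rewrite mulr_ge0 ?powR_ge0 ?(ltW s0).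
      by rewrite mulr_ge0 ?w0 ?g0.
    - exact: measurable_funeM.
    - by apply: emeasurable_funD => //; exact: measurable_funeM.
    - move=> x Dx; rewrite -!EFinM -EFinD lee_fin.
      rewrite [leLHS](_ : _ = w x * (s * a `^ (s - 1) * g x))%R; last by ring.
      rewrite [leRHS](_ : _ = w x * (g x `^ s + (s - 1) * a `^ s))%R; last by ring.
      by rewrite ler_wpM2l ?w0// tangent_powR// g0.
  have as1 : (a `^ (s - 1) * a = a `^ s)%R.
    by rewrite -{2}(powRr1 (ltW a0)) -powRD ?gt_eqF ?implybT// subrK.
  have H2 : (s * (a `^ s * W))%:E <= J + ((s - 1) * (a `^ s * W))%:E.
    move: H; rewrite iE -!EFinM; congr (_ <= _ + _%:E).
      by rewrite -as1; congr EFin; ring.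
    by rewrite mulrA.
  rewrite -leeBlDr// -EFinB in H2.
  by move: H2; congr (_ <= _); congr EFin; ring.
rewrite iE poweR_EFin powRM ?(ltW a0) ?(ltW Wp)//.
have -> : (W `^ s = W `^ (s - 1) * W)%R.
  by rewrite -{3}(powRr1 (ltW Wp)) -powRD ?(gt_eqF Wp) ?implybT// subrK.
rewrite mulrCA EFinM; apply: lee_wpmul2l => //.
by rewrite lee_fin powR_ge0.
Qed.

(** An integral form of Minkowski's inequality, for integrands whose powers
    have uniformly bounded integrals: Jensen in y for each x, then Tonelli. *)
Lemma superposition_powR d1 d2 (T1 : measurableType d1) (T2 : measurableType d2)
    (m1 : {sigma_finite_measure set T1 -> \bar R})
    (m2 : {sigma_finite_measure set T2 -> \bar R})
    (D1 : set T1) (D2 : set T2) (w : T2 -> R) (g : T1 * T2 -> R) (l : T1 -> R)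
    (s W A : R) :
  measurable D1 -> measurable D2 -> (1 <= s)%R ->
  measurable_fun D2 w -> measurable_fun (D1 `*` D2) g -> measurable_fun D1 l ->
  (forall y, D2 y -> (0 <= w y)%R) ->
  (forall x y, D1 x -> D2 y -> (0 <= g (x, y))%R) ->
  (forall x, D1 x -> exists B, forall y, D2 y -> (g (x, y) <= B)%R) ->
  (0 <= A)%R ->
  \int[m2]_(y in D2) (w y)%:E = W%:E ->
  (forall y, D2 y -> \int[m1]_(x in D1) (g (x, y) `^ s)%:E <= A%:E) ->
  (forall x, D1 x -> (0 <= l x)%R) ->
  (forall x, D1 x -> (l x)%:E <= \int[m2]_(y in D2) (w y * g (x, y))%:E) ->
  \int[m1]_(x in D1) (l x `^ s)%:E <= (W `^ s * A)%:E.
Proof.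
move=> mD1 mD2 s1 mw mg ml w0 g0 gB A0 wW gA l0 lg.
have s0 : (0 < s)%R := lt_le_trans ltr01 s1.
have W0 : (0 <= W)%R by rewrite -lee_fin -wW; apply: integral_ge0 => x Dx; rewrite lee_fin w0.
pose F (k : T1 * T2 -> R) := (fun z => (w z.2 * k z)%:E) \_ (D1 `*` D2).
have mD12 : measurable (D1 `*` D2) by exact: measurableX.
have mw2 : measurable_fun (D1 `*` D2) (fun z : T1 * T2 => w z.2).
  apply: (@measurable_comp _ _ _ _ _ _ D2 w) => //.
    by move=> _ [[x y] [/= _ Dy] <-].
  exact: measurable_funTS.
have mF (k : T1 * T2 -> R) : measurable_fun (D1 `*` D2) k -> measurable_fun [set: T1 * T2] (F k).
  move=> mk; apply: (measurable_restrictT _ mD12).1.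
  by apply/measurable_EFinP; exact: measurable_funM.
have F0 (k : T1 * T2 -> R) : (forall x y, D1 x -> D2 y -> (0 <= k (x, y))%R) -> forall z, 0 <= F k z.
  move=> k0; apply: erestrict_ge0 => -[x y] [/= Dx Dy].
  by rewrite lee_fin mulr_ge0 ?w0 ?k0.
have FE k x : D1 x -> \int[m2]_(y in D2) (w y * k (x, y))%:E = \int[m2]_y F k (x, y).
  move=> Dx; rewrite integral_mkcond; apply: eq_integral => y _.
  rewrite /F /patch; case: ifPn => [/set_mem Dy|Dy]; first by rewrite mem_set.
  by rewrite memNset// => -[/= _ /mem_set]; apply/negP.
have F1 k x : ~ D1 x -> \int[m2]_y F k (x, y) = 0.
  move=> Dx; apply: integral0_eq => y _.
  by rewrite /F /patch memNset// => -[].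
pose gs z := (g z `^ s)%R.
have mgs : measurable_fun (D1 `*` D2) gs by exact: measurable_powR_fun.
have mI (k : T1 * T2 -> R) : measurable_fun (D1 `*` D2) k ->
    (forall x y, D1 x -> D2 y -> (0 <= k (x, y))%R) ->
    measurable_fun [set: T1] (fun x => \int[m2]_y F k (x, y)).
  by move=> mk k0; apply: (@measurable_fun_fubini_tonelli_F _ _ _ _ _ m2 (F k)); [exact: mF|exact: F0].
have gs0 x y : D1 x -> D2 y -> (0 <= gs (x, y))%R by rewrite powR_ge0.
apply: (@le_trans _ _ (\int[m1]_(x in D1)
   ((W `^ (s - 1))%:E * \int[m2]_(y in D2) (w y * gs (x, y))%:E))).
  apply: ge0_le_integral => //.
  - by move=> x _; rewrite lee_fin powR_ge0.
  - by apply/measurable_EFinP; exact: measurable_powR_fun.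
  - apply: (@eq_measurable_fun _ _ _ _ _ (fun x => (W `^ (s - 1))%:E * \int[m2]_y F gs (x, y))).
      by move=> x /set_mem Dx; rewrite FE.
    by apply: measurable_funTS; apply: measurable_funeM; exact: mI.
  - move=> x Dx; have [B gxB] := gB x Dx.
    apply: (@le_trans _ _ ((\int[m2]_(y in D2) (w y * g (x, y))%:E) `^ s)).
      by rewrite -poweR_EFin le_poweR ?lee_fin ?l0 ?lg ?(ltW s0).
    apply: (@jensen_powR _ _ m2 D2 w (fun y => g (x, y)) s W B) => //.
      move=> _ Y mY.
      rewrite (_ : _ `&` _ = xsection ((D1 `*` D2) `&` g @^-1` Y) x); last first.
        apply/seteqP; split => y; rewrite /xsection/= ?inE/=.
          by move=> [Dy Yy]; do !split.
        by move=> [[_ Dy] Yy].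
      by apply: measurable_xsection; apply: mg.
    by move=> y Dy; rewrite g0//= gxB.
rewrite ge0_integralZl_EFin ?powR_ge0//; last 2 first.
- by move=> x Dx; apply: integral_ge0 => y Dy; rewrite lee_fin mulr_ge0 ?w0 ?gs0.
- apply: (@eq_measurable_fun _ _ _ _ _ (fun x => \int[m2]_y F gs (x, y))).
    by move=> x /set_mem Dx; rewrite FE.
  by apply: measurable_funTS; exact: mI.
have -> : \int[m1]_(x in D1) \int[m2]_(y in D2) (w y * gs (x, y))%:E =
    \int[m1]_x \int[m2]_y F gs (x, y).
  rewrite integral_mkcond; apply: eq_integral => x _; rewrite /patch.
  by case: ifPn => [/set_mem/FE//|/negP xD]; rewrite F1// => /mem_set.
rewrite (@fubini_tonelli _ _ _ _ _ m1 m2 (F gs)); last 2 first.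
- exact: mF.
- exact: F0.
have inner y : D2 y -> \int[m1]_x F gs (x, y) <= (w y)%:E * A%:E.
  move=> Dy; rewrite [leLHS](_ : _ = \int[m1]_(x in D1) ((w y)%:E * (g (x, y) `^ s)%:E)).
    rewrite ge0_integralZl_EFin ?w0//.
      by apply: lee_wpmul2l; rewrite ?lee_fin ?w0// gA.
      by move=> x Dx; rewrite lee_fin powR_ge0.
    apply/measurable_EFinP; apply: measurable_powR_fun => _ Y mY.
    rewrite (_ : _ `&` _ = ysection ((D1 `*` D2) `&` g @^-1` Y) y); last first.
      apply/seteqP; split => x; rewrite /ysection/= ?inE/=.
        by move=> [Dx Yx]; do !split.
      by move=> [[Dx _] Yx].
    by apply: measurable_ysection; apply: mg.
  rewrite [RHS]integral_mkcond; apply: eq_integral => x _; rewrite /F /patch.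
  case: ifPn => [/set_mem[/= Dx _]|xD]; first by rewrite mem_set// EFinM.
  by rewrite memNset// => Dx; move/negP : xD; apply; exact/mem_set.
have outer y : ~ D2 y -> \int[m1]_x F gs (x, y) = 0.
  move=> Dy; apply: integral0_eq => x _.
  by rewrite /F /patch memNset// => -[].
apply: (@le_trans _ _ ((W `^ (s - 1))%:E * \int[m2]_(y in D2) ((A%:E) * (w y)%:E))).
  apply: lee_wpmul2l; first by rewrite lee_fin powR_ge0.
  rewrite [leRHS]integral_mkcond; apply: ge0_le_integral => //.
  - by move=> y _; apply: integral_ge0 => x _; exact: F0.
  - by apply: (@measurable_fun_fubini_tonelli_G _ _ _ _ _ m1 (F gs)); [exact: mF|exact: F0].
  - apply: (measurable_restrictT _ mD2).1.
    by apply: measurable_funeM; exact/measurable_EFinP.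
  - move=> y _; rewrite /patch; case: ifPn => [/set_mem Dy|/negP Dy].
      by rewrite muleC inner.
    by rewrite outer// => /mem_set.
rewrite ge0_integralZl_EFin//; last exact/measurable_EFinP.
rewrite wW -!EFinM lee_fin.
have [->|Wn0] := eqVneq W 0%R; first by rewrite mulr0 mulr0 powR0 ?gt_eqF// mul0r.
have -> : (W `^ s = W `^ (s - 1) * W)%R.
  by rewrite -{3}(powRr1 W0) -powRD ?Wn0 ?implybT// subrK.
by rewrite mulrA mulrAC.
Qed.

End PowerIntegrals.

(** * Rotations and the Poisson kernel *)

Section Rotation.
Context {R : realType}.
Local Notation leb := (@lebesgue_measure R).
Local Open Scope ereal_scope.

Lemma integral_translation (h : R -> \bar R) (a b y : R) :
  measurable_fun [set: R] h -> (forall x, 0 <= h x) ->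
  \int[leb]_(x in `]a, b]) h (x + y)%R = \int[leb]_(x in `](a + y)%R, (b + y)%R]) h x.
Proof.
move=> mh h0; pose phi (x : R) : R := (x + y)%R.
have mphi : measurable_fun [set: measurableTypeR R] (phi : _ -> measurableTypeR R).
  by apply: measurable_funD => //; exact: measurable_cst.
have pre c d : phi @^-1` `](c + y)%R, (d + y)%R] = `]c, d]%classic.
  by apply/seteqP; split => x /=; rewrite !in_itv/= ltrD2r lerD2r.
transitivity (\int[leb]_(x in phi @^-1` `](a + y)%R, (b + y)%R]) (h \o phi) x).
  by rewrite pre.
rewrite -(@ge0_integral_pushforward _ _ _ _ _ _ mphi leb _ h)//; last exact: measurable_funTS.
apply: eq_measure_integral => A mA _; apply/esym.
pose phi' : {mfun measurableTypeR R >-> measurableTypeR R} :=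
  HB.pack phi (isMeasurableFun.Build _ _ _ _ _ mphi).
apply: (@lebesgue_measure_unique R (pushforward leb phi')) => //.
move=> X [[c d] _ <-] /=; rewrite /pushforward.
have -> : phi @^-1` `]c, d] = `](c - y)%R, (d - y)%R]%classic.
  by rewrite -pre !subrK.
rewrite !lebesgue_measure_itv/= !lte_fin ltrD2r.
by case: ifP => // _; rewrite -!EFinB; congr EFin; ring.
Qed.

(** The shifted period is cut at 2 * pi, and the part beyond is translated back. *)
Lemma integral_rotation (h : R -> \bar R) (y : R) :
  measurable_fun [set: R] h -> (forall x, 0 <= h x) ->
  (forall x, h (x + 2 * pi)%R = h x) -> (0 <= y <= 2 * pi)%R ->
  \int[leb]_(x in `[0%R, (2 * pi)%R]) h (x + y)%R =
  \int[leb]_(x in `[0%R, (2 * pi)%R]) h x.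
Proof.
move=> mh h0 hper /andP[y0 y2].
have mt (z : R) : measurable_fun [set: R] (fun x => h (x + z)%R).
  apply: (measurableT_comp mh).
  by apply: measurable_funD => //; exact: measurable_cst.
rewrite -!integral_itv_obnd_cbnd; last 2 first.
- exact: measurable_funTS.
- exact: measurable_funTS.
rewrite integral_translation// add0r.
have split (a b c : R) : (a <= b <= c)%R -> \int[leb]_(x in `]a, c]) h x =
    \int[leb]_(x in `]a, b]) h x + \int[leb]_(x in `]b, c]) h x.
  move=> /andP[ab bc].
  rewrite (@itv_bndbnd_setU _ _ (BRight a) (BRight b) (BRight c)) ?bnd_simp//.
  rewrite ge0_integral_setU//; first exact: measurable_funTS.
  apply/disj_setPS => x [/=]; rewrite !in_itv/= => /andP[_ xb] /andP[bx _].
  by move: (lt_le_trans bx xb); rewrite ltxx.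
rewrite (split y (2 * pi)%R); last by rewrite y2 lerDl.
rewrite (split 0%R y (2 * pi)%R); last by rewrite y0.
rewrite addeC; congr (_ + _).
rewrite addrC -{1}[(2 * pi)%R]add0r -integral_translation//.
by apply: eq_integral => x _; rewrite hper.
Qed.

End Rotation.

Section Poisson.
Context {R : realType}.
Implicit Types (f : R[i] -> R[i]) (z : R[i]) (rho t : R).
Local Notation leb := (@lebesgue_measure R).

Definition poisson rho t : R := (1 - rho ^+ 2) / cabs (polar 1 t - rho%:C) ^+ 2.

(** The Cauchy kernel plus a kernel holomorphic on the closed disc; on the unit
    circle the sum is the Poisson kernel. *)
Definition poissonC rho z : R[i] := z / (z - rho%:C) + rho%:C * z / (1 - rho%:C * z).

Section kernel.
Variable rho : R.
Hypothesis rho01 : 0 <= rho < 1.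

Let rho0 : 0 <= rho. Proof. by case/andP: rho01. Qed.
Let rho1 : rho < 1. Proof. by case/andP: rho01. Qed.
Let arho : cabs rho%:C = rho. Proof. by rewrite cabs_real ger0_norm. Qed.

Let den z : cabs z <= 1 -> 1 - rho%:C * z != 0.
Proof.
move=> z1; rewrite subr_eq0; apply: contraTneq rho1 => E.
have : cabs 1 = rho * cabs z by rewrite E cabsM arho.
rewrite cabs1 -leNgt => ->.
by rewrite ler_piMr.
Qed.

Let kernel2_cderivable z : cabs z <= 1 ->
  cderivable (fun z => rho%:C * z / (1 - rho%:C * z)) z.
Proof.
move=> z1; apply: cderivableM.
  by apply: cderivableM; [exact: cderivable_cst|exact: cderivable_id].
apply: cderivableV; first exact: den.
apply: cderivableB; first exact: cderivable_cst.
by apply: cderivableM; [exact: cderivable_cst|exact: cderivable_id].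
Qed.

Lemma poissonCE t : poissonC rho (polar 1 t) = (poisson rho t)%:C.
Proof.
rewrite /poissonC /poisson; set z := polar 1 t.
have az : cabs z = 1 by rewrite cabs_polar normr1.
have zz : z * conjc z = 1 by rewrite mulc_conj az expr1n.
have zn0 : z != 0 by rewrite -cabs_gt0 az.
have d1 : z - rho%:C != 0 by apply: (@circle_neq _ 1); rewrite ?arho// az normr1.
have d2 : conjc z - rho%:C != 0.
  by rewrite -(conjc_real rho) -rmorphB conjc_eq0.
have E : (cabs (z - rho%:C) ^+ 2)%:C = (z - rho%:C) * (conjc z - rho%:C).
  by rewrite -mulc_conj rmorphB/= oppr0.
rewrite rmorphM/= fmorphV/= rmorphB/= rmorphXn/= E.
have -> : 1 - rho%:C * z = z * (conjc z - rho%:C) by rewrite mulrBr zz mulrC.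
have -> : rho%:C * z / (z * (conjc z - rho%:C)) = rho%:C / (conjc z - rho%:C).
  by field; rewrite zn0 d2.
have -> : 1 - rho%:C ^+ 2 = z * conjc z - rho%:C ^+ 2 by rewrite zz.
by field; rewrite d1 d2.
Qed.

Lemma poisson_ge0 t : 0 <= poisson rho t.
Proof.
rewrite /poisson divr_ge0 ?sqr_ge0// subr_ge0 expr_le1//.
exact: ltW.
Qed.

Let circ_poissonC : circ 1 (poissonC rho).
Proof.
apply: circ_cderivable => z zE; apply: cderivableD.
  by apply: cauchy_kernel_cderivable; apply: circle_neq zE; rewrite arho.
by apply: kernel2_cderivable; rewrite zE normr1.
Qed.

(** Cauchy's formula for the first summand of the kernel; the second one contributes
    the mean of a holomorphic function that vanishes at the origin. *)
Lemma poisson_formula f : entire f ->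
  cmean 1 (fun z => f z * poissonC rho z) = f rho%:C.
Proof.
move=> ef; have /entireP df := ef.
have c1 : circ 1 (fun z => f z * (z / (z - rho%:C))).
  apply: circ_cderivable => z zE; apply: cderivableM => //.
  by apply: cauchy_kernel_cderivable; apply: circle_neq zE; rewrite arho.
have d2 z : cabs z <= 1 -> cderivable (fun z => f z * (rho%:C * z / (1 - rho%:C * z))) z.
  by move=> z1; apply: cderivableM => //; exact: kernel2_cderivable.
have c2 : circ 1 (fun z => f z * (rho%:C * z / (1 - rho%:C * z))).
  by apply: circ_cderivable => z zE; apply: d2; rewrite zE normr1.
rewrite (@eq_cmean _ _ _ (fun z => f z * (z / (z - rho%:C)) +
    f z * (rho%:C * z / (1 - rho%:C * z)))); last first.
  by move=> z _; rewrite mulrDr.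
rewrite cmeanD// cauchy_formula ?arho//.
rewrite (@cmean_disc _ 1 _ 0 ler01); last 2 first.
- by move=> z /d2; exact: cderiv_ccont.
- by move=> z /d2.
by rewrite mulr0 mul0r mulr0 addr0.
Qed.

Lemma poisson_segcont : segcont 0 (2 * pi) (poisson rho).
Proof.
have := circ_Re circ_poissonC.
by rewrite (_ : (fun s => _) = poisson rho)//; apply: funext => t; rewrite poissonCE.
Qed.

Lemma avg_poisson : avg (poisson rho) = 1.
Proof.
have e1 : entire (fun=> 1 : R[i]) by apply/entireP => z; exact: cderivable_cst.
have E : cmean 1 (poissonC rho) = 1.
  rewrite -(poisson_formula e1); apply: eq_cmean => z _; by rewrite mul1r.
rewrite -[RHS]/(complex.Re (1 : R[i])) -E.
by congr avg; apply: funext => t; rewrite poissonCE.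
Qed.

Lemma poisson_bound f z : entire f ->
  cabs (f (rho%:C * z)) <= avg (fun t => poisson rho t * cabs (f (polar 1 t * z))).
Proof.
move=> ef; have /entireP df := ef.
pose F w := f (w * z).
have eF : entire F by exact: entire_dilation.
have cF : circ 1 (fun w => F w * poissonC rho w).
  apply: circ_cderivable => w wE; have /entireP dF := eF; apply: cderivableM => //.
  apply: cderivableD.
    by apply: cauchy_kernel_cderivable; apply: circle_neq wE; rewrite arho.
  by apply: kernel2_cderivable; rewrite wE normr1.
rewrite -[f _]/(F rho%:C) -(poisson_formula eF) (le_trans (cabs_cmean cF))//.
rewrite le_eqVlt; apply/orP; left; apply/eqP; congr avg; apply: funext => t.
by rewrite cabsM poissonCE cabs_real ger0_norm ?poisson_ge0// mulrC.
Qed.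

End kernel.
End Poisson.

(** * Integral means *)

Section IntegralMeans.
Context {R : realType}.
Implicit Types (f g h : R[i] -> R[i]) (z c : R[i]) (r s t : R) (p : \bar R).
Local Notation leb := (@lebesgue_measure R).
Local Notation I2pi := (`[0%R, (2 * pi)%R]%classic : set R).

Lemma measurable_circ f r : circ r f ->
  measurable_fun I2pi (fun t => cabs (f (polar r t))).
Proof.
by move=> /circ_abs/segcont_integrable/measurable_int/measurable_EFinP.
Qed.

Lemma avgE (a : R -> R) : segcont 0 (2 * pi) a -> (forall t, 0 <= a t) ->
  ((avg a)%:E = \int[leb]_(t in I2pi) ((2 * pi)^-1 * a t)%:E)%E.
Proof.
move=> ca a0; have ia := segcont_integrable ca.
rewrite /avg EFinM /Rintegral fineK; last exact: integrable_fin_num.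
rewrite -ge0_integralZl_EFin ?invr_ge0 ?pi2_ge0//.
  by move=> t _; rewrite lee_fin a0.
by have /measurable_int := ia.
Qed.

(** Cauchy's formula on the circle of radius r + 1, whose distance to z is at
    least 1. *)
Lemma entire_sup_bound f z r : entire f -> cabs z <= r ->
  cabs (f z) <= (r + 1) * l1mean f (r + 1).
Proof.
move=> ef zr; have zr1 : cabs z < r + 1 by rewrite (le_lt_trans zr)// ltrDl.
have := taylor_remainder 0 ef zr1; rewrite big_ord0 subr0 expr0 mul1r.
move=> /le_trans; apply; rewrite ler_wpM2r ?l1mean_ge0//.
have r1 : 0 <= r + 1 by rewrite (le_trans (cabs_ge0 z))// ltW.
rewrite ler_piMr// invf_le1 ?subr_gt0//; move: zr; lra.
Qed.

Lemma mean_ge0 p f r : 0 <= r -> (0 <= integral_mean p f r)%E.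
Proof.
move=> r0; case: p => [s| |] //=; first exact: poweR_ge0.
apply: (@le_trans _ _ (cabs (f (polar r 0)))%:E); first by rewrite lee_fin cabs_ge0.
apply: ereal_sup_ubound; exists (polar r 0) => //=.
by rewrite cabs_polar ger0_norm.
Qed.

Section fixed_exponent.
Variable p : \bar R.
Hypothesis p1 : (1 <= p)%E.

Let s_ge1 s : p = s%:E -> 1 <= s.
Proof. by move=> pE; rewrite -lee_fin -pE. Qed.

Let s_gt0 s : p = s%:E -> 0 < s.
Proof. by move=> /s_ge1; exact: lt_le_trans. Qed.

Let c0 : (0 <= ((2 * pi)^-1 : R)%:E)%E.
Proof. by rewrite lee_fin invr_ge0 pi2_ge0. Qed.

Lemma le_mean f g r : 0 <= r -> circ r f -> circ r g ->
  (forall z, cabs z = r -> cabs (f z) <= cabs (g z)) ->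
  (integral_mean p f r <= integral_mean p g r)%E.
Proof.
move=> r0 cf cg fg; case pE : p => [s| |]; last exact: lexx.
- rewrite /integral_mean; apply: le_poweR; first by rewrite invr_ge0 (ltW (s_gt0 pE)).
    by rewrite mule_ge0// integral_ge0// => t _; rewrite lee_fin powR_ge0.
  apply: lee_wpmul2l; first exact: c0.
  apply: ge0_le_integral; first exact: measurable_itv.
  + by move=> t _; rewrite lee_fin powR_ge0.
  + by apply/measurable_EFinP/measurable_powR_fun; exact: measurable_circ.
  + by apply/measurable_EFinP/measurable_powR_fun; exact: measurable_circ.
  + move=> t _; rewrite lee_fin ge0_ler_powR ?nnegrE ?cabs_ge0 ?(ltW (s_gt0 pE))//.
    by rewrite fg// cabs_polar ger0_norm.
- apply: ge_ereal_sup => _ [z /= zr <-].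
  apply: (@le_trans _ _ (cabs (g z))%:E); first by rewrite lee_fin fg.
  by apply: ereal_sup_ubound; exists z.
Qed.

Lemma mean_cst c r : 0 <= r -> integral_mean p (fun=> c) r = (cabs c)%:E.
Proof.
move=> r0; case pE : p => [s| |] //=.
- rewrite integral_cst//= lebesgue_measure_itv/= lte_fin pi2_gt0 -EFinB subr0 -!EFinM.
  rewrite mulrCA mulVf ?mulr1 ?gt_eqF ?pi2_gt0//= -powRrM.
  by rewrite mulfV ?powRr1 ?cabs_ge0// gt_eqF ?(s_gt0 pE).
- rewrite (_ : [set _ | _ in _] = [set (cabs c)%:E]) ?ereal_sup1//.
  apply/seteqP; split => [_ [z _ <-]//|_ ->]; exists (polar r 0) => //=.
  by rewrite cabs_polar ger0_norm.
by move: p1; rewrite pE.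
Qed.

Lemma mean_fin f r : 0 <= r -> entire f -> integral_mean p f r \is a fin_num.
Proof.
move=> r0 ef; rewrite ge0_fin_numE ?mean_ge0//.
set B := (r + 1) * l1mean f (r + 1).
have B0 : 0 <= B by rewrite mulr_ge0 ?addr_ge0// l1mean_ge0.
apply: (@le_lt_trans _ _ (integral_mean p (fun=> B%:C) r)); last first.
  by rewrite mean_cst// ltry.
apply: le_mean => //; first exact: entire_circ.
  by apply: circ_cderivable => z _; exact: cderivable_cst.
by move=> z zr; rewrite cabs_real ger0_norm// entire_sup_bound// zr.
Qed.

Lemma meanD f g r : 0 <= r -> circ r f -> circ r g ->
  (integral_mean p (fun z => f z + g z)%R r <=
   integral_mean p f r + integral_mean p g r)%E.
Proof.
move=> r0 cf cg; case pE : p => [s| |].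
- have s0 := s_gt0 pE; have s1 := s_ge1 pE.
  have mf := measurable_circ cf; have mg := measurable_circ cg.
  have cfg : circ r (fun z => f z + g z) by move=> t; exact: ccontD.
  have E k : integral_mean s%:E k r = (((2 * pi)^-1)%:E `^ s^-1 *
      (\int[leb]_(t in I2pi) (cabs (k (polar r t)) `^ s)%:E) `^ s^-1)%E.
    rewrite -poweRM//; apply: integral_ge0 => t _; by rewrite lee_fin powR_ge0.
  rewrite (E f) (E g) (E (fun z => f z + g z)).
  rewrite -ge0_muleDr ?poweR_ge0//; apply: lee_wpmul2l; first exact: poweR_ge0.
  apply: (le_trans _ (minkowski_on leb (measurable_itv _) s1 mf mg _ _)).
  + apply: le_poweR; first by rewrite invr_ge0 ltW.
      by rewrite integral_ge0// => t _; rewrite lee_fin powR_ge0.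
    apply: ge0_le_integral => //.
    * by move=> t _; rewrite lee_fin powR_ge0.
    * by apply/measurable_EFinP/measurable_powR_fun; exact: (measurable_circ cfg).
    * by apply/measurable_EFinP/measurable_powR_fun; exact: measurable_funD.
    * move=> t _; rewrite lee_fin ge0_ler_powR ?nnegrE ?addr_ge0 ?cabs_ge0 ?cabsD//.
      exact: ltW.
  + by move=> t _; exact: cabs_ge0.
  + by move=> t _; exact: cabs_ge0.
- apply: ge_ereal_sup => _ [z /= zr <-].
  rewrite (@le_trans _ _ ((cabs (f z))%:E + (cabs (g z))%:E)%E)//.
    by rewrite -EFinD lee_fin cabsD.
  by apply: leeD; apply: ereal_sup_ubound; exists z.
- by move: p1; rewrite pE.
Qed.

Lemma meanZ c f r : 0 <= r -> circ r f ->
  (integral_mean p (fun z => c * f z)%R r = (cabs c)%:E * integral_mean p f r)%E.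
Proof.
move=> r0 cf; have [-> |cn0] := eqVneq c 0.
  have -> : (fun z => 0 * f z) = (fun=> 0) by apply: funext => z; rewrite mul0r.
  by rewrite mean_cst// cabs0 mul0e.
case pE : p => [s| |].
- have s0 := s_gt0 pE; rewrite /=.
  have -> : (\int[leb]_(t in I2pi) (cabs (c * f (polar r t)) `^ s)%:E =
      (cabs c `^ s)%:E * \int[leb]_(t in I2pi) (cabs (f (polar r t)) `^ s)%:E)%E.
    rewrite -ge0_integralZl_EFin ?powR_ge0//.
    + by apply: eq_integral => t _; rewrite -EFinM -powRM ?cabs_ge0// cabsM.
    + by move=> t _; rewrite lee_fin powR_ge0.
    + by apply/measurable_EFinP/measurable_powR_fun; exact: measurable_circ.
  have i0 : (0 <= \int[leb]_(t in I2pi) (cabs (f (polar r t)) `^ s)%:E)%E.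
    by rewrite integral_ge0// => t _; rewrite lee_fin powR_ge0.
  rewrite muleCA [LHS]poweRM ?lee_fin ?powR_ge0 ?mule_ge0//.
  by rewrite poweR_EFin -powRrM mulfV ?powRr1 ?cabs_ge0// gt_eqF.
- have ge d k : (integral_mean +oo (fun z => d * k z)%R r <=
      (cabs d)%:E * integral_mean +oo k r)%E.
    apply: ge_ereal_sup => _ [z /= zr <-]; rewrite cabsM EFinM.
    by apply: lee_wpmul2l; rewrite ?lee_fin ?cabs_ge0//; apply: ereal_sup_ubound; exists z.
  apply/eqP; rewrite eq_le ge andTb.
  have := ge c^-1 (fun z => c * f z).
  rewrite (_ : (fun z => c^-1 * (c * f z)) = f); last first.
    by apply: funext => z; rewrite mulrA mulVf// mul1r.
  rewrite cabsV => H; have := lee_wpmul2l _ H (x := (cabs c)%:E).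
  rewrite lee_fin cabs_ge0 muleA -EFinM mulfV ?mul1e; first by apply.
  by rewrite cabs_eq0.
- by move: p1; rewrite pE.
Qed.

Lemma mean_monomial n r : 0 <= r -> integral_mean p (fun z => z ^+ n) r = (r ^+ n)%:E.
Proof.
move=> r0; have e := @mean_cst (r ^+ n)%:C r r0.
rewrite cabs_real ger0_norm ?exprn_ge0// in e; rewrite -e.
have c1 : circ r (fun z => z ^+ n) by apply: circ_cderivable => z _; exact: cderivableX.
have c2 : circ r (fun=> (r ^+ n)%:C).
  by apply: circ_cderivable => z _; exact: cderivable_cst.
apply/eqP; rewrite eq_le; apply/andP; split; apply: le_mean => // z zr;
  by rewrite cabsX zr cabs_real ger0_norm ?exprn_ge0.
Qed.

(** Jensen's inequality for the normalized measure of the circle. *)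
Lemma l1mean_le f r : 0 <= r -> entire f -> ((l1mean f r)%:E <= integral_mean p f r)%E.
Proof.
move=> r0 ef; have cf := entire_circ r ef; case pE : p => [s| |].
- have s0 := s_gt0 pE; have s1 := s_ge1 pE.
  rewrite /l1mean /= avgE; [|exact: circ_abs|by move=> t; exact: cabs_ge0].
  have mf := measurable_circ cf.
  have := @jensen_powR R _ _ leb I2pi (fun=> (2 * pi)^-1) (fun t => cabs (f (polar r t)))
    s 1 ((r + 1) * l1mean f (r + 1)) _ s1 _ mf.
  rewrite powR1 mul1e => H.
  set x := (X in (X <= _)%E).
  have x0 : (0 <= x)%E.
    by apply: integral_ge0 => t _; rewrite lee_fin mulr_ge0 ?cabs_ge0 ?invr_ge0 ?pi2_ge0.
  have -> : x = ((x `^ s) `^ s^-1)%E by rewrite -poweRrM mulfV ?poweRe1// gt_eqF.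
  apply: le_poweR.
  + by rewrite invr_ge0 ltW.
  + exact: poweR_ge0.
  + apply: (le_trans (H _ _ _ _ _)) => //.
    * by move=> t _; rewrite cabs_ge0 entire_sup_bound// cabs_polar ger0_norm.
    * rewrite integral_cst//= lebesgue_measure_itv/= lte_fin pi2_gt0 -EFinB subr0 -EFinM.
      by rewrite mulVf// gt_eqF// pi2_gt0.
    * rewrite -ge0_integralZl_EFin ?invr_ge0 ?pi2_ge0//.
      - by move=> t _; rewrite lee_fin powR_ge0.
      - by apply/measurable_EFinP/measurable_powR_fun.
- rewrite /l1mean; set S := integral_mean _ _ _.
  have [B SB] : exists B : R, S = B%:E.
    have := mean_fin r0 ef; rewrite pE -/S => /fineK SE.
    by exists (fine S).
  rewrite SB lee_fin -(avg_cst B); apply: le_avg; first exact: circ_abs.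
    by move=> t _; exact: cvg_cst.
  move=> t; rewrite -lee_fin -SB; apply: ereal_sup_ubound.
  by exists (polar r t) => //=; rewrite cabs_polar ger0_norm.
- by move: p1; rewrite pE.
Qed.

(** On the smaller circle, the function is dominated by a Poisson average of its
    rotations on the larger one, and rotations preserve the mean. *)
Lemma le_mean_radius f r1 r2 : entire f -> 0 <= r1 -> r1 <= r2 ->
  (integral_mean p f r1 <= integral_mean p f r2)%E.
Proof.
move=> ef r10; rewrite le_eqVlt => /predU1P[->//|r12].
have r20 : 0 < r2 := le_lt_trans r10 r12.
pose rho := r1 / r2.
have rho01 : 0 <= rho < 1.
  by rewrite divr_ge0 ?(ltW r20)//= ltr_pdivrMr// mul1r.
have cP := poisson_segcont rho01.
have P0 := poisson_ge0 rho01.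
have cc (z : R[i]) : segcont 0 (2 * pi) (fun t => cabs (f (polar 1 t * z))).
  have eF := @entire_dilation R f z ef.
  exact: (circ_abs (entire_circ 1 eF)).
case pE : p => [s| |].
- have s0 := s_gt0 pE; have s1 := s_ge1 pE.
  have Afin : (\int[leb]_(t in I2pi) (cabs (f (polar r2 t)) `^ s)%:E)%E \is a fin_num.
    rewrite ge0_fin_numE; last by apply: integral_ge0 => t _; rewrite lee_fin powR_ge0.
    rewrite ltey; apply/eqP => E; have := mean_fin (ltW r20) ef; rewrite pE /= E.
    by rewrite mulry gtr0_sg ?invr_gt0 ?pi2_gt0// mul1e poweRyr// invr_eq0 gt_eqF.
  rewrite /=; apply: le_poweR; first by rewrite invr_ge0 ltW.
    by rewrite mule_ge0// integral_ge0// => t _; rewrite lee_fin powR_ge0.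
  apply: lee_wpmul2l; first exact: c0.
  set A := (\int[leb]_(t in I2pi) (cabs (f (polar r2 t)) `^ s)%:E)%E in Afin *.
  have A0 : 0 <= fine A.
    by apply: fine_ge0; apply: integral_ge0 => t _; rewrite lee_fin powR_ge0.
  have := @superposition_powR R _ _ _ _ leb leb I2pi I2pi
    (fun y => (2 * pi)^-1 * poisson rho y)
    (fun ty => cabs (f (polar r2 (ty.1 + ty.2)))) (fun t => cabs (f (polar r1 t)))
    s 1 (fine A).
  rewrite powR1 mul1r (fineK Afin) => H; apply: H.
  + exact: measurable_itv.
  + exact: measurable_itv.
  + exact: s1.
  + apply: measurable_funM; first exact: measurable_cst.
    by have /segcont_integrable/measurable_int/measurable_EFinP := cP.
  + have mu2 (k : R -> R) : continuous k ->
        measurable_fun (I2pi `*` I2pi) (fun ty : R * R => r2 * k (ty.1 + ty.2)).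
      move=> ck; apply: measurable_funTS; apply: measurable_funM => //.
      apply: (measurableT_comp (continuous_measurable_fun ck)).
      exact: measurable_funD.
    have [mR mI] := @entire_measurable R _ _ (I2pi `*` I2pi) f
      (fun ty => polar r2 (ty.1 + ty.2)) ef (measurableX (measurable_itv _) (measurable_itv _))
      (mu2 _ (@continuous_cos R)) (mu2 _ (@continuous_sin R)).
    exact: measurable_cabs.
  + exact: measurable_circ (entire_circ r1 ef).
  + by move=> y _; rewrite mulr_ge0 ?P0// invr_ge0 pi2_ge0.
  + by move=> x y _ _; exact: cabs_ge0.
  + move=> x _; exists ((r2 + 1) * l1mean f (r2 + 1)) => y _.
    by rewrite entire_sup_bound// cabs_polar ger0_norm// ltW.
  + exact: A0.
  + by rewrite -avgE// avg_poisson.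
  + move=> y y2.
    pose hh t := (cabs (f (polar r2 t)) `^ s)%:E.
    rewrite le_eqVlt; apply/orP; left; apply/eqP.
    apply: (@integral_rotation R hh y) => //.
    * apply/measurable_EFinP/measurable_powR_fun; apply: continuous_measurable_fun => t.
      by have [] := circ_cabs (entire_circ r2 ef) t.
    * by move=> t; rewrite lee_fin powR_ge0.
    * move=> t; rewrite /hh; congr ((cabs (f _) `^ s)%:E).
      rewrite /polar mulr_natl mulr2n -mulr2n.
      by rewrite cosD2pi sinD2pi.
  + by move=> t _; exact: cabs_ge0.
  + move=> t _; have := poisson_bound rho01 (polar r2 t) ef.
    have -> : rho%:C * polar r2 t = polar r1 t.
      by rewrite [RHS]polarE [polar r2 t]polarE mulrA -rmorphM divfK ?gt_eqF.
    rewrite -lee_fin avgE; last 2 first.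
    * move=> x x2; apply: (@continuousM R R^o); [exact: cP|exact: cc].
    * by move=> x; rewrite mulr_ge0 ?cabs_ge0 ?P0.
    move=> /le_trans; apply; rewrite le_eqVlt; apply/orP; left; apply/eqP.
    apply: eq_integral => y _; rewrite mulrA /= polarM mul1r [(y + t)%R]addrC.
    by [].
- apply: ge_ereal_sup => _ [z /= zr <-].
  set S := ereal_sup _.
  have [B SB] : exists B : R, S = B%:E.
    have := mean_fin (ltW r20) ef; rewrite pE -/S => /fineK SE.
    by exists (fine S).
  rewrite SB lee_fin.
  have [z' z'r ->] : exists2 z', cabs z' = r2 & z = rho%:C * z'.
    have [r1z|r1n] := eqVneq r1 0.
      exists (polar r2 0); first by rewrite cabs_polar gtr0_norm.
      by rewrite /rho r1z mul0r mul0r; apply/eqP; rewrite -cabs_eq0 zr r1z.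
    exists ((r2 / r1)%:C * z).
      by rewrite cabsM cabs_real zr ger0_norm ?divr_ge0 ?(ltW r20)// divfK.
    rewrite mulrA -rmorphM /rho (_ : r1 / r2 * (r2 / r1) = 1) ?rmorph1 ?mul1r//.
    by field; rewrite r1n gt_eqF.
  rewrite (le_trans (poisson_bound rho01 z' ef))//.
  have cPB : segcont 0 (2 * pi) (fun t => poisson rho t * B).
    by move=> t t2; apply: (@continuousM R R^o); [exact: cP|exact: cvg_cst].
  rewrite (@le_trans _ _ (avg (fun t => poisson rho t * B)))//.
    apply: le_avg => //.
      by move=> t t2; apply: (@continuousM R R^o); [exact: cP|exact: cc].
    move=> t; rewrite ler_wpM2l ?P0// -lee_fin -SB; apply: ereal_sup_ubound.
    by exists (polar 1 t * z') => //=; rewrite cabsM cabs_polar normr1 mul1r.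
  under [X in avg X]eq_fun do rewrite mulrC.
  by rewrite avgZ// avg_poisson// mulr1.
- by move: p1; rewrite pE.
Qed.

End fixed_exponent.
End IntegralMeans.

(** * Hausdorff operators of measures on ]1, +oo[ *)

Section ComplexIntegral.
Context {R : realType}.
Variable mu : {measure set (measurableTypeR R) -> \bar R}.
Variable E : set R.
Hypothesis mE : measurable E.
Implicit Types (F G : R -> R[i]) (c : R[i]).

Lemma cintegrableD F G : cintegrable mu E F -> cintegrable mu E G ->
  cintegrable mu E (fun t => F t + G t).
Proof.
move=> [FR FI] [GR GI]; split.
  by under eq_fun do rewrite cReD EFinD; exact: integrableD.
by under eq_fun do rewrite cImD EFinD; exact: integrableD.
Qed.

Lemma cintegrableZ c F : cintegrable mu E F -> cintegrable mu E (fun t => c * F t).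
Proof.
move=> [FR FI]; split.
  under eq_fun do rewrite cReM EFinB !EFinM.
  by apply: integrableB => //; exact: integrableZl.
under eq_fun do rewrite cImM EFinD !EFinM.
by apply: integrableD => //; exact: integrableZl.
Qed.

Lemma cintegralD F G : cintegrable mu E F -> cintegrable mu E G ->
  cintegral mu E (fun t => F t + G t) = cintegral mu E F + cintegral mu E G.
Proof.
move=> [FR FI] [GR GI]; apply: complex_ext.
  rewrite cReD /cintegral/= -RintegralD//.
  by apply: eq_Rintegral => t _; rewrite cReD.
rewrite cImD /cintegral/= -RintegralD//.
by apply: eq_Rintegral => t _; rewrite cImD.
Qed.

Lemma cintegralZ c F : cintegrable mu E F ->
  cintegral mu E (fun t => c * F t) = c * cintegral mu E F.
Proof.
move=> [FR FI].
have Zi (a : R) (h : R -> R) : mu.-integrable E (EFin \o h) ->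
    mu.-integrable E (EFin \o (fun t => a * h t)).
  by move=> hi; rewrite (_ : _ \o _ = (fun t => a%:E * (h t)%:E)%E)//; exact: integrableZl.
apply: complex_ext.
  rewrite cReM /cintegral/= -!RintegralZl// -RintegralB//; do ?exact: Zi.
  by apply: eq_Rintegral => t _; rewrite cReM.
rewrite cImM /cintegral/= -!RintegralZl// -RintegralD//; do ?exact: Zi.
by apply: eq_Rintegral => t _; rewrite cImM.
Qed.

Lemma cintegrable_cabs F : cintegrable mu E F ->
  mu.-integrable E (fun t => (cabs (F t))%:E).
Proof.
move=> [FR FI].
have mR : measurable_fun E (fun t => complex.Re (F t)).
  by apply/measurable_EFinP; exact: measurable_int FR.
have mI : measurable_fun E (fun t => complex.Im (F t)).
  by apply/measurable_EFinP; exact: measurable_int FI.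
apply: (@le_integrable _ _ _ mu E mE _
    (fun t => (`|complex.Re (F t)|%:E + `|complex.Im (F t)|%:E)%E)).
- by apply/measurable_EFinP; exact: measurable_cabs.
- move=> t _; rewrite /= lee_fin ger0_norm ?cabs_ge0//.
  by rewrite (le_trans (cabs_le_ReIm _))// ler_norm.
- by apply: integrableD; [|exact: (integrable_norm FR)|exact: (integrable_norm FI)].
Qed.

Lemma cabs_cintegral F : cintegrable mu E F ->
  ((cabs (cintegral mu E F))%:E <= \int[mu]_(t in E) (cabs (F t))%:E)%E.
Proof.
move=> iF; set m := cintegral mu E F.
have [->|m0] := eqVneq m 0.
  by rewrite cabs0 integral_ge0// => t _; rewrite lee_fin cabs_ge0.
pose c := (cabs m)%:C / m.
have c1 : cabs c = 1.
  by rewrite cabsM cabsV cabs_real ger0_norm ?cabs_ge0// divff// cabs_eq0.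
have -> : cabs m = complex.Re (c * m) by rewrite divfK.
have icF := cintegrableZ c iF; rewrite -cintegralZ// /cintegral/= /Rintegral fineK.
  apply: le_integral => //; first exact: icF.1.
    exact: cintegrable_cabs.
  move=> t _; rewrite lee_fin (le_trans (ler_norm _))// (le_trans (Re_le_cabs _))//.
  by rewrite cabsM c1 mul1r.
by apply: integrable_fin_num => //; exact: icF.1.
Qed.

End ComplexIntegral.

Section PartialHausdorff.
Context {R : realType}.
Variable mu : {measure set (measurableTypeR R) -> \bar R}.
Variables (E : set R) (W : R).
Hypothesis mE : measurable E.
Hypothesis E1 : E `<=` `]1, +oo[%classic.
Hypothesis EW : (\int[mu]_(t in E) (t^-1)%:E = W%:E)%E.
Implicit Types (f g : R[i] -> R[i]) (z : R[i]) (t : R).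

(** Restricting the measure makes it possible to treat the factors close to 1
    apart. *)
Definition hausdorff_on f z : R[i] := cintegral mu E (hausdorff_integrand f z).

Let tgt1 t : E t -> 1 < t.
Proof. by move=> /E1 /=; rewrite in_itv/= andbT. Qed.

Let tgt0 t : E t -> 0 < t.
Proof. by move=> /tgt1; exact: lt_trans. Qed.

Lemma measurable_inv (D : set R) : measurable D -> D `<=` `]0, +oo[%classic ->
  measurable_fun D (fun t : R => t^-1).
Proof.
move=> mD D0; apply: (measurable_funS _ D0); first exact: measurable_itv.
apply: open_continuous_measurable_fun; first exact: interval_open.
move=> t; rewrite inE/= in_itv/= andbT => t0.
by apply: inv_continuous; rewrite gt_eqF.
Qed.

Let mEinv : measurable_fun E (fun t : R => t^-1).
Proof. by apply: measurable_inv => // t /tgt0; rewrite /= in_itv/= andbT. Qed.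

Lemma div_real z t : z / t%:C = (complex.Re z * t^-1) +i* (complex.Im z * t^-1).
Proof.
rewrite -fmorphV; apply: complex_ext; rewrite ?cReM ?cImM/=; ring.
Qed.

Lemma cabs_div_real z t : 0 < t -> cabs (z / t%:C) = cabs z / t.
Proof. by move=> t0; rewrite cabsM cabsV cabs_real gtr0_norm. Qed.

Lemma measurable_dilation (D : set R) f z : entire f -> measurable D ->
  D `<=` `]0, +oo[%classic ->
  measurable_fun D (fun t => complex.Re (f (z / t%:C))) /\
  measurable_fun D (fun t => complex.Im (f (z / t%:C))).
Proof.
move=> ef mD D0; have mi := measurable_inv mD D0.
apply: entire_measurable => //; under eq_fun do rewrite div_real;
  by apply: measurable_funM.
Qed.

Lemma cintegrable_le (F : R -> R[i]) (B : R) :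
  measurable_fun E (fun t => complex.Re (F t)) ->
  measurable_fun E (fun t => complex.Im (F t)) ->
  (forall t, E t -> cabs (F t) <= B * t^-1) -> cintegrable mu E F.
Proof.
move=> mR mI FB.
have iB : mu.-integrable E (fun t => (B%:E * (t^-1)%:E)%E).
  apply: integrableZl => //; apply/integrableP; split; first exact/measurable_EFinP.
  rewrite [ltLHS](_ : _ = W%:E) ?ltry// -EW; apply: eq_integral => t /set_mem Et.
  by rewrite abse_EFin ger0_norm// invr_ge0 ltW// tgt0.
have le (u : R[i] -> R) : (forall z, `|u z| <= cabs z) ->
    measurable_fun E (fun t => u (F t)) -> mu.-integrable E (fun t => (u (F t))%:E).
  move=> ub mu'; apply: (@le_integrable _ _ _ mu E mE _ (fun t => (B%:E * (t^-1)%:E)%E)) => //.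
    exact/measurable_EFinP.
  move=> t Et /=; rewrite lee_fin.
  by rewrite (le_trans (ub _))// (le_trans (FB t Et))// ler_norm.
split; first exact: (le _ (@Re_le_cabs R)).
exact: (le _ (@Im_le_cabs R)).
Qed.

Let bnd f z := (cabs z + 1) * l1mean f (cabs z + 1).

Let bndP f z t : entire f -> E t -> cabs (f (z / t%:C)) <= bnd f z.
Proof.
move=> ef Et; apply: entire_sup_bound => //; rewrite cabs_div_real ?tgt0//.
by rewrite ler_pdivrMr ?tgt0// ler_peMr ?cabs_ge0// ltW// tgt1.
Qed.

Lemma measurable_integrand (D : set R) f z : entire f -> measurable D ->
  D `<=` `]0, +oo[%classic ->
  measurable_fun D (fun t => complex.Re (hausdorff_integrand f z t)) /\
  measurable_fun D (fun t => complex.Im (hausdorff_integrand f z t)).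
Proof.
move=> ef mD D0; have mi := measurable_inv mD D0.
have [mR mI] := measurable_dilation z ef mD D0.
split.
  apply: eq_measurable_fun (measurable_funM mi mR) => t _.
  by rewrite /hausdorff_integrand cReM/= mul0r subr0.
apply: eq_measurable_fun (measurable_funM mi mI) => t _.
by rewrite /hausdorff_integrand cImM/= mul0r addr0.
Qed.

Lemma hausdorff_on_integrable f z : entire f ->
  cintegrable mu E (hausdorff_integrand f z).
Proof.
move=> ef; have [|mR mI] := measurable_integrand z ef mE.
  by move=> t /tgt0; rewrite /= in_itv/= andbT.
apply: (@cintegrable_le _ (bnd f z)) => // t Et.
rewrite /hausdorff_integrand cabsM cabs_real ger0_norm ?invr_ge0 ?(ltW (tgt0 Et))//.
by rewrite mulrC ler_wpM2r ?invr_ge0 ?(ltW (tgt0 Et))// bndP.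
Qed.

Lemma cabs_hausdorff_on f z : entire f ->
  ((cabs (hausdorff_on f z))%:E <=
   \int[mu]_(t in E) (t^-1 * cabs (f (z / t%:C)))%:E)%E.
Proof.
move=> ef; have iF := hausdorff_on_integrable z ef.
apply: (le_trans (cabs_cintegral mE iF)).
rewrite le_eqVlt; apply/orP; left; apply/eqP; apply: eq_integral => t /set_mem Et.
by rewrite cabsM cabs_real ger0_norm// invr_ge0 ltW// tgt0.
Qed.

Let W0 : 0 <= W.
Proof.
by rewrite -lee_fin -EW; apply: integral_ge0 => t /tgt0 t0; rewrite lee_fin invr_ge0 ltW.
Qed.

Let mEFinv : measurable_fun E (fun t : R => (t^-1)%:E).
Proof. exact/measurable_EFinP. Qed.

Lemma hausdorff_on_le f z (B : R) : entire f -> 0 <= B ->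
  (forall t, E t -> cabs (f (z / t%:C)) <= B) -> cabs (hausdorff_on f z) <= B * W.
Proof.
move=> ef B0 fB; rewrite -lee_fin (le_trans (cabs_hausdorff_on z ef))//.
have iF := cintegrable_cabs mE (hausdorff_on_integrable z ef).
rewrite EFinM -EW -ge0_integralZl_EFin//; last first.
  by move=> t /tgt0 t0; rewrite lee_fin invr_ge0 ltW.
apply: ge0_le_integral => //.
- by move=> t /tgt0 t0; rewrite lee_fin mulr_ge0 ?cabs_ge0 ?invr_ge0 ?(ltW t0).
- apply: eq_measurable_fun (measurable_int _ iF) => t /set_mem Et.
  by rewrite cabsM cabs_real ger0_norm// invr_ge0 ltW// tgt0.
- exact: measurable_funeM.
- move=> t Et; rewrite -EFinM lee_fin mulrC ler_wpM2r ?fB// invr_ge0 ltW//.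
  exact: tgt0.
Qed.

(** The chord inequality survives integration, so the integral is entire. *)
Lemma hausdorff_on_entire f : entire f -> entire (hausdorff_on f).
Proof.
move=> ef; apply: chord_entire => z.
pose r := cabs z + 2.
have r0 : 0 <= r by rewrite addr_ge0 ?cabs_ge0.
pose M := (r + 1) * l1mean f (r + 1).
have M0 : 0 <= M by rewrite mulr_ge0 ?l1mean_ge0// addr_ge0.
exists (M * r * W) => h k h1 k1.
set D := cabs h * cabs k * cabs (h - k).
have D0 : 0 <= D by rewrite !mulr_ge0 ?cabs_ge0.
have I w := hausdorff_on_integrable w ef.
pose Phi t := k * (hausdorff_integrand f (z + h) t + (- 1) * hausdorff_integrand f z t) +
  (- h) * (hausdorff_integrand f (z + k) t + (- 1) * hausdorff_integrand f z t).
have iD a b : cintegrable mu E (fun t => hausdorff_integrand f a t +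
    (- 1) * hausdorff_integrand f b t).
  by apply: cintegrableD => //; apply: cintegrableZ.
have iPhi : cintegrable mu E Phi.
  by apply: cintegrableD => //; apply: cintegrableZ.
have -> : k * (hausdorff_on f (z + h) - hausdorff_on f z) -
    h * (hausdorff_on f (z + k) - hausdorff_on f z) = cintegral mu E Phi.
  rewrite /Phi cintegralD ?cintegralZ ?cintegralD ?cintegralZ//;
    do ?exact: cintegrableZ.
  by rewrite !mulN1r mulNr.
rewrite -lee_fin (le_trans (cabs_cintegral mE iPhi))//.
have -> : (M * r * W * D)%:E = ((M * r * D)%:E * W%:E)%E by rewrite -EFinM; congr EFin; ring.
rewrite -EW -ge0_integralZl_EFin//; last 2 first.
- by move=> t /tgt0 t0; rewrite lee_fin invr_ge0 ltW.
- exact: mulr_ge0 (mulr_ge0 M0 r0) D0.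
apply: ge0_le_integral => //.
- by move=> t _; rewrite lee_fin cabs_ge0.
- exact: measurable_int (cintegrable_cabs mE iPhi).
- exact: measurable_funeM.
move=> t Et; have t0 := tgt0 Et; have t1 := tgt1 Et.
rewrite -EFinM lee_fin.
have tn0 : t%:C != 0 by rewrite -cabs_gt0 cabs_real gtr0_norm.
have small v : cabs v <= 1 -> cabs (v / t%:C) <= 1.
  by move=> v1; rewrite cabs_div_real// ler_pdivrMr// mul1r (le_trans v1)// ltW.
have ch : chord_lipschitz f (z / t%:C) (M * r).
  apply: entire_chord => //.
    rewrite lerD2r cabs_div_real// ler_pdivrMr// ler_peMr ?cabs_ge0// ltW//.
  by move=> w wr; apply: entire_sup_bound => //; rewrite wr.
have := ch (h / t%:C) (k / t%:C) (small _ h1) (small _ k1).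
have -> : Phi t = (k / t%:C) * (f (z / t%:C + h / t%:C) - f (z / t%:C)) -
   (h / t%:C) * (f (z / t%:C + k / t%:C) - f (z / t%:C)).
  rewrite /Phi /hausdorff_integrand -!mulrDl fmorphV; ring.
move=> /le_trans; apply; rewrite -mulrBl !cabs_div_real//.
rewrite -[leRHS]mulrA ler_wpM2l ?(mulr_ge0 M0 r0)//.
have -> : cabs h / t * (cabs k / t) * (cabs (h - k) / t) = D / t * (t^-1 * t^-1).
  by rewrite /D; field; rewrite gt_eqF.
rewrite ler_piMr ?divr_ge0 ?(ltW t0)//.
by rewrite mulr_ile1 ?invr_ge0 ?(ltW t0)// invf_le1// ltW.
Qed.

Lemma hausdorff_onB f g z : entire f -> entire g ->
  hausdorff_on (fun w => f w - g w) z = hausdorff_on f z - hausdorff_on g z.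
Proof.
move=> ef eg; have iF := hausdorff_on_integrable z ef.
have iG := hausdorff_on_integrable z eg.
rewrite -[- hausdorff_on g z]mulN1r -cintegralZ// -cintegralD//; last exact: cintegrableZ.
congr cintegral; apply: funext => t; rewrite /hausdorff_integrand; ring.
Qed.

(** Tonelli's theorem needs sigma-finiteness: on a bounded part of E, the integrable
    function 1 / t is bounded below. *)
Let sigma_finite_on : sigma_finite setT (mrestr mu mE).
Proof.
exists (fun n : nat => `]-oo, n%:R]%classic : set R).
  apply/seteqP; split => // t _; exists (Num.bound `|t|) => //=.
  by rewrite in_itv/= (le_trans (ler_norm t))// ltW// archi_boundP.
move=> n; split; first exact: measurable_itv.
rewrite /mrestr.
have mI : measurable (`]-oo, n%:R]%classic `&` E) by apply: measurableI.
rewrite -[X in (X < _)%E]mul1e -integral_cst//.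
apply: (@le_lt_trans _ _ (n%:R%:E * W%:E)%E); last by rewrite -EFinM ltry.
rewrite -EW -ge0_integralZl_EFin//; last first.
  by move=> t /tgt0 t0; rewrite lee_fin invr_ge0 ltW.
apply: (@le_trans _ _ (\int[mu]_(t in `]-oo, n%:R]%classic `&` E) (n%:R%:E * (t^-1)%:E))%E).
  apply: ge0_le_integral => //.
    apply: measurable_funeM.
    exact: (measurable_funS mE (@subIsetr _ _ _) mEFinv).
  move=> t [/=]; rewrite in_itv/= => tn /tgt0 t0.
  by rewrite -EFinM lee_fin ler_pdivlMr// mul1r.
apply: ge0_subset_integral => //.
- exact: measurable_funeM.
- by move=> t /tgt0 t0; rewrite -EFinM lee_fin divr_ge0// ltW.
Qed.

Let nu0 : {measure set (measurableTypeR R) -> \bar R} := mrestr mu mE.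

Let nu : {sigma_finite_measure set (measurableTypeR R) -> \bar R} :=
  HB.pack_for {sigma_finite_measure set (measurableTypeR R) -> \bar R}
    (Measure.sort nu0) (@Measure_isSigmaFinite.Build _ _ _ (Measure.sort nu0) sigma_finite_on).

Let integral_nu (a : R -> \bar R) :
  (\int[nu]_(t in E) a t = \int[mu]_(t in E) a t)%E.
Proof.
by apply: eq_measure_integral => A mA AE; rewrite /= /mrestr setIidl.
Qed.

(** Dilations by factors larger than 1 do not increase the integral means, so a
    superposition of them increases them at most by its total mass. *)
Lemma mean_superposition p f h r : (1 <= p)%E -> 0 <= r -> entire f -> circ r h ->
  (forall z, cabs z = r -> ((cabs (h z))%:E <=
     \int[mu]_(t in E) (t^-1 * cabs (f (z / t%:C)))%:E)%E) ->
  (integral_mean p h r <= W%:E * integral_mean p f r)%E.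
Proof.
move=> p1 r0 ef ch hle.
have rt t : E t -> 0 <= r / t <= r.
  move=> Et; rewrite divr_ge0 ?(ltW (tgt0 Et))//= ler_pdivrMr ?tgt0//.
  by rewrite ler_peMr// ltW// tgt1.
case pE : p => [s| |].
- have s1 : 1 <= s by rewrite -lee_fin -pE.
  have s0 : 0 < s := lt_le_trans ltr01 s1.
  pose S (r : R) := (\int[lebesgue_measure]_(t in `[0%R, (2 * pi)%R])
    (cabs (f (polar r t)) `^ s)%:E)%E.
  have S0 x : (0 <= S x)%E by apply: integral_ge0 => t _; rewrite lee_fin powR_ge0.
  have c0 : (0 <= ((2 * pi)^-1 : R)%:E)%E by rewrite lee_fin invr_ge0 pi2_ge0.
  have Sfin : S r \is a fin_num.
    rewrite ge0_fin_numE// ltey; apply/eqP => SE.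
    have := mean_fin p1 r0 ef; rewrite pE /= -/(S r) SE.
    by rewrite mulry gtr0_sg ?invr_gt0 ?pi2_gt0// mul1e poweRyr// invr_eq0 gt_eqF.
  have Sle t : E t -> (S (r / t)%R <= S r)%E.
    move=> Et; have /andP[rt0 rt1] := rt t Et.
    have := le_mean_radius p1 ef rt0 rt1; rewrite pE /= -/(S r) -/(S (r / t)).
    move=> /(le_poweR (ltW s0) (poweR_ge0 _ _)).
    have pK x : (0 <= x -> (x `^ s^-1) `^ s = x)%E.
      by move=> x0; rewrite -poweRrM mulVf ?poweRe1// gt_eqF.
    rewrite [X in (X <= _)%E -> _]pK; last exact: mule_ge0.
    rewrite [X in (_ <= X)%E -> _]pK; last exact: mule_ge0.
    by rewrite lee_pmul2l// lte_fin invr_gt0 pi2_gt0.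
  have H := @superposition_powR R _ _ _ _ lebesgue_measure nu
    (`[0%R, (2 * pi)%R]%classic : set R) E (fun t => t^-1)
    (fun xt => cabs (f (polar r xt.1 / xt.2%:C))) (fun x => cabs (h (polar r x)))
    s W (fine (S r)).
  have {H}H : (\int[lebesgue_measure]_(x in `[0%R, (2 * pi)%R])
      (cabs (h (polar r x)) `^ s)%:E <= (W `^ s)%:E * S r)%E.
    rewrite -[S r in leRHS]fineK// -EFinM; apply: H.
    + exact: measurable_itv.
    + exact: mE.
    + exact: s1.
    + exact: mEinv.
    + have m2 : measurable_fun (`[0, 2 * pi]%classic `*` E) (fun xt : R * R => xt.2^-1).
        apply: (@measurable_comp _ _ _ _ _ _ E (fun t : R => t^-1)) => //.
          by move=> _ [[x y] [/= _ Dy] <-].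
        exact: measurable_funTS.
      have mk (k : R -> R) : continuous k ->
          measurable_fun (`[0, 2 * pi]%classic `*` E) (fun xt : R * R => r * k xt.1 * xt.2^-1).
        move=> ck; apply: measurable_funM => //; apply: measurable_funTS.
        apply: measurable_funM => //.
        exact: (measurableT_comp (continuous_measurable_fun ck)).
      have [] := @entire_measurable R _ _ (`[0, 2 * pi]%classic `*` E) f
        (fun xt => polar r xt.1 / xt.2%:C) ef (measurableX (measurable_itv _) mE).
      * have := mk _ (@continuous_cos R); apply: eq_measurable_fun => xt _.
        by rewrite div_real.
      * have := mk _ (@continuous_sin R); apply: eq_measurable_fun => xt _.
        by rewrite div_real.
      * by move=> mR mI; exact: measurable_cabs.
    + exact: measurable_circ.
    + by move=> t /tgt0 t0; rewrite invr_ge0 ltW.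
    + by move=> x t _ _; exact: cabs_ge0.
    + move=> x _; exists (bnd f (polar r x)) => t Et; exact: bndP.
    + exact: fine_ge0.
    + by rewrite integral_nu.
    + move=> t Et; rewrite (fineK Sfin); apply: (le_trans _ (Sle t Et)).
      rewrite le_eqVlt; apply/orP; left.
      apply/eqP; apply: eq_integral => x _; congr ((cabs (f _) `^ s)%:E) => /=.
      by rewrite polarE [RHS]polarE rmorphM fmorphV/= mulrAC.
    + by move=> x _; exact: cabs_ge0.
    + move=> x _; rewrite integral_nu; apply: hle.
      by rewrite cabs_polar ger0_norm.
  rewrite /integral_mean -/(S r).
  have -> : (W%:E = ((W `^ s)%:E) `^ s^-1)%E.
    by rewrite poweR_EFin -powRrM mulfV ?gt_eqF// powRr1.
  rewrite -poweRM ?mule_ge0// ?lee_fin ?powR_ge0//.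
  apply: le_poweR; first by rewrite invr_ge0 ltW.
    by rewrite mule_ge0// integral_ge0// => t _; rewrite lee_fin powR_ge0.
  by rewrite muleCA; apply: lee_wpmul2l.
- apply: ge_ereal_sup => _ [z /= zr <-].
  apply: (le_trans (hle z zr)).
  set S := ereal_sup _; have [B SB] : exists B : R, S = B%:E.
    have := mean_fin p1 r0 ef; rewrite pE -/S => /fineK SE.
    by exists (fine S).
  rewrite SB -EW muleC.
  have fB t : E t -> cabs (f (z / t%:C)) <= B.
    move=> Et; have /andP[rt0 rt1] := rt t Et.
    rewrite -lee_fin -SB; have := le_mean_radius p1 ef rt0 rt1; rewrite pE.
    apply: le_trans; apply: ereal_sup_ubound; exists (z / t%:C) => //=.
    by rewrite cabs_div_real ?zr ?tgt0.
  have iF := cintegrable_cabs mE (hausdorff_on_integrable z ef).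
  have B0 : 0 <= B.
    by rewrite -lee_fin -SB; have := mean_ge0 p f r0; rewrite pE.
  rewrite -ge0_integralZl_EFin//; last first.
    by move=> t /tgt0 t0; rewrite lee_fin invr_ge0 ltW.
  apply: ge0_le_integral => //.
  + by move=> t /tgt0 t0; rewrite lee_fin mulr_ge0 ?cabs_ge0 ?invr_ge0 ?(ltW t0).
  + apply: eq_measurable_fun (measurable_int _ iF) => t /set_mem Et.
    by rewrite cabsM cabs_real ger0_norm// invr_ge0 ltW// tgt0.
  + exact: measurable_funeM.
  + move=> t Et; rewrite -EFinM lee_fin mulrC ler_wpM2r ?fB// invr_ge0 ltW//.
    exact: tgt0.
- by move: p1; rewrite pE.
Qed.

Lemma mean_hausdorff_on p f r : (1 <= p)%E -> 0 <= r -> entire f ->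
  (integral_mean p (hausdorff_on f) r <= W%:E * integral_mean p f r)%E.
Proof.
move=> p1 r0 ef; apply: mean_superposition => //.
  exact/entire_circ/hausdorff_on_entire.
by move=> z _; exact: cabs_hausdorff_on.
Qed.

End PartialHausdorff.

(** * Norms of radial profiles *)

Section RadialNorm.
Context {R : realType}.
Implicit Types (m : R -> R) (r s : R).
Local Notation leb := (@lebesgue_measure R).
Local Notation Rpos := (`[0%R, +oo[%classic : set R).

Variables (q : \bar R) (phi : R -> R).
Hypothesis q1 : (1 <= q)%E.
Hypothesis hphi : classC q phi.

Let phi0 r : 0 <= r -> 0 <= phi r.
Proof. by case: hphi => -[_ + _] _; exact. Qed.

(** The mixed norm depends on a function only through its integral means. Profiles
    that are not the means of a function, such as sums of means, occur in the
    estimates. *)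
Definition radial_norm m : \bar R :=
  match q with
  | s%:E => (\int[leb]_(r in Rpos)
      ((m r)%:E `^ s * (expR (- (s * phi r)) * r)%:E)) `^ s^-1
  | +oo => ereal_sup [set (m r)%:E * (expR (- phi r))%:E | r in Rpos]
  | -oo => 0
  end%E.

Definition profile m := measurable_fun Rpos m /\ forall r, 0 <= r -> 0 <= m r.

Lemma profileD m1 m2 : profile m1 -> profile m2 -> profile (fun r => m1 r + m2 r).
Proof.
move=> [f1 p1] [f2 p2]; split; first exact: measurable_funD.
by move=> r r0; rewrite addr_ge0 ?p1 ?p2.
Qed.

Lemma profileZ (c : R) m : 0 <= c -> profile m -> profile (fun r => c * m r).
Proof.
move=> c0 [f1 p1]; split; first by apply: measurable_funM => //; exact: measurable_cst.
by move=> r r0; rewrite mulr_ge0 ?p1.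
Qed.

Lemma profileX n : profile (fun r => r ^+ n).
Proof.
split; first by apply: measurable_funX; exact: measurable_id.
by move=> r r0; rewrite exprn_ge0.
Qed.

Lemma nondecreasing_profile m : (forall r, 0 <= r -> 0 <= m r) ->
  (forall r r', 0 <= r -> r <= r' -> m r <= m r') -> profile m.
Proof.
move=> m0 mm; split => //.
apply: (@eq_measurable_fun _ _ _ _ _ (fun r => m (Num.max 0 r))).
  by move=> r; rewrite inE/= in_itv/= andbT => r0; rewrite max_r.
apply: nondecreasing_measurable; first exact: measurable_itv.
move=> x y xy; apply: mm; first by rewrite le_max lexx.
by rewrite ge_max le_max lexx/= le_max xy orbT.
Qed.

Let phi_diff r : 0 <= r -> exists l, forall e, 0 < e -> exists2 d, 0 < d &
  forall x, 0 <= x -> `|x - r| < d -> `|phi x - phi r - l * (x - r)| <= e * `|x - r|.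
Proof.
move=> r0; case: hphi => -[[dphi [_ dP]] _ _] _; exists (dphi r) => e e0.
have /cvgrPdist_le/(_ e e0)[d /= d0 H] := dP r r0.
exists d => // x x0 xd; have [->|xr] := eqVneq x r.
  by rewrite !subrr mulr0 subr0 normr0 mulr0.
have xr' : x - r != 0 by rewrite subr_eq0.
have := H x; rewrite /= distrC in_itv/= andbT => /(_ xd xr x0) h.
have -> : phi x - phi r - dphi r * (x - r) =
    - ((dphi r - (phi x - phi r) / (x - r)) * (x - r)).
  by rewrite mulrBl divfK//; ring.
by rewrite normrN normrM ler_wpM2r.
Qed.

Let phi_cont : {within `[0%R, +oo[, continuous phi}.
Proof.
apply/subspace_continuousP => r; rewrite /= in_itv/= andbT => r0.
have [l lP] := phi_diff r0; have [d d0 dP] := lP 1 ltr01.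
apply/cvgrPdist_le => /= e e0.
pose c := `|l| + 1; have c0 : 0 < c by rewrite ltr_wpDl.
exists (Num.min d (e / c)); first by rewrite /= lt_min d0 divr_gt0.
move=> x /=; rewrite distrC lt_min => /andP[xd xe].
rewrite in_itv/= andbT => x0.
rewrite /from_subspace distrC -(subrK (l * (x - r)) (_ - _)).
rewrite (le_trans (ler_normD _ _))// normrM.
rewrite (@le_trans _ _ (1 * `|x - r| + `|l| * `|x - r|))//.
  by rewrite lerD2r dP.
by rewrite -mulrDl [1 + _]addrC -ler_pdivlMl// mulrC ltW.
Qed.

Let mphi : measurable_fun Rpos phi.
Proof. by apply: subspace_continuous_measurable_fun => //; exact: measurable_itv. Qed.

Let phi_derivable r : 0 < r -> derivable phi r 1.
Proof.
move=> r0; have [l lP] := phi_diff (ltW r0).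
apply/cvg_ex; exists l; apply/cvgrPdist_le => /= e e0.
have [d d0 dP] := lP e e0; exists (Num.min d r); first by rewrite /= lt_min d0.
move=> h /=; rewrite sub0r normrN lt_min => /andP[hd hr] h0.
have := dP (h + r); rewrite addrK -[h *: 1]/(h * 1) mulr1 => H.
have {H}H := H _ hd.
rewrite -[_ *: _]/(_ * _).
have -> : l - h^-1 * (phi (h + r) - phi r) = - (h^-1 * (phi (h + r) - phi r - l * h)).
  by field.
rewrite normrN normrM normfV ler_pdivrMl ?normr_gt0// [leRHS]mulrC H//.
by move: hr; rewrite ltr_norml => /andP[hr _]; rewrite -lerBlDr sub0r ltW.
Qed.

(** Since r * phi' r is eventually at least n, the function phi - n * ln is
    eventually nondecreasing. *)
Lemma weight_decay n : exists2 C, 0 < C & forall r, 0 <= r -> r ^+ n * expR (- phi r) <= C.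
Proof.
have [_ /cvgryPge/(_ n%:R)[R0 [_ R0P]]] := hphi.
pose R1 := Num.max 1 (R0 + 1).
have R11 : 1 <= R1 by rewrite le_max lexx.
have R10 : 0 < R1 := lt_le_trans ltr01 R11.
have R1P r : R1 <= r -> n%:R <= r * derive1 phi r.
  by rewrite ge_max => /andP[_ h]; apply: R0P; rewrite (lt_le_trans _ h)// ltrDl.
exists (R1 ^+ n); first by rewrite exprn_gt0.
move=> r r0; have [rR|Rr] := leP r R1.
  rewrite -[leRHS]mulr1; apply: ler_pM; rewrite ?exprn_ge0 ?expR_ge0//.
    by rewrite lerXn2r ?nnegrE// ltW.
  by rewrite -expR0 ler_expR oppr_le0 phi0.
have rp : 0 < r := lt_trans R10 Rr.
have mono : phi R1 - n%:R * ln R1 <= phi r - n%:R * ln r.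
  pose psi (x : R) : R := phi x - n%:R * ln x.
  have dpsi (x : R) : 0 < x -> is_derive x (1 : R) psi (derive1 phi x - n%:R * x^-1).
    move=> x0; have d1 : is_derive x (1 : R) phi (derive1 phi x).
      by rewrite derive1E; apply: derivableP; exact: phi_derivable.
    have d2 := @is_deriveZ _ _ _ (@ln R) n%:R x 1 _ (is_derive1_ln x0).
    exact: (is_deriveB d1 d2).
  apply: (@ger0_derive1_ndecry R psi R1 _ _ _ R1 r) => //; last exact: ltW.
  - move=> x; rewrite in_itv/= andbT => xR; have x0 := lt_trans R10 xR.
    by case: (dpsi x x0).
  - move=> x; rewrite in_itv/= andbT => xR; have x0 := lt_trans R10 xR.
    rewrite derive1E (@derive_val _ _ _ _ _ _ _ (dpsi x x0)) subr_ge0.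
    by rewrite ler_pdivrMr// mulrC R1P// ltW.
  - apply: derivable_within_continuous => x; rewrite in_itv/= andbT => xR.
    by case: (dpsi x (lt_le_trans R10 xR)).
have phiR := phi0 (ltW R10).
have pw (x : R) : 0 < x -> x ^+ n = expR (n%:R * ln x).
  by move=> x0; rewrite mulr_natl -lnXn// lnK// posrE exprn_gt0.
rewrite (pw _ rp) (pw _ R10) -expRD ler_expR.
move: mono phiR; lra.
Qed.

(** The factor that absorbs the density expR (- (s * phi r)) * r of the norm into
    the power of exponent s. *)
Let wt s r := expR (- phi r) * r `^ s^-1.

Let mwt s : measurable_fun Rpos (wt s).
Proof.
apply: measurable_funM; last by apply: measurable_powR_fun; exact: measurable_id.
apply: (measurableT_comp (continuous_measurable_fun (@continuous_expR R))).
exact: measurable_funN.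
Qed.

Let wt0 s r : 0 <= wt s r.
Proof. by rewrite mulr_ge0 ?expR_ge0 ?powR_ge0. Qed.

Let s_ge1 s : q = s%:E -> 1 <= s.
Proof. by move=> qE; rewrite -lee_fin -qE. Qed.

Let s_gt0 s : q = s%:E -> 0 < s.
Proof. by move=> /s_ge1; exact: lt_le_trans. Qed.

Let norm_finE s m : q = s%:E -> (forall r, 0 <= r -> 0 <= m r) ->
  (radial_norm m = (\int[leb]_(r in Rpos) ((m r * wt s r) `^ s)%:E) `^ s^-1)%E.
Proof.
move=> qE m0; have s0 := s_gt0 qE.
rewrite /radial_norm qE; congr (_ `^ _)%E; apply: eq_integral => r.
rewrite inE/= in_itv/= andbT => r0.
rewrite -EFinM powRM ?m0// /wt powRM ?expR_ge0 ?powR_ge0//.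
rewrite -powRrM mulVf ?gt_eqF// powRr1//.
by rewrite [expR (- phi r) `^ s]/powR gt_eqF ?expR_gt0// expRK mulrN.
Qed.

Let mprod s m : profile m -> measurable_fun Rpos (fun r => m r * wt s r).
Proof. by move=> [mm _]; exact: measurable_funM. Qed.

Let mprodE s m : profile m -> measurable_fun Rpos (fun r => ((m r * wt s r) `^ s)%:E).
Proof. by move=> mm; apply/measurable_EFinP/measurable_powR_fun; exact: mprod. Qed.

Let posE r : Rpos r = (0 <= r) :> Prop.
Proof. by rewrite /= in_itv/= andbT. Qed.

Lemma le_radial_norm m1 m2 : profile m1 -> profile m2 ->
  (forall r, 0 <= r -> m1 r <= m2 r) -> (radial_norm m1 <= radial_norm m2)%E.
Proof.
move=> p1 p2 m12; case qE : q => [s| |].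
- have s0 := s_gt0 qE; rewrite (norm_finE qE p1.2) (norm_finE qE p2.2).
  apply: le_poweR; first by rewrite invr_ge0 ltW.
    by apply: integral_ge0 => r _; rewrite lee_fin powR_ge0.
  apply: ge0_le_integral; first exact: measurable_itv.
  + by move=> r _; rewrite lee_fin powR_ge0.
  + exact: mprodE.
  + exact: mprodE.
  + move=> r; rewrite posE => r0; rewrite lee_fin ge0_ler_powR ?nnegrE ?(ltW s0)//.
    * by rewrite mulr_ge0 ?p1.2.
    * by rewrite mulr_ge0 ?p2.2.
    * by rewrite ler_wpM2r// m12.
- rewrite /radial_norm qE; apply: ge_ereal_sup => _ [r r0 <-].
  apply: (@le_trans _ _ ((m2 r)%:E * (expR (- phi r))%:E)%E); last first.
    by apply: ereal_sup_ubound; exists r.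
  by move: r0; rewrite posE => r0; rewrite -!EFinM lee_fin ler_wpM2r ?expR_ge0// m12.
- by move: q1; rewrite qE.
Qed.

Lemma radial_norm_ge0 m : profile m -> (0 <= radial_norm m)%E.
Proof.
move=> pm; rewrite /radial_norm; case: q => [s| |] //; first exact: poweR_ge0.
apply: (@le_trans _ _ ((m 0)%:E * (expR (- phi 0))%:E)%E).
  by rewrite -EFinM lee_fin mulr_ge0 ?pm.2 ?expR_ge0.
by apply: ereal_sup_ubound; exists 0 => //; rewrite posE.
Qed.

Lemma radial_normZ (c : R) m : 0 <= c -> profile m ->
  (radial_norm (fun r => (c * m r)%R) = c%:E * radial_norm m)%E.
Proof.
move=> c0 pm; case qE : q => [s| |].
- have s0 := s_gt0 qE; have pc := profileZ c0 pm.
  rewrite (norm_finE qE pm.2) (norm_finE qE pc.2).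
  have -> : (\int[leb]_(r in Rpos) ((c * m r * wt s r) `^ s)%:E =
     (c `^ s)%:E * \int[leb]_(r in Rpos) ((m r * wt s r) `^ s)%:E)%E.
    rewrite -ge0_integralZl_EFin ?powR_ge0//; last 2 first.
    + by move=> r _; rewrite lee_fin powR_ge0.
    + exact: mprodE.
    apply: eq_integral => r; rewrite inE posE => r0.
    rewrite -EFinM -mulrA; congr EFin; apply: powRM => //.
    by rewrite mulr_ge0 ?pm.2.
  rewrite poweRM ?lee_fin ?powR_ge0//; last first.
    by apply: integral_ge0 => r _; rewrite lee_fin powR_ge0.
  by rewrite poweR_EFin -powRrM mulfV ?powRr1// gt_eqF.
- rewrite /radial_norm qE; apply/eqP; rewrite eq_le; apply/andP; split.
    apply: ge_ereal_sup => _ [r r0 <-]; rewrite EFinM -muleA.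
    by apply: lee_wpmul2l; rewrite ?lee_fin//; apply: ereal_sup_ubound; exists r.
  have [->|cn0] := eqVneq c 0.
    rewrite mul0e; apply: ereal_sup_ubound; exists 0; first by rewrite posE.
    by rewrite mul0r mul0e.
  have cp : 0 < c by rewrite lt_neqAle eq_sym cn0.
  rewrite -lee_pdivlMl//; apply: ge_ereal_sup => _ [r r0 <-].
  rewrite lee_pdivlMl// muleA -EFinM.
  by apply: ereal_sup_ubound; exists r.
- by move: q1; rewrite qE.
Qed.

Lemma radial_normD m1 m2 : profile m1 -> profile m2 ->
  (radial_norm (fun r => (m1 r + m2 r)%R) <= radial_norm m1 + radial_norm m2)%E.
Proof.
move=> p1 p2; have p12 := profileD p1 p2; case qE : q => [s| |].
- have s1 := s_ge1 qE.
  rewrite (norm_finE qE p1.2) (norm_finE qE p2.2) (norm_finE qE p12.2).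
  have H := minkowski_on leb (measurable_itv _) s1 (mprod s p1) (mprod s p2).
  have -> : (\int[leb]_(r in Rpos) (((m1 r + m2 r) * wt s r) `^ s)%:E =
      \int[leb]_(r in Rpos) ((m1 r * wt s r + m2 r * wt s r) `^ s)%:E)%E.
    by apply: eq_integral => r _; rewrite mulrDl.
  apply: H.
  + by move=> r; rewrite posE => r0; rewrite mulr_ge0 ?p1.2.
  + by move=> r; rewrite posE => r0; rewrite mulr_ge0 ?p2.2.
- rewrite /radial_norm qE; apply: ge_ereal_sup => _ [r r0 <-].
  rewrite EFinD ge0_muleDl ?lee_fin; last 2 first.
  + by move: r0; rewrite posE; exact: p1.2.
  + by move: r0; rewrite posE; exact: p2.2.
  by apply: leeD; apply: ereal_sup_ubound; exists r.
- by move: q1; rewrite qE.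
Qed.

Lemma radial_norm_monomial n : (radial_norm (fun r => (r ^+ n)%R) < +oo)%E.
Proof.
case qE : q => [s| |].
- have s1 := s_ge1 qE; have s0 := s_gt0 qE.
  rewrite (norm_finE qE (profileX n).2); apply: poweR_lty.
  have [a a0 aP] := weight_decay n; have [b b0 bP] := weight_decay n.+1.
  have [c c0 cP] := weight_decay n.+2; have [d d0 dP] := weight_decay n.+3.
  (* Three further powers of r leave the integrable function 1 / (1 + r^2) and a
     factor 1 / (1 + r) that compensates the density r. *)
  pose K := a + b + c + d.
  have K0 : 0 < K by rewrite !addr_gt0.
  apply: (@le_lt_trans _ _ ((K `^ s)%:E * \int[leb]_(r in Rpos) (oneDsqr r)^-1%:E)%E);
    last by rewrite integral0y_oneDsqr -EFinM ltry.
  have m1 : measurable_fun Rpos (fun r => ((oneDsqr r)^-1)%:E).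
    apply/measurable_EFinP/measurable_funTS.
    exact: (continuous_measurable_fun (@continuous_oneDsqrV R)).
  rewrite -ge0_integralZl_EFin ?powR_ge0//.
  apply: ge0_le_integral; first exact: measurable_itv.
  + by move=> r _; rewrite lee_fin powR_ge0.
  + exact: mprodE (profileX n).
  + exact: measurable_funeM.
  + move=> r; rewrite posE => r0; rewrite -EFinM lee_fin.
    have r1 : 0 < 1 + r by rewrite ltr_wpDr.
    have o1 : 1 <= oneDsqr r by rewrite lerDl sqr_ge0.
    have o0 : 0 < oneDsqr r := lt_le_trans ltr01 o1.
    pose X := r ^+ n * expR (- phi r).
    have X0 : 0 <= X by rewrite mulr_ge0 ?exprn_ge0 ?expR_ge0.
    have XK : X * (oneDsqr r * (1 + r)) <= K.
      have -> : X * (oneDsqr r * (1 + r)) = X + r ^+ n.+1 * expR (- phi r) +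
          r ^+ n.+2 * expR (- phi r) + r ^+ n.+3 * expR (- phi r).
        by rewrite /X /oneDsqr !exprS; ring.
      by rewrite !lerD ?aP ?bP ?cP ?dP.
    have XK' : X <= K / oneDsqr r / (1 + r).
      by rewrite -mulrA -invfM ler_pdivlMr ?mulr_gt0.
    rewrite /wt mulrA -/X powRM ?powR_ge0// -powRrM mulVf ?gt_eqF// powRr1//.
    have XsK : X `^ s <= K `^ s / oneDsqr r / (1 + r).
      apply: (@le_trans _ _ ((K / oneDsqr r / (1 + r)) `^ s)).
        rewrite ge0_ler_powR ?nnegrE ?(ltW s0)// !divr_ge0 ?(ltW K0) ?(ltW o0) ?(ltW r1)//.
      rewrite -!mulrA powRM ?(ltW K0) ?mulr_ge0 ?invr_ge0 ?(ltW o0) ?(ltW r1)//.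
      rewrite ler_wpM2l ?powR_ge0//.
      set u := (_ * _); have u0 : 0 < u by rewrite mulr_gt0 ?invr_gt0.
      have u1 : u <= 1.
        by rewrite mulr_ile1 ?invr_ge0 ?(ltW o0) ?(ltW r1)// invf_le1// lerDl.
      rewrite -[leRHS]powRr1 ?(ltW u0)// /powR gt_eqF// ler_expR ler_wnM2r//.
      by rewrite ln_le0.
    apply: (@le_trans _ _ (K `^ s / oneDsqr r / (1 + r) * r)).
      by rewrite ler_wpM2r.
    rewrite -mulrA ler_piMr ?mulr_ge0 ?powR_ge0 ?invr_ge0 ?(ltW o0)//.
    by rewrite mulrC ler_pdivrMr// mul1r lerDr.
- rewrite /radial_norm qE; have [C C0 CP] := weight_decay n.
  apply: (@le_lt_trans _ _ C%:E); last exact: ltry.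
  apply: ge_ereal_sup => _ [r r0 <-]; rewrite -EFinM lee_fin CP//.
  by move: r0; rewrite posE.
- by move: q1; rewrite qE.
Qed.

(** On [r, r + 1], which has positive weight, the profile is at least its value at
    r. *)
Lemma radial_norm_local r : 0 < r -> exists2 k, 0 < k & forall m,
  profile m -> (forall r r', 0 <= r -> r <= r' -> m r <= m r') ->
  ((k * m r)%:E <= radial_norm m)%E.
Proof.
move=> r0; case qE : q => [s| |].
- have s0 := s_gt0 qE.
  have rr1 : r <= r + 1 by rewrite lerDl.
  have [|c _ cP] := @EVT_max R phi r (r + 1) rr1.
    apply: continuous_subspaceW phi_cont => x /=; rewrite !in_itv/= andbT.
    by move=> /andP[rx _]; rewrite (le_trans (ltW r0)).
  exists (expR (- phi c) * r `^ s^-1); first by rewrite mulr_gt0 ?expR_gt0 ?powR_gt0.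
  move=> m pm mm; rewrite (norm_finE qE pm.2).
  set a := (X in (X%:E <= _)%E).
  have a0 : 0 <= a by rewrite !mulr_ge0 ?expR_ge0 ?powR_ge0 ?pm.2 ?ltW.
  have -> : (a%:E = ((a `^ s)%:E) `^ s^-1)%E.
    by rewrite poweR_EFin -powRrM mulfV ?powRr1// gt_eqF.
  apply: le_poweR; first by rewrite invr_ge0 ltW.
    by rewrite lee_fin powR_ge0.
  have sub : `[r, r + 1]%classic `<=` Rpos.
    move=> x; rewrite posE /= in_itv/= => /andP[rx _].
    exact: le_trans (ltW r0) rx.
  apply: (@le_trans _ _ (\int[leb]_(x in `[r, (r + 1)%R]) ((m x * wt s x) `^ s)%:E)%E);
    last first.
    apply: ge0_subset_integral => //; first exact: mprodE.
    by move=> x _; rewrite lee_fin powR_ge0.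
  have -> : ((a `^ s)%:E = \int[leb]_(x in `[r, (r + 1)%R]) (a `^ s)%:E)%E.
    rewrite integral_cst//= lebesgue_measure_itv/= lte_fin ltrDl ltr01 -EFinB.
    by rewrite addrC addKr mule1.
  apply: ge0_le_integral; first exact: measurable_itv.
  + by move=> x _; rewrite lee_fin powR_ge0.
  + exact: measurable_cst.
  + exact: measurable_funS (mprodE s pm).
  + move=> x xr; have := sub x xr; rewrite posE => x0.
    move: (xr); rewrite /= in_itv/= => /andP[rx xr1].
    rewrite lee_fin; apply: ge0_ler_powR; rewrite ?nnegrE ?(ltW s0)//.
      by rewrite mulr_ge0 ?pm.2.
    rewrite /a mulrC; apply: ler_pM => //; rewrite ?mulr_ge0 ?expR_ge0 ?powR_ge0 ?pm.2 ?(ltW r0)//.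
      by rewrite mm// ltW.
    apply: ler_pM; rewrite ?expR_ge0 ?powR_ge0//.
      by rewrite ler_expR lerN2 cP// in_itv/= rx.
    by rewrite ge0_ler_powR ?nnegrE ?invr_ge0 ?(ltW s0) ?(ltW r0).
- exists (expR (- phi r)); first exact: expR_gt0.
  move=> m pm mm; rewrite /radial_norm qE mulrC EFinM.
  by apply: ereal_sup_ubound; exists r => //; rewrite posE ltW.
- by move: q1; rewrite qE.
Qed.

Lemma cvg_powR (u : nat -> R) (x s : R) : 0 < s -> (forall n, 0 <= u n) -> 0 <= x ->
  u n @[n --> \oo] --> x -> u n `^ s @[n --> \oo] --> x `^ s.
Proof.
move=> s0 u0; rewrite le_eqVlt => /predU1P[<- ux|x0 ux].
  rewrite powR0 ?gt_eqF//; apply/cvgrPdist_le => /= e e0.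
  have e1 : 0 < e `^ s^-1 by rewrite powR_gt0.
  move/cvgrPdist_le : ux => /(_ _ e1); apply: filterS => n.
  rewrite !sub0r !normrN !ger0_norm ?powR_ge0// => un.
  have -> : e = (e `^ s^-1) `^ s by rewrite -powRrM mulVf ?powRr1 ?(ltW e0)// gt_eqF.
  by rewrite ge0_ler_powR ?nnegrE ?(ltW s0) ?powR_ge0.
have c : {for x, continuous (fun y : R => y `^ s)}.
  apply/differentiable_continuous/derivable1_diffP/derivable_powR.
  by rewrite in_itv/= x0.
exact: (cvg_comp _ _ ux c).
Qed.

(** Fatou's lemma for finite q; for q = +oo, the pointwise bounds. *)
Lemma radial_norm_lim (u : nat -> R -> R) m (B : R) :
  (forall n, profile (u n)) -> profile m ->
  (forall r, 0 <= r -> u n r @[n --> \oo] --> m r) ->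
  (forall n, (radial_norm (u n) <= B%:E)%E) -> (radial_norm m <= B%:E)%E.
Proof.
move=> pu pm um uB.
have B0 : 0 <= B by rewrite -lee_fin (le_trans _ (uB 0%N))// radial_norm_ge0.
case qE : q => [s| |].
- have s0 := s_gt0 qE; rewrite (norm_finE qE pm.2).
  have -> : (B%:E = ((B `^ s)%:E) `^ s^-1)%E.
    by rewrite poweR_EFin -powRrM mulfV ?powRr1// gt_eqF.
  apply: le_poweR; first by rewrite invr_ge0 ltW.
    by apply: integral_ge0 => r _; rewrite lee_fin powR_ge0.
  have uBs n : (\int[leb]_(r in Rpos) ((u n r * wt s r) `^ s)%:E <= (B `^ s)%:E)%E.
    have := uB n; rewrite (norm_finE qE (pu n).2) => /(le_poweR (ltW s0) (poweR_ge0 _ _)).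
    rewrite -poweRrM mulVf ?gt_eqF// poweRe1//.
    by apply: integral_ge0 => r _; rewrite lee_fin powR_ge0.
  have E r : Rpos r -> ((m r * wt s r) `^ s)%:E =
      limn_einf (fun n => ((u n r * wt s r) `^ s)%:E).
    rewrite posE => r0; apply/esym.
    have c : (fun n => ((u n r * wt s r) `^ s)%:E) @ \oo --> ((m r * wt s r) `^ s)%:E.
      apply: cvg_EFin; first by apply: nearW.
      apply: cvg_powR => //.
      - by move=> n; rewrite mulr_ge0 ?(pu n).2.
      - by rewrite mulr_ge0 ?pm.2.
      - by apply: cvgMl; exact: um.
    rewrite is_cvg_limn_einfE; last by apply/cvg_ex; eexists; exact: c.
    exact: cvg_lim c.
  have -> : (\int[leb]_(r in Rpos) ((m r * wt s r) `^ s)%:E =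
      \int[leb]_(r in Rpos) limn_einf (fun n => ((u n r * wt s r) `^ s)%:E))%E.
    by apply: eq_integral => r /set_mem Rr; rewrite E.
  apply: (le_trans (@fatou _ _ _ leb Rpos (measurable_itv _)
     (fun n r => ((u n r * wt s r) `^ s)%:E) _ _)).
  + by move=> n; exact: mprodE.
  + by move=> n r _; rewrite lee_fin powR_ge0.
  rewrite limn_einf_lim; apply: lime_le; first exact: is_cvg_einfs.
  apply: nearW => n; apply: le_trans (uBs n).
  by apply: ereal_inf_lbound; exists n => //=.
- rewrite /radial_norm qE; apply: ge_ereal_sup => _ [r r0 <-].
  rewrite -EFinM lee_fin.
  have c : u n r * expR (- phi r) @[n --> \oo] --> m r * expR (- phi r).
    by apply: cvgMl; apply: um; move: r0; rewrite posE.
  rewrite -(cvg_lim _ c)//; apply: limr_le; first by apply/cvg_ex; eexists; exact: c.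
  apply: nearW => n; rewrite -lee_fin (le_trans _ (uB n))// /radial_norm qE EFinM.
  by apply: ereal_sup_ubound; exists r.
- by move: q1; rewrite qE.
Qed.

End RadialNorm.

(** * Extraction of subsequences *)

Section DiagonalExtraction.
Context {R : realType}.

(** By Tychonoff's theorem the sequence of families clusters in the product space.
    Neighbourhoods in this space constrain only finitely many coordinates, so the
    subsequence is chosen term by term, with more coordinates and a smaller
    tolerance at each step. In the index set, the boolean stands for the real and
    the imaginary part of a coefficient. *)
Lemma diagonal_extraction (x : nat -> nat * bool -> R) (b : nat * bool -> R) :
  (forall n i, `|x n i| <= b i) ->
  exists y : nat * bool -> R, exists2 sigma : nat -> nat,
    {homo sigma : m n / (m < n)%N} &
    forall i, x (sigma n) i @[n --> \oo] --> y i.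
Proof.
move=> xb.
pose T := prod_topology (fun _ : nat * bool => R : topologicalType).
pose X : nat -> T := x.
have cK : compact [set f : T | forall i, `[- b i, b i]%classic (f i)].
  exact: (@tychonoff _ (fun=> R : topologicalType) (fun i => `[- b i, b i]%classic)
    (fun i => @segment_compact R _ _)).
have XK : (X @ \oo) [set f : T | forall i, `[- b i, b i]%classic (f i)].
  by exists 0%N => // n _ i; rewrite /= in_itv/= -ler_norml; exact: xb.
have [y [_ cy]] := cK (X @ \oo) _ XK; exists y.
have near_y m (e : R) : 0 < e -> nbhs (y : T) [set f : T | forall k b, (k < m)%N ->
    `|f (k, b) - y (k, b)| <= e].
  move=> e0; elim: m => [|m ih]; first by apply: filterS filterT.
  have coord c : nbhs (y : T) [set f : T | `|f (m, c) - y (m, c)| <= e].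
    have B : nbhs (y (m, c) : R) [set a : R | `|a - y (m, c)| <= e].
      by exists e => //= a; rewrite /ball_/= distrC => /ltW.
    exact: (@proj_continuous _ (fun _ : nat * bool => R : topologicalType) (m, c) y _ B).
  apply: (filterS _ (filterI ih (filterI (coord true) (coord false)))) => f [h [ht hf]] k c; rewrite ltnS leq_eqVlt => /predU1P[->|]; last exact: h.
  by case: c.
have step (mN : nat * nat) : exists n, (mN.2 < n)%N /\ forall k c, (k < mN.1)%N ->
    `|x n (k, c) - y (k, c)| <= mN.1.+1%:R^-1.
  have e0 : 0 < mN.1.+1%:R^-1 :> R by rewrite invr_gt0.
  have tail : (X @ \oo) [set f | exists2 n, (mN.2 < n)%N & f = X n].
    by exists mN.2.+1 => // n /= Nn; exists n.
  have [f [[n Nn ->] xy]] := cy _ _ tail (near_y mN.1 _ e0).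
  by exists n.
have [nxt nxtP] := choice step.
pose sigma := fix s n := if n is n'.+1 then nxt (n, s n') else nxt (0%N, 0%N).
exists sigma.
  apply: homo_ltn; first exact: ltn_trans.
  by move=> n; exact: (nxtP (n.+1, sigma n)).1.
have close n k c : (k < n)%N -> `|x (sigma n) (k, c) - y (k, c)| <= n.+1%:R^-1.
  by case: n => // n kn; exact: (nxtP (n.+1, sigma n)).2.
move=> [k c]; apply/cvgrPdist_le => e e0.
have [N _ NP] := near_infty_natSinv_lt (PosNum e0).
exists (maxn N k.+1) => // n /=; rewrite geq_max => /andP[Nn kn].
rewrite distrC (le_trans (close n k c kn))// ltW//; exact: NP.
Qed.

End DiagonalExtraction.

(** * The mixed norm of entire functions *)

Section MixedNorm.
Context {R : realType}.
Implicit Types (f g h : R[i] -> R[i]) (z : R[i]) (r : R).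
Variables (p q : \bar R) (phi : R -> R).
Hypothesis p1 : (1 <= p)%E.
Hypothesis q1 : (1 <= q)%E.
Hypothesis hphi : classC q phi.

Local Notation N := (radial_norm q phi).
Local Notation norm := (mixed_norm p q phi).

Definition rmean f r : R := fine (integral_mean p f r).

Lemma rmeanE f r : entire f -> 0 <= r -> integral_mean p f r = (rmean f r)%:E.
Proof. by move=> ef r0; rewrite /rmean fineK// mean_fin. Qed.

Lemma le_rmean_radius f r r' : entire f -> 0 <= r -> r <= r' -> rmean f r <= rmean f r'.
Proof.
move=> ef r0 rr'; rewrite -lee_fin -!rmeanE ?(le_trans r0)//.
exact: le_mean_radius.
Qed.

Lemma rmean_profile f : entire f -> profile (rmean f).
Proof.
move=> ef; apply: nondecreasing_profile.
  by move=> r r0; apply: fine_ge0; exact: mean_ge0.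
by move=> r r' r0; exact: le_rmean_radius.
Qed.

Lemma mixed_normE f : entire f -> norm f = N (rmean f).
Proof.
move=> ef; rewrite /mixed_norm /radial_norm; case: q => [s| |] //.
  congr poweR; apply: eq_integral => r; rewrite inE/= in_itv/= andbT => r0.
  by rewrite rmeanE.
congr ereal_sup; apply: eq_imagel => r; rewrite /= in_itv/= andbT => r0.
by rewrite rmeanE.
Qed.

Lemma entireB f g : entire f -> entire g -> entire (fun z => f z - g z).
Proof.
by move=> /entireP df /entireP dg; apply/entireP => z; exact: cderivableB.
Qed.

Lemma rmeanB f g r : entire f -> entire g -> 0 <= r ->
  rmean (fun z => f z - g z) r <= rmean f r + rmean g r.
Proof.
move=> ef eg r0.
have egN : circ r (fun z => (- 1) * g z) by move=> t; apply: ccontZ; exact: entire_circ.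
have efg := entireB ef eg.
rewrite -lee_fin EFinD -!rmeanE//.
have -> : (fun z => f z - g z) = (fun z => f z + (- 1) * g z).
  by apply: funext => z; rewrite mulN1r.
apply: (le_trans (meanD p1 r0 (entire_circ r ef) egN)).
rewrite meanZ//; last exact: entire_circ.
by rewrite cabsN cabs1 mul1e.
Qed.

Lemma entire_monomial (c : R[i]) n : entire (fun z => c * z ^+ n).
Proof.
by apply/entireP => z; apply: cderivableM; [exact: cderivable_cst|exact: cderivableX].
Qed.

Lemma rmean_monomial (c : R[i]) n r : 0 <= r ->
  rmean (fun z => c * z ^+ n) r = cabs c * r ^+ n.
Proof.
move=> r0; rewrite /rmean meanZ//.
  by rewrite mean_monomial// -EFinM.
by apply: circ_cderivable => z _; exact: cderivableX.
Qed.

Definition monomial_norm n : R := fine (N (fun r => r ^+ n)).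

Lemma monomial_normE n : N (fun r => r ^+ n) = (monomial_norm n)%:E.
Proof.
rewrite /monomial_norm fineK// ge0_fin_numE ?radial_norm_monomial//.
exact: (radial_norm_ge0 q phi (profileX n)).
Qed.

Lemma monomial_norm_gt0 n : 0 < monomial_norm n.
Proof.
have [k k0 kP] := radial_norm_local q1 hphi (@ltr01 R).
rewrite -lte_fin -monomial_normE; apply: (lt_le_trans _ (kP _ (profileX n) _)).
  by rewrite expr1n mulr1 lte_fin.
by move=> r r' r0 rr'; rewrite lerXn2r ?nnegrE// (le_trans r0).
Qed.

Lemma norm_monomial (c : R[i]) n :
  norm (fun z => c * z ^+ n) = (cabs c * monomial_norm n)%:E.
Proof.
have em := @entire_monomial c n.
rewrite mixed_normE// EFinM -monomial_normE.
rewrite -(radial_normZ q1 hphi (cabs_ge0 c) (profileX n)).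
apply/eqP; rewrite eq_le; apply/andP; split; apply: (le_radial_norm q1 hphi);
    do ?[exact: rmean_profile|apply: profileZ; [exact: cabs_ge0|exact: profileX]];
    by move=> r r0; rewrite rmean_monomial.
Qed.

Lemma l1mean_le_rmean f r : entire f -> 0 <= r -> l1mean f r <= rmean f r.
Proof. by move=> ef r0; rewrite -lee_fin -rmeanE//; exact: l1mean_le. Qed.

Lemma ccoef0 f : entire f -> coef f 0 = f 0.
Proof.
move=> ef; rewrite /coef -(@cmean_disc R 1 f 0 ler01).
- by apply: eq_cmean => z _; rewrite expr0 divr1.
- by move=> z _; apply: cderiv_ccont; exact: (entireP f).1.
- by move=> z _ _; exact: (entireP f).1.
Qed.

Lemma cabs_coef_rmean f n r : entire f -> 0 <= r ->
  cabs (coef f n) * r ^+ n <= rmean f r.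
Proof.
move=> ef; rewrite le_eqVlt => /predU1P[<-|r0]; last first.
  by rewrite (le_trans (cabs_coef n ef r0))// l1mean_le_rmean// ltW.
case: n => [|n]; last by rewrite expr0n mulr0 (rmean_profile ef).2.
rewrite expr0 mulr1 ccoef0// (le_trans _ (l1mean_le_rmean ef (lexx 0)))//.
rewrite /l1mean (_ : (fun t => _) = fun=> cabs (f 0)) ?avg_cst//.
by apply: funext => t; rewrite polarE mul0r.
Qed.

(** Cauchy's inequality on every circle, integrated. *)
Lemma cabs_coef_norm f n : entire f ->
  ((cabs (coef f n) * monomial_norm n)%:E <= norm f)%E.
Proof.
move=> ef; rewrite -norm_monomial (mixed_normE (@entire_monomial (coef f n) n)).
rewrite (mixed_normE ef).
have em := @entire_monomial (coef f n) n.
apply: (le_radial_norm q1 hphi (rmean_profile em) (rmean_profile ef)).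
by move=> r r0; rewrite rmean_monomial// cabs_coef_rmean.
Qed.

(** A bound on the norm bounds the mean over one circle, which bounds the values
    inside by Cauchy's formula. *)
Lemma norm_local (r : R) : 0 <= r -> exists2 C, 0 < C & forall f (B : R), entire f ->
  (norm f <= B%:E)%E -> l1mean f (r + 1) <= C * B /\
    forall z, cabs z <= r -> cabs (f z) <= C * B.
Proof.
move=> r0; have r1 : 0 < r + 1 by rewrite ltr_wpDl.
have [k k0 kP] := radial_norm_local q1 hphi r1.
exists ((r + 1) / k); first by rewrite divr_gt0.
move=> f B ef fB; have B0 : 0 <= B.
  rewrite -lee_fin; apply: le_trans fB; rewrite (mixed_normE ef).
  exact: radial_norm_ge0 (rmean_profile ef).
have lB : l1mean f (r + 1) <= B / k.
  rewrite (le_trans (l1mean_le_rmean ef (ltW r1)))// ler_pdivlMr// mulrC -lee_fin.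
  apply: le_trans fB; rewrite (mixed_normE ef).
  apply: kP; first exact: rmean_profile ef.
  by move=> x y x0; exact: le_rmean_radius.
split.
  rewrite (le_trans lB)// mulrAC -mulrA ler_peMl ?divr_ge0 ?(ltW k0)//.
  by rewrite lerDr.
move=> z zr; rewrite (le_trans (entire_sup_bound ef zr))// mulrAC -mulrA.
by rewrite ler_wpM2l// ltW.
Qed.

End MixedNorm.

(** * Necessity *)

Section ExtendedLimits.
Context {R : realType}.

Lemma cvge0P (u : nat -> \bar R) : (forall n, 0 <= u n)%E ->
  u n @[n --> \oo] --> 0%E <->
  forall e : R, 0 < e -> exists M, forall n, (M <= n)%N -> (u n <= e%:E)%E.
Proof.
move=> u0; split.
  move=> /fine_cvgP[[M1 _ fin] /cvgrPdist_le lim] e e0.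
  have [M2 _ M2P] := lim e e0; exists (maxn M1 M2) => n; rewrite geq_max => /andP[n1 n2].
  rewrite -(fineK (fin n n1)) lee_fin.
  by have := M2P n n2; rewrite /= sub0r normrN; exact: le_trans (ler_norm _).
move=> ue; apply/fine_cvgP; split.
  have [M MP] := ue 1 ltr01; exists M => // n Mn.
  by rewrite ge0_fin_numE// (le_lt_trans (MP n Mn))// ltry.
apply/cvgrPdist_le => e e0; have [M MP] := ue e e0; exists M => // n Mn.
rewrite /= sub0r normrN ger0_norm ?fine_ge0//.
rewrite -lee_fin fineK; first exact: MP.
by rewrite ge0_fin_numE// (le_lt_trans (MP n Mn))// ltry.
Qed.

End ExtendedLimits.

Section Monomials.
Context {R : realType}.
Implicit Types (c z : R[i]) (n k : nat).

Lemma coef_monomial c n : coef (fun z => c * z ^+ n) n = c.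
Proof.
rewrite -[RHS](cmean_cst 1 c); apply: eq_cmean => z; rewrite normr1 => z1.
by rewrite mulfK// expf_neq0// -cabs_gt0 z1.
Qed.

Lemma coef_monomial_lt c n k : (k < n)%N -> coef (fun z => c * z ^+ n) k = 0.
Proof.
move=> kn; rewrite /coef (@eq_cmean _ _ _ (fun z => c * z ^+ (n - k))); last first.
  move=> z; rewrite normr1 => z1; rewrite -mulrA; congr (_ * _).
  by rewrite -{1}(subnK (ltnW kn)) exprD mulfK// expf_neq0// -cabs_gt0 z1.
have d z : cderivable (fun z => c * z ^+ (n - k)) z.
  by move/entireP : (@entire_monomial R c (n - k)%N); exact.
rewrite (@cmean_disc R 1 _ 0 ler01).
- by rewrite expr0n subn_eq0 leqNgt kn mulr0.
- by move=> z _; exact: cderiv_ccont.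
- by move=> z _ _; exact: d.
Qed.

End Monomials.

Section Necessity.
Context {R : realType}.
Variables (p q : \bar R) (phi : R -> R).
Variable mu : {measure set (measurableTypeR R) -> \bar R}.
Hypothesis p1 : (1 <= p)%E.
Hypothesis q1 : (1 <= q)%E.
Hypothesis hphi : classC q phi.
Hypothesis defined : forall f, Fock p q phi f -> hausdorff_defined mu f.
Local Notation norm := (mixed_norm p q phi).
Local Notation Dpos := (`]0%R, +oo[%classic : set R).

Let Fock_monomial (c : R[i]) n : Fock p q phi (fun z => c * z ^+ n).
Proof.
split; first exact: entire_monomial.
by rewrite (norm_monomial p1 q1 hphi) ltry.
Qed.

(** The eigenvalue of the Hausdorff operator on the monomial of degree n. *)
Definition moment n : R := \int[mu]_(t in Dpos) (t^-1 ^+ n.+1).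

Let integrandE (c z : R[i]) n t : Dpos t ->
  hausdorff_integrand (fun z => c * z ^+ n) z t = (c * z ^+ n) * (t^-1 ^+ n.+1)%:C.
Proof.
rewrite /= in_itv/= andbT => t0; rewrite /hausdorff_integrand exprMn -fmorphV rmorphXn exprS/=; ring.
Qed.

Lemma moment_integrable n : mu.-integrable Dpos (fun t => (t^-1 ^+ n.+1)%:E).
Proof.
have [+ _] := defined (Fock_monomial 1 n) 1.
apply: eq_integrable => // t /set_mem Dt.
by rewrite integrandE// expr1n !mul1r.
Qed.

Lemma hausdorff_monomial (c : R[i]) n :
  hausdorff mu (fun z => c * z ^+ n) = (fun z => (c * (moment n)%:C) * z ^+ n).
Proof.
apply: funext => z; rewrite /hausdorff.
have iF : cintegrable mu Dpos (fun t => (t^-1 ^+ n.+1)%:C).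
  split => /=; first exact: moment_integrable.
  exact: integrable0.
have -> : cintegral mu Dpos (hausdorff_integrand (fun z => c * z ^+ n) z) =
    cintegral mu Dpos (fun t => (c * z ^+ n) * (t^-1 ^+ n.+1)%:C).
  by congr (_ +i* _); apply: eq_Rintegral => t /set_mem Dt; rewrite integrandE.
rewrite cintegralZ//.
have -> : cintegral mu Dpos (fun t => (t^-1 ^+ n.+1)%:C) = (moment n)%:C.
  congr (_ +i* _); rewrite /= /Rintegral integral0_eq//.
ring.
Qed.

(** On ]0, 1] all powers of 1 / t are at least 1. *)
Lemma moment_ge n : (mu `]0%R, 1%R]%classic <= (moment n)%:E)%E.
Proof.
have im := moment_integrable n.
rewrite /moment /Rintegral fineK; last by apply: integrable_fin_num => //; exact: measurable_itv.
rewrite -[leLHS]mul1e -integral_cst; last exact: measurable_itv.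
have sub : `]0%R, 1%R]%classic `<=` Dpos.
  by move=> t; rewrite /= !in_itv/= andbT => /andP[].
apply: (@le_trans _ _ (\int[mu]_(t in `]0%R, 1%R]) (t^-1 ^+ n.+1)%:E)%E).
  apply: ge0_le_integral; first exact: measurable_itv.
  - by move=> t _; rewrite lee_fin.
  - exact: measurable_cst.
  - by apply: measurable_funS (measurable_int _ im) => //; exact: measurable_itv.
  - move=> t; rewrite /= in_itv/= => /andP[t0 t1].
    by rewrite lee_fin exprn_ege1// invf_ge1.
apply: ge0_subset_integral => //; do ?exact: measurable_itv.
  exact: measurable_int im.
by move=> t; rewrite /= in_itv/= andbT => t0; rewrite lee_fin exprn_ge0// invr_ge0 ltW.
Qed.

Hypothesis Hcompact : compact_operator (Fock p q phi) norm (hausdorff mu).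

(** The normalized monomials are bounded, and the coefficient of index k vanishes on
    all but the first of their images. Since the norm controls the coefficients,
    the limit of a subsequence of images has all coefficients zero, and the
    coefficient of index n of the n-th image, which is the moment up to the
    normalization, shows that moments tend to 0 along the subsequence. *)
Lemma null_of_compact : mu `]0%R, 1%R]%classic = 0%E.
Proof.
have [_ _ seq] := Hcompact.
pose a n : R[i] := ((monomial_norm q phi n)^-1)%:C.
have N0 n : 0 < monomial_norm q phi n by exact: (monomial_norm_gt0 q1 hphi).
have caN n : cabs (a n) * monomial_norm q phi n = 1.
  by rewrite cabs_real gtr0_norm ?invr_gt0// mulVf// gt_eqF.
pose u n := (fun z : R[i] => a n * z ^+ n).
have [|sigma [g [eg ng] [smono lim]]] := seq u (fun n => Fock_monomial (a n) n).
  by exists 1 => n; rewrite (norm_monomial p1 q1 hphi) caN.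
pose F n z := hausdorff mu (u (sigma n)) z - g z.
have eM n : entire (hausdorff mu (u (sigma n))).
  by rewrite /u hausdorff_monomial; exact: entire_monomial.
have eF n : entire (F n) by exact: (entireB (eM n) eg).
have nF0 n : (0 <= norm (F n))%E.
  rewrite (mixed_normE q phi p1 (eF n)); apply: radial_norm_ge0.
  exact: (rmean_profile p1 (eF n)).
have {lim}lim := (cvge0P nF0).1 lim.
have sge n : (n <= sigma n)%N.
  by elim: n => // n ih; rewrite (leq_ltn_trans ih)// smono.
have cF n k : coef (F n) k = coef (hausdorff mu (u (sigma n))) k - coef g k.
  exact (@ccoefB R (hausdorff mu (u (sigma n))) g k (eM n) eg).
have cg k : coef g k = 0.
  apply/eqP; rewrite -cabs_eq0 eq_le cabs_ge0 andbT; apply/ler_addgt0Pl => e e0.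
  rewrite addr0; have [M MP] := lim _ (mulr_gt0 e0 (N0 k)).
  pose n := maxn M k.+1.
  have kn : (k < sigma n)%N by rewrite (leq_trans _ (sge n))// leq_maxr.
  have := le_trans (cabs_coef_norm p1 q1 hphi k (eF n)) (MP n (leq_maxl _ _)).
  rewrite cF /u hausdorff_monomial coef_monomial_lt// sub0r cabsN lee_fin.
  by rewrite ler_pM2r.
apply/eqP; rewrite eq_le measure_ge0 andbT; apply/lee_addgt0Pr => e e0.
rewrite add0e; have [M MP] := lim e e0.
have := le_trans (cabs_coef_norm p1 q1 hphi (sigma M) (eF M)) (MP M (leqnn M)).
rewrite cF cg subr0 /u hausdorff_monomial coef_monomial cabsM mulrAC caN mul1r cabs_real.
apply: le_trans; apply: (le_trans (moment_ge (sigma M))).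
by rewrite lee_fin ler_norm.
Qed.

Lemma mass_of_defined : (\int[mu]_(t in Dpos) (t^-1)%:E < +oo)%E.
Proof.
have -> : (\int[mu]_(t in Dpos) (t^-1)%:E = (moment 0)%:E)%E.
  rewrite /moment /Rintegral fineK; first by apply: eq_integral => t _; rewrite expr1.
  by apply: integrable_fin_num (moment_integrable 0); exact: measurable_itv.
exact: ltry.
Qed.

End Necessity.

(** * Normal families *)

Section NormalFamilies.
Context {R : realType}.
Implicit Types (f g h : R[i] -> R[i]) (z w : R[i]) (r e : R).
Variables (p q : \bar R) (phi : R -> R).
Hypothesis p1 : (1 <= p)%E.
Hypothesis q1 : (1 <= q)%E.
Hypothesis hphi : classC q phi.
Local Notation norm := (mixed_norm p q phi).

Lemma sum_small (a : nat -> nat -> R) K :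
  (forall j e, 0 < e -> exists N, forall n, (N <= n)%N -> a n j <= e) ->
  forall e, 0 < e -> exists N, forall n, (N <= n)%N -> \sum_(j < K) a n j <= e.
Proof.
move=> asmall; elim: K => [|K ih] e e0.
  by exists 0%N => n _; rewrite big_ord0 ltW.
have e2 : 0 < e / 2 by rewrite divr_gt0.
have [N1 N1P] := ih _ e2; have [N2 N2P] := asmall K _ e2.
exists (maxn N1 N2) => n; rewrite geq_max => /andP[n1 n2].
by rewrite big_ord_recr/= [leRHS]splitr lerD ?N1P ?N2P.
Qed.

(** Minkowski's inequality on the circle, used in both directions. *)
Lemma rmean_dist f g r e : entire f -> entire g -> 0 <= r ->
  (forall z, cabs z = r -> cabs (f z - g z) <= e) ->
  `|rmean p f r - rmean p g r| <= e.
Proof.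
have half f' g' : entire f' -> entire g' -> 0 <= r ->
    (forall z, cabs z = r -> cabs (f' z - g' z) <= e) ->
    rmean p f' r <= e + rmean p g' r.
  move=> ef eg r0 fg.
  have e0 : 0 <= e.
    by apply: le_trans (fg r%:C _); rewrite ?cabs_ge0// cabs_real ger0_norm.
  have eB := entireB ef eg.
  rewrite -lee_fin EFinD -(rmeanE p1 ef r0) -(rmeanE p1 eg r0).
  have -> : f' = (fun z => (f' z - g' z) + g' z) by apply: funext => z; rewrite subrK.
  apply: (le_trans (meanD p1 r0 (entire_circ r eB) (entire_circ r eg))).
  rewrite leeD2r// (_ : e = cabs e%:C); last by rewrite cabs_real ger0_norm.
  rewrite -(mean_cst p1 e%:C r0); apply: le_mean => //.
  - exact: (entire_circ r eB).
  - by apply: circ_cderivable => z _; exact: cderivable_cst.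
  - by move=> z zr; rewrite cabs_real ger0_norm// fg.
move=> ef eg r0 fg; rewrite ler_norml; apply/andP; split.
  rewrite lerBrDr addrC lerBlDl; apply: half => // z zr.
  by rewrite cabs_distC; exact: fg.
by rewrite lerBlDr; apply: half.
Qed.

Lemma chord_lipschitz_lim (v : nat -> R[i] -> R[i]) g z (C : R) :
  (forall w, ccvg (v ^~ w) (g w)) -> (forall n, chord_lipschitz (v n) z C) ->
  chord_lipschitz g z C.
Proof.
move=> vg vC h k h1 k1; apply/ler_addgt0Pl => e e0.
have e4 : 0 < e / 4 by rewrite divr_gt0.
have [N0 P0] := vg z _ e4; have [N1 P1] := vg (z + h) _ e4; have [N2 P2] := vg (z + k) _ e4.
pose n := maxn N0 (maxn N1 N2).
have {}P0 := P0 n (leq_maxl _ _).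
have {}P1 := P1 n (leq_trans (leq_maxl _ _) (leq_maxr _ _)).
have {}P2 := P2 n (leq_trans (leq_maxr _ _) (leq_maxr _ _)).
have small c a : cabs c <= 1 -> cabs a <= e / 4 -> cabs (c * a) <= e / 4.
  by move=> c1 ae; rewrite cabsM -[e / 4]mul1r ler_pM ?cabs_ge0.
have -> : k * (g (z + h) - g z) - h * (g (z + k) - g z) =
    (k * (v n (z + h) - v n z) - h * (v n (z + k) - v n z)) -
    (k * (v n (z + h) - g (z + h))) + k * (v n z - g z) +
    (h * (v n (z + k) - g (z + k))) - h * (v n z - g z) by ring.
have := vC n h k h1 k1.
set D := C * _; set X := (k * _ - _) => XD.
rewrite (le_trans (cabsB _ _))// (_ : e + D = D + e / 4 + e / 4 + e / 4 + e / 4); last by field.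
rewrite lerD ?small// (le_trans (cabsD _ _))// lerD ?small//.
rewrite (le_trans (cabsD _ _))// lerD ?small// (le_trans (cabsB _ _))// lerD ?small//.
Qed.

(** Montel's theorem for a ball of the space. The Taylor coefficients are bounded,
    hence converge along a subsequence; the Taylor remainders are small uniformly
    in the sequence, so the subsequence is uniformly Cauchy on discs. The limit is
    entire by the chord inequality, and Fatou's lemma bounds its norm. *)
Lemma normal_family (u : nat -> R[i] -> R[i]) (B : R) :
  (forall n, entire (u n)) -> (forall n, (norm (u n) <= B%:E)%E) ->
  exists2 sigma : nat -> nat, {homo sigma : m n / (m < n)%N} &
  exists2 g, entire g & (norm g <= B%:E)%E /\
    forall r, 0 <= r -> forall e, 0 < e -> exists N, forall n, (N <= n)%N ->
      forall z, cabs z <= r -> cabs (u (sigma n) z - g z) <= e.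
Proof.
move=> eu uB.
pose x n (i : nat * bool) : R :=
  if i.2 then complex.Re (coef (u n) i.1) else complex.Im (coef (u n) i.1).
have [|y [sigma smono xy]] := @diagonal_extraction R x
    (fun i => B / monomial_norm q phi i.1).
  move=> n [k c].
  have cB : cabs (coef (u n) k) <= B / monomial_norm q phi k.
    rewrite ler_pdivlMr ?(monomial_norm_gt0 q1 hphi)// -lee_fin.
    exact: le_trans (cabs_coef_norm p1 q1 hphi k (eu n)) (uB n).
  by rewrite /x; case: c; [exact: le_trans (Re_le_cabs _) cB|exact: le_trans (Im_le_cabs _) cB].
exists sigma => //; pose v n := u (sigma n).
have ev n : entire (v n) by exact: eu.
have vB n : (norm (v n) <= B%:E)%E by exact: uB.
pose l k := y (k, true) +i* y (k, false).
have cl k : ccvg (fun n => coef (v n) k) (l k).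
  by apply: ccvg_ReIm; [exact: (xy (k, true))|exact: (xy (k, false))].
have unif r : 0 <= r -> forall e, 0 < e -> exists N, forall n m, (N <= n)%N -> (N <= m)%N ->
    forall z, cabs z <= r -> cabs (v n z - v m z) <= e.
  move=> r0 e e0; have [C C0 CP] := norm_local p1 q1 hphi r0.
  have r1 : 0 < r + 1 by rewrite ltr_wpDl.
  have q01 : 0 <= r / (r + 1) < 1.
    by rewrite divr_ge0 ?(ltW r1)//= ltr_pdivrMr// mul1r ltrDl.
  have e4 : 0 < e / 4 by rewrite divr_gt0.
  have [K KP] := geometric_small ((r + 1) * (C * B)) q01 e4.
  have rem n z : cabs z <= r ->
      cabs (v n z - \sum_(j < K) coef (v n) j * z ^+ j) <= e / 4.
    move=> zr; have zr1 : cabs z < r + 1 by rewrite (le_lt_trans zr)// ltrDl.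
    apply: (le_trans (taylor_remainder K (ev n) zr1)).
    apply: le_trans (KP K (leqnn K)); apply: ler_pM.
    - by rewrite exprn_ge0 ?divr_ge0 ?cabs_ge0 ?ltW.
    - by rewrite mulr_ge0 ?divr_ge0 ?subr_ge0 ?l1mean_ge0 ?(ltW r1)// ltW.
    - rewrite lerXn2r ?nnegrE ?divr_ge0 ?cabs_ge0 ?(ltW r1)//.
      by rewrite ler_pM2r ?invr_gt0.
    - apply: ler_pM; rewrite ?l1mean_ge0 ?divr_ge0 ?subr_ge0 ?(ltW r1) ?(ltW zr1)//.
        rewrite ler_pdivrMr ?subr_gt0// ler_peMr ?(ltW r1)//.
        by rewrite lerBrDr addrC lerD2r.
      by have [] := CP (v n) B (ev n) (vB n).
  have [|N NP] := @sum_small (fun n j => cabs (coef (v n) j - l j) * r ^+ j) K _ (e / 4) e4.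
    move=> j e' e'0; have rj : 0 < r ^+ j + 1 by rewrite ltr_wpDl ?exprn_ge0.
    have [N NP] := cl j _ (divr_gt0 e'0 rj); exists N => n /NP h.
    apply: (le_trans (ler_wpM2r (exprn_ge0 j r0) h)).
    by rewrite mulrAC ler_pdivrMr// ler_pM2l// lerDl.
  have sumle n z : (N <= n)%N -> cabs z <= r ->
      cabs (\sum_(j < K) coef (v n) j * z ^+ j - \sum_(j < K) l j * z ^+ j) <= e / 4.
    move=> Nn zr; apply: le_trans (NP n Nn); rewrite -sumrB.
    apply: (le_trans (cabs_sum K (fun j => coef (v n) j * z ^+ j - l j * z ^+ j))).
    apply: ler_sum => j _; rewrite -mulrBl cabsM cabsX ler_wpM2l ?cabs_ge0//.
    by rewrite lerXn2r ?nnegrE ?cabs_ge0.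
  exists N => n m Nn Nm z zr.
  have a1 := rem n z zr; have a2 := sumle n z Nn zr.
  have a3 := sumle m z Nm zr; have a4 := rem m z zr.
  move: a1 a2 a3 a4.
  set S1 := \sum_(j < K) coef (v n) j * _; set S2 := \sum_(j < K) coef (v m) j * _.
  set L := \sum_(j < K) l j * _ => a1 a2 a3 a4.
  have -> : v n z - v m z = (v n z - S1) + (S1 - L) - (S2 - L) - (v m z - S2) by ring.
  rewrite (_ : e = e / 4 + e / 4 + e / 4 + e / 4); last by field.
  rewrite (le_trans (cabsB _ _))// lerD// (le_trans (cabsB _ _))// lerD//.
  by rewrite (le_trans (cabsD _ _))// lerD.
have lim z : exists w, ccvg (v ^~ z) w.
  apply: ccvg_cauchy => e e0.
  have [N NP] := unif _ (cabs_ge0 z) e e0.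
  by exists N => n m Nn Nm; exact: NP.
have [g gP] := choice lim.
have eg : entire g.
  apply: chord_entire => z.
  have r0 : 0 <= cabs z + 2 by rewrite addr_ge0 ?cabs_ge0.
  have [C C0 CP] := norm_local p1 q1 hphi r0.
  exists (C * B * (cabs z + 2)); apply: (chord_lipschitz_lim gP) => n.
  apply: (entire_chord (ev n) (lexx _)) => w wr.
  by have [_] := CP (v n) B (ev n) (vB n); apply; rewrite wr.
have ug r : 0 <= r -> forall e, 0 < e -> exists N, forall n, (N <= n)%N ->
    forall z, cabs z <= r -> cabs (v n z - g z) <= e.
  move=> r0 e e0; have e2 : 0 < e / 2 by rewrite divr_gt0.
  have [N NP] := unif r r0 _ e2; exists N => n Nn z zr.
  have [M MP] := gP z _ e2; have mM := MP _ (leq_maxr N M).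
  have := NP n _ Nn (leq_maxl N M) z zr.
  rewrite (_ : v n z - g z = (v n z - v (maxn N M) z) + (v (maxn N M) z - g z)); last by ring.
  by move=> h; rewrite (le_trans (cabsD _ _))// [leRHS]splitr lerD.
exists g => //; split=> //.
rewrite (mixed_normE q phi p1 eg).
apply: (@radial_norm_lim _ q phi q1 hphi (fun n => rmean p (v n))).
- by move=> n; exact: (rmean_profile p1 (ev n)).
- exact: (rmean_profile p1 eg).
- move=> r r0; apply/cvgrPdist_le => e e0; have [N NP] := ug r r0 e e0.
  exists N => // n Nn; rewrite distrC; apply: (rmean_dist (ev n) eg r0) => z zr.
  by apply: NP => //; rewrite zr.
- by move=> n; rewrite -(mixed_normE q phi p1 (ev n)).
Qed.

End NormalFamilies.

(** * Sufficiency *)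

Section Sufficiency.
Context {R : realType}.
Implicit Types (f g h : R[i] -> R[i]) (z w : R[i]) (r e : R).
Variables (p q : \bar R) (phi : R -> R).
Variable mu : {measure set (measurableTypeR R) -> \bar R}.
Hypothesis p1 : (1 <= p)%E.
Hypothesis q1 : (1 <= q)%E.
Hypothesis hphi : classC q phi.
Hypothesis mu01 : mu `]0%R, 1%R]%classic = 0%E.
Hypothesis mass : (\int[mu]_(t in `]0%R, +oo[) (t^-1)%:E < +oo)%E.
Local Notation norm := (mixed_norm p q phi).
Local Notation Dpos := (`]0%R, +oo[%classic : set R).
Local Notation E1 := (`]1%R, +oo[%classic : set R).

Let mE1 : measurable E1. Proof. exact: measurable_itv. Qed.

Let E1_pos : E1 `<=` Dpos.
Proof. by move=> t; rewrite /= !in_itv/= !andbT; exact: lt_trans. Qed.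

Let inv_ge0 t : Dpos t -> (0 <= (t^-1)%:E)%E.
Proof. by rewrite /= in_itv/= andbT => t0; rewrite lee_fin invr_ge0 ltW. Qed.

Let minv (D : set R) : measurable D -> D `<=` Dpos ->
  measurable_fun D (fun t : R => (t^-1)%:E).
Proof. by move=> mD D0; apply/measurable_EFinP; exact: measurable_inv. Qed.

Let sub_fin (D : set R) : measurable D -> D `<=` E1 ->
  exists W : R, (\int[mu]_(t in D) (t^-1)%:E = W%:E)%E.
Proof.
move=> mD DE; have D0 := subset_trans DE E1_pos.
exists (fine (\int[mu]_(t in D) (t^-1)%:E)%E); rewrite fineK// ge0_fin_numE.
  apply: le_lt_trans mass; apply: ge0_subset_integral => //.
  exact: (minv (measurable_itv _) (@subset_refl _ _)).
by apply: integral_ge0 => t /D0/inv_ge0.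
Qed.

(** The measure of density 1 / t is finite on ]1, +oo[, hence continuous at 1. *)
Let split_mass e : 0 < e -> exists2 l : R, 1 < l & exists2 a : R,
  a <= e & (\int[mu]_(t in `]1%R, l[) (t^-1)%:E = a%:E)%E.
Proof.
move=> e0; have [W EW] := sub_fin mE1 (@subset_refl _ _).
pose F (n : nat) : set R := `[1 + n.+1%:R^-1, +oo[%classic.
have FE n : F n `<=` E1.
  move=> t; rewrite /F /= !in_itv/= !andbT; apply: lt_le_trans.
  by rewrite ltrDl invr_gt0.
have UF : \bigcup_n F n = E1.
  apply/seteqP; split => [t [n _]|t]; first exact: FE.
  rewrite /= in_itv/= andbT -subr_gt0 => t1.
  have [N _ NP] := near_infty_natSinv_lt (PosNum t1).
  exists N => //; rewrite /F /= in_itv/= andbT -lerBrDl ltW//.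
  exact: (NP N (leqnn N)).
have lim : (\int[mu]_(t in F n) (t^-1)%:E)%E @[n --> \oo] -->
    (\int[mu]_(t in \bigcup_n F n) (t^-1)%:E)%E.
  apply: (@ge0_nondecreasing_set_cvg_integral _ (measurableTypeR R) _ F
    (fun t => (t^-1)%:E) mu).
  - apply/nondecreasing_seqP => n; rewrite subsetEset; apply: subset_itvr.
    by rewrite bnd_simp lerD2l lef_pV2 ?posrE// ler_nat.
  - by move=> n; exact: measurable_itv.
  - by move=> n; exact: (minv (measurable_itv _) (subset_trans (FE n) E1_pos)).
  - by move=> n t /FE/E1_pos/inv_ge0.
rewrite UF EW in lim; have /fine_cvgP[_ /cvgrPdist_le/(_ e e0)[N _ NP]] := lim.
have mF : measurable (F N) by exact: measurable_itv.
have [b Fb] := sub_fin mF (FE N).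
pose l : R := 1 + N.+1%:R^-1; have l1 : 1 < l by rewrite ltrDl invr_gt0.
have mL : measurable (`]1%R, l[%classic : set R) by exact: measurable_itv.
have LE : `]1%R, l[%classic `<=` E1 by exact: subset_itvl.
have [a La] := sub_fin mL LE.
exists l => //; exists a => //.
have := NP N (leqnn N); rewrite /= Fb /=; apply: le_trans.
suff -> : W = a + b by rewrite addrK ler_norm.
apply: EFin_inj; rewrite EFinD -EW -La -Fb -ge0_integral_setU//.
- congr (integral _ _ _); rewrite /F.
  by rewrite -itv_bndbnd_setU ?bnd_simp// ltW.
- by apply: minv; [exact: measurableU|rewrite subUset; split; [exact: subset_trans LE E1_pos|exact: subset_trans (FE N) E1_pos]].
- by move=> t [/LE|/FE] /E1_pos/inv_ge0.
- rewrite disj_set2E; apply/eqP/seteqP; split => // t [].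
  by rewrite /F /= !in_itv/= andbT => /andP[_ h1] /(lt_le_trans h1); rewrite ltxx.
Qed.

Let W : R := fine (\int[mu]_(t in E1) (t^-1)%:E)%E.

Let EW : (\int[mu]_(t in E1) (t^-1)%:E = W%:E)%E.
Proof. by have [w Ew] := sub_fin mE1 (@subset_refl _ _); rewrite /W Ew. Qed.

Local Notation H := (hausdorff_on mu E1).

Let DposD : Dpos `\` `]0%R, 1%R]%classic = E1.
Proof.
apply/seteqP; split => t.
  move=> [] /=; rewrite !in_itv/= !andbT => t0 /negP.
  by rewrite t0/= -ltNge.
rewrite /= !in_itv/= !andbT => t1; split; first exact: lt_trans t1.
by apply/negP; rewrite negb_and -!ltNge t1 orbT.
Qed.

Let mDpos : measurable Dpos. Proof. exact: measurable_itv. Qed.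

Lemma hausdorff_well_defined f : entire f -> hausdorff_defined mu f.
Proof.
move=> ef z.
have [iR iI] := hausdorff_on_integrable mE1 (@subset_refl _ _) EW z ef.
have [mRe mIm] := measurable_integrand z ef mDpos (@subset_refl _ _).
have m01 : measurable (`]0%R, 1%R]%classic : set R) by exact: measurable_itv.
have lift (u : R -> R) : measurable_fun Dpos u -> mu.-integrable E1 (EFin \o u) ->
    mu.-integrable Dpos (EFin \o u).
  move=> mu' iu; have mu'' : measurable_fun Dpos (EFin \o u) by exact/measurable_EFinP.
  have [_] := @negligible_integrable _ (measurableTypeR R) R mu _ _ _ m01 mDpos mu'' mu01.
  by rewrite DposD; exact.
split; [exact: (lift _ mRe iR)|exact: (lift _ mIm iI)].
Qed.

Lemma hausdorffE f : entire f -> hausdorff mu f = H f.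
Proof.
move=> ef; apply: funext => z; have [iR iI] := hausdorff_well_defined ef z.
have m01 : measurable (`]0%R, 1%R]%classic : set R) by exact: measurable_itv.
congr (_ +i* _); rewrite /Rintegral; congr fine;
  by rewrite (@negligible_integral _ (measurableTypeR R) R mu _ _ _ m01 mDpos _ mu01) ?DposD.
Qed.

(** Dilations by factors larger than 1 contract the integral means on each circle. *)
Lemma norm_hausdorff f : entire f -> (norm (H f) <= W%:E * norm f)%E.
Proof.
move=> ef; have eH := hausdorff_on_entire mE1 (@subset_refl _ _) EW ef.
have W0 : 0 <= W.
  by rewrite -lee_fin -EW; apply: integral_ge0 => t /E1_pos/inv_ge0.
rewrite (mixed_normE q phi p1 eH) (mixed_normE q phi p1 ef).
have pf := rmean_profile p1 ef.
rewrite -(radial_normZ q1 hphi W0 pf).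
apply: (le_radial_norm q1 hphi (rmean_profile p1 eH) (profileZ W0 pf)) => r r0.
rewrite -lee_fin EFinM -(rmeanE p1 eH r0) -(rmeanE p1 ef r0).
exact: (mean_hausdorff_on mE1 (@subset_refl _ _) EW p1 r0 ef).
Qed.

(** A dilation by a factor at least l > 1 sends the circle of radius r into a
    smaller disc, where a Taylor polynomial approximates with an error that
    decays geometrically. There are n + 1 coefficients, one at least, because at
    z = 0 the constant term alone gives the bound. *)
Lemma taylor_dilation h z t (l : R) n : 1 < l -> l <= t -> entire h ->
  cabs (h (z / t%:C)) <= \sum_(k < n.+1) cabs (coef h k) * cabs z ^+ k +
    l^-1 ^+ n.+1 * (1 - l^-1)^-1 * rmean p h (cabs z).
Proof.
move=> l1 lt eh; have l0 : 0 < l := lt_trans ltr01 l1; have t0 : 0 < t := lt_le_trans l0 lt.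
have li : l^-1 < 1 by rewrite invf_lt1.
have c0 : 0 <= l^-1 ^+ n.+1 * (1 - l^-1)^-1.
  by rewrite mulr_ge0 ?exprn_ge0 ?invr_ge0 ?(ltW l0)// subr_ge0 ltW.
have m0 : 0 <= rmean p h (cabs z) by rewrite (rmean_profile p1 eh).2 ?cabs_ge0.
have s0 (F : nat -> nat) : 0 <= \sum_(k < n) cabs (coef h (F k)) * cabs z ^+ (F k).
  by apply: sumr_ge0 => k _; rewrite mulr_ge0 ?exprn_ge0 ?cabs_ge0.
have [zE|z0] := eqVneq z 0.
  rewrite zE cabs0 in s0 m0 *; rewrite mul0r big_ord_recl/= expr0 mulr1 (ccoef0 eh) -addrA lerDl.
  exact: addr_ge0 (s0 S) (mulr_ge0 c0 m0).
have r0 : 0 < cabs z by rewrite cabs_gt0.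
have tl : t^-1 <= l^-1 by rewrite lef_pV2 ?posrE.
have t1 : t^-1 < 1 := le_lt_trans tl li.
have zt : cabs (z / t%:C) = cabs z / t by rewrite cabs_div_real.
have ztr : cabs (z / t%:C) < cabs z by rewrite zt gtr_pMr.
have := taylor_remainder n.+1 eh ztr; set S := \sum_(j < n.+1) _ => rem.
rewrite (_ : h _ = S + (h (z / t%:C) - S)); last by rewrite addrC subrK.
rewrite (le_trans (cabsD _ _))// lerD//.
  apply: (le_trans (cabs_sum n.+1 (fun j => coef h j * (z / t%:C) ^+ j))).
  apply: ler_sum => j _; rewrite cabsM cabsX ler_wpM2l ?cabs_ge0//.
  by rewrite lerXn2r ?nnegrE ?cabs_ge0// ltW.
rewrite zt in rem ztr; have q0 : 0 <= cabs z / (cabs z - cabs z / t).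
  by rewrite divr_ge0 ?(ltW r0)// subr_ge0 ltW.
have tE : cabs z / t / cabs z = t^-1 by rewrite mulrAC divff ?gt_eqF// mul1r.
apply: (le_trans rem); rewrite tE -[leRHS]mulrA.
apply: ler_pM.
- by rewrite exprn_ge0// invr_ge0 ltW.
- by rewrite mulr_ge0 ?l1mean_ge0.
- by rewrite lerXn2r ?nnegrE ?invr_ge0 ?(ltW l0) ?(ltW t0).
apply: ler_pM; rewrite ?l1mean_ge0//.
- have -> : cabs z / (cabs z - cabs z / t) = (1 - t^-1)^-1.
    rewrite -[X in X - _]mulr1 -mulrBr invfM mulrA divff ?mul1r// gt_eqF//.
  by rewrite lef_pV2 ?posrE ?subr_gt0// lerD2l lerN2.
- exact: (l1mean_le_rmean p1 eh (ltW r0)).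
Qed.

Lemma radial_norm_poly (a : nat -> R) n : (forall k, 0 <= a k) ->
  profile (fun r => \sum_(k < n) a k * r ^+ k) /\
  (radial_norm q phi (fun r => \sum_(k < n) a k * r ^+ k)%R <=
   (\sum_(k < n) a k * monomial_norm q phi k)%:E)%E.
Proof.
move=> a0; elim: n => [|n [pn ih]].
  have E : (fun r : R => \sum_(k < 0) a k * r ^+ k) = (fun r => 0 * r ^+ 0).
    by apply: funext => r; rewrite big_ord0 mul0r.
  rewrite E big_ord0; split; first exact: profileZ (lexx 0) (profileX 0).
  by rewrite (radial_normZ q1 hphi (lexx 0) (profileX 0)) mul0e.
have E : (fun r : R => \sum_(k < n.+1) a k * r ^+ k) =
    (fun r => \sum_(k < n) a k * r ^+ k + a n * r ^+ n).
  by apply: funext => r; rewrite big_ord_recr.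
have pX := profileZ (a0 n) (profileX n).
rewrite E; split; first exact: profileD.
apply: (le_trans (radial_normD q1 hphi pn pX)).
rewrite big_ord_recr/= EFinD leeD// (radial_normZ q1 hphi (a0 n) (profileX n)).
by rewrite (monomial_normE q1 hphi) -EFinM.
Qed.

(** Up to a small multiple of the norm, the image depends only on finitely many
    Taylor coefficients: this is what makes the operator compact. Dilations
    by factors close to 1 carry little mass; the others are well approximated
    by Taylor polynomials. *)
Lemma hausdorff_approx e : 0 < e -> exists n, exists2 c : R, 0 <= c &
  forall h (B : R), entire h -> (norm h <= B%:E)%E ->
  (norm (H h) <= (e * B + c * \sum_(k < n) cabs (coef h k) * monomial_norm q phi k)%:E)%E.
Proof.
move=> e0; have e2 : 0 < e / 2 by rewrite divr_gt0.
have [l l1 [a ae La]] := split_mass e2.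
have l0 : 0 < l := lt_trans ltr01 l1.
have mL : measurable (`]1%R, l[%classic : set R) by exact: measurable_itv.
have LE : `]1%R, l[%classic `<=` E1 by exact: subset_itvl.
have mF : measurable (`[l, +oo[%classic : set R) by exact: measurable_itv.
have FE : `[l, +oo[%classic `<=` E1 by apply: subset_itvr; rewrite bnd_simp.
have [c Fc] := sub_fin mF FE.
have c0 : 0 <= c.
  by rewrite -lee_fin -Fc; apply: integral_ge0 => t /FE/E1_pos/inv_ge0.
have a0 : 0 <= a.
  by rewrite -lee_fin -La; apply: integral_ge0 => t /LE/E1_pos/inv_ge0.
have li : 0 <= l^-1 < 1 by rewrite invr_ge0 (ltW l0)/= invf_lt1.
have [n nP] := geometric_small ((1 - l^-1)^-1 * c) li e2.
exists n.+1, c => // h B eh hB.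
have eHE := hausdorff_on_entire mE1 (@subset_refl _ _) EW eh.
have eL := hausdorff_on_entire mL LE La eh.
have eF := hausdorff_on_entire mF FE Fc eh.
have HLF : H h = (fun z => hausdorff_on mu `]1%R, l[%classic h z +
    hausdorff_on mu `[l, +oo[%classic h z).
  have U : E1 = `]1%R, l[%classic `|` `[l, +oo[%classic.
    by rewrite -itv_bndbnd_setU ?bnd_simp// ltW.
  apply: funext => z; have [iR iI] := hausdorff_on_integrable mE1 (@subset_refl _ _) EW z eh.
  have D : [disjoint (`]1%R, l[%classic : set R) & (`[l, +oo[%classic : set R)].
    rewrite disj_set2E; apply/eqP/seteqP; split => // t [].
    by rewrite /= !in_itv/= andbT => /andP[_ h1] /(lt_le_trans h1); rewrite ltxx.
  rewrite /hausdorff_on; apply: complex_ext; rewrite ?cReD ?cImD /cintegral/=.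
    by rewrite U Rintegral_setU// -U.
  by rewrite U Rintegral_setU// -U.
pose b := l^-1 ^+ n.+1 * (1 - l^-1)^-1 * c.
have d0 : 0 <= l^-1 ^+ n.+1 * (1 - l^-1)^-1.
  case/andP: li => li0 li1; apply: mulr_ge0; first exact: exprn_ge0.
  by rewrite invr_ge0 subr_ge0 ltW.
have b0 : 0 <= b by exact: mulr_ge0.
have be : b <= e / 2 by rewrite /b -mulrA; exact: nP.
pose P r : R := \sum_(k < n.+1) (c * cabs (coef h k)) * r ^+ k.
have ck k : 0 <= c * cabs (coef h k) by rewrite mulr_ge0 ?cabs_ge0.
have [pP NP] := radial_norm_poly n.+1 ck.
have ph := rmean_profile p1 eh.
have ab0 : 0 <= a + b by rewrite addr_ge0.
have pab := profileZ ab0 ph.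
have B0 : 0 <= B.
  by rewrite -lee_fin (le_trans _ hB)// (mixed_normE q phi p1 eh); exact: radial_norm_ge0.
have mean_bound r : 0 <= r -> rmean p (H h) r <= (a + b) * rmean p h r + P r.
  move=> r0.
  have S0 : 0 <= \sum_(k < n.+1) cabs (coef h k) * r ^+ k.
    by apply: sumr_ge0 => k _; rewrite mulr_ge0 ?exprn_ge0 ?cabs_ge0.
  pose M := (\sum_(k < n.+1) cabs (coef h k) * r ^+ k +
    l^-1 ^+ n.+1 * (1 - l^-1)^-1 * rmean p h r).
  have M0 : 0 <= M by apply: addr_ge0 => //; apply: mulr_ge0 => //; exact: ph.2.
  have far : (integral_mean p (hausdorff_on mu `[l, +oo[%classic h) r <= (M * c)%:E)%E.
    rewrite (_ : M * c = cabs (M * c)%:C); last by rewrite cabs_real ger0_norm// mulr_ge0.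
    rewrite -(mean_cst p1 (M * c)%:C r0); apply: le_mean => //.
    - exact: (entire_circ r eF).
    - by apply: circ_cderivable => z _; exact: cderivable_cst.
    move=> z zr; rewrite cabs_real ger0_norm ?mulr_ge0//.
    apply: (hausdorff_on_le mF FE Fc eh M0) => t; rewrite /= in_itv/= andbT => lt.
    by rewrite /M -zr; exact: taylor_dilation.
  rewrite -lee_fin -(rmeanE p1 eHE r0) HLF.
  apply: (le_trans (meanD p1 r0 (entire_circ r eL) (entire_circ r eF))).
  have near := mean_hausdorff_on mL LE La p1 r0 eh.
  apply: (le_trans (leeD near far)); rewrite (rmeanE p1 eh r0) -EFinM -EFinD lee_fin.
  rewrite le_eqVlt; apply/orP; left; apply/eqP.
  have -> : P r = c * \sum_(k < n.+1) cabs (coef h k) * r ^+ k.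
    by rewrite mulr_sumr; apply: eq_bigr => k _; rewrite mulrA.
  rewrite /M /b; ring.
rewrite (mixed_normE q phi p1 eHE).
have pHE := rmean_profile p1 eHE.
apply: (le_trans (le_radial_norm q1 hphi pHE (profileD pab pP) mean_bound)).
apply: (le_trans (radial_normD q1 hphi pab pP)).
rewrite EFinD; apply: leeD.
  rewrite (radial_normZ q1 hphi ab0 ph) -(mixed_normE q phi p1 eh).
  apply: (le_trans (lee_wpmul2l _ hB)); first by rewrite lee_fin.
  by rewrite -EFinM lee_fin ler_wpM2r// [leRHS]splitr lerD.
apply: (le_trans NP); rewrite lee_fin mulr_sumr.
by apply: ler_sum => k _; rewrite mulrA.
Qed.

(** A bounded sequence has a locally uniformly convergent subsequence; the
    coefficients of the differences tend to 0, hence so do the norms of their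
    images by [hausdorff_approx]. *)
Lemma compact_of_mass : hausdorff_compact p q phi mu.
Proof.
split; first by move=> f [ef _]; exact: hausdorff_well_defined.
have eH f : entire f -> entire (H f).
  by move=> ef; exact: (hausdorff_on_entire mE1 (@subset_refl _ _) EW ef).
have FockH f : Fock p q phi f -> Fock p q phi (hausdorff mu f).
  move=> [ef nf]; rewrite (hausdorffE ef); split; first exact: eH.
  apply: (le_lt_trans (norm_hausdorff ef)).
  have n0 : (0 <= norm f)%E.
    by rewrite (mixed_normE q phi p1 ef); exact: radial_norm_ge0 (rmean_profile p1 ef).
  by rewrite -(@fineK _ (norm f)) ?ge0_fin_numE// -EFinM ltry.
split=> //.
- move=> a f g [ef _] [eg _].
  have df := hausdorff_well_defined ef; have dg := hausdorff_well_defined eg.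
  apply: funext => z.
  rewrite /hausdorff -(cintegralZ mDpos a (df z)) -(cintegralD mDpos); last 2 first.
  - exact: cintegrableZ mDpos a _ (df z).
  - exact: dg.
  congr cintegral; apply: funext => t; rewrite /hausdorff_integrand; ring.
move=> u Fu [B uB].
have eu n : entire (u n) by have [] := Fu n.
have [sigma smono [g eg [gB ug]]] := normal_family p1 q1 hphi eu uB.
have Fg : Fock p q phi g by split => //; exact: le_lt_trans gB (ltry _).
exists sigma, (hausdorff mu g); first exact: FockH.
split=> //.
pose h n := (fun z => u (sigma n) z - g z).
have eh n : entire (h n) by exact: (entireB (eu (sigma n)) eg).
have hB n : (norm (h n) <= (B + B)%:E)%E.
  have pu := rmean_profile p1 (eu (sigma n)); have pg := rmean_profile p1 eg.
  rewrite (mixed_normE q phi p1 (eh n)).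
  apply: (le_trans (le_radial_norm q1 hphi (rmean_profile p1 (eh n)) (profileD pu pg) _)).
    by move=> r r0; exact: (rmeanB p1 (eu (sigma n)) eg r0).
  apply: (le_trans (radial_normD q1 hphi pu pg)).
  rewrite -(mixed_normE q phi p1 (eu (sigma n))) -(mixed_normE q phi p1 eg) EFinD.
  exact: leeD.
have E : (fun n => norm (fun z => hausdorff mu (u (sigma n)) z - hausdorff mu g z)) =
    (fun n => norm (H (h n))).
  apply: funext => n; congr mixed_norm; apply: funext => z.
  rewrite (hausdorffE (eu (sigma n))) (hausdorffE eg).
  by rewrite (hausdorff_onB mE1 (@subset_refl _ _) EW z (eu (sigma n)) eg).
rewrite E; apply/cvge0P.
  move=> n; rewrite (mixed_normE q phi p1 (eH _ (eh n))).
  exact: radial_norm_ge0 (rmean_profile p1 (eH _ (eh n))).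
move=> e e0.
have B0 : 0 <= B.
  rewrite -lee_fin; apply: le_trans gB; rewrite (mixed_normE q phi p1 eg).
  exact: radial_norm_ge0 (rmean_profile p1 eg).
have e2 : 0 < e / 2 by rewrite divr_gt0.
(* The differences have norm at most B + B; adding 1 avoids a zero divisor. *)
have d0 : 0 < e / 2 / (B + B + 1) by rewrite divr_gt0// ltr_wpDl// addr_ge0.
have [K [c c0 KP]] := hausdorff_approx d0.
have [|M MP] := @sum_small R (fun n k => c * (cabs (coef (h n) k) * monomial_norm q phi k)) K _ _ e2.
  move=> k e' e'0.
  have m0 := monomial_norm_gt0 q1 hphi k.
  have C0 : 0 < c * monomial_norm q phi k + 1 by rewrite ltr_wpDl// mulr_ge0// ltW.
  have [N NP] := ug 1 ler01 _ (divr_gt0 e'0 C0); exists N => n Nn.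
  have ck : cabs (coef (h n) k) <= e' / (c * monomial_norm q phi k + 1).
    have := cabs_coef k (eh n) ltr01; rewrite expr1n mulr1 => /le_trans; apply.
    rewrite -[leRHS](avg_cst); apply: le_avg.
    - exact: (circ_abs (entire_circ 1 (eh n))).
    - by move=> x _; exact: cvg_cst.
    - by move=> t; apply: NP => //; rewrite cabs_polar normr1.
  rewrite mulrCA; apply: (le_trans (ler_wpM2r _ ck)).
    by rewrite mulr_ge0// ltW.
  by rewrite mulrAC ler_pdivrMr// ler_pM2l// lerDl.
exists M => n Mn; apply: (le_trans (KP (h n) _ (eh n) (hB n))).
rewrite lee_fin [leRHS]splitr lerD//.
  by rewrite mulrAC ler_pdivrMr ?ltr_wpDl ?addr_ge0// ler_pM2l// lerDl.
by rewrite mulr_sumr; exact: MP.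
Qed.

End Sufficiency.

(** * Characterization of compactness *)

Theorem theorem5 (R : realType) (p q : \bar R) (phi : R -> R)
    (mu : {measure set (measurableTypeR R) -> \bar R})
    (hp : (1 <= p)%E) (hq : (1 <= q)%E)
    (hphi : classC q phi)
    (hmon : (mixed_norm p q phi (fun z : R[i] => (z ^+ n)%R) `^ (n%:R^-1))%E
              @[n --> \oo] --> +oo%E) :
  hausdorff_compact p q phi mu <->
  mu `]0%R, 1%R]%classic = 0%E /\ (\int[mu]_(t in `]0%R, +oo[) (t^-1)%:E < +oo)%E.
Proof.
split=> [[defined compact]|[mu01 mass]]; last exact: (compact_of_mass hp hq hphi mu01 mass).
split; first exact: (null_of_compact hp hq hphi defined compact).
exact: (mass_of_defined hp hq hphi defined).
Qed.
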